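(* Let $W(\cdot)$ be a sample-path continuous, intrinsically stationary Gaussian random field on $\mathbb{R}^d$ with variogram $\gamma$, mean $\mathbb{E}W(t)=0$ and variance $\sigma^2(t)=\mathrm{Var}(W(t))$, $t\in\mathbb{R}^d$. Let $W_i(\cdot)$, $i\in\mathbb{N}$, be independent copies of $W(\cdot)$. Let $Q$ be a probability measure on $\mathbb{R}^d$ and let $\Pi=\sum_{i\in\mathbb{N}}\delta_{(X_i,H_i)}$ be a Poisson point process on $\mathbb{R}\times\mathbb{R}^d$, independent of $\{W_i(\cdot): i\in\mathbb{N}\}$, with intensity measure $e^{-x}\,dx\,Q(dh)$. Then $$\tilde Z(t):=\max_{i\in\mathbb{N}}\left(X_i+W_i(t-H_i)-\frac{\sigma^2(t-H_i)}{2}\right),\qquad t\in\mathbb{R}^d,$$ is a Brown-Resnick process associated to the variogram $\gamma$, i.e. $\tilde Z\stackrel{d}{=}Z$, where $Z$ is the Brown-Resnick process associated to $\gamma$.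
   Context: A random field $W$ on $\mathbb{R}^d$ is intrinsically stationary if for every $h\in\mathbb{R}^d$ the field $\{W(x+h)-W(x):x\in\mathbb{R}^d\}$ is weakly stationary; its (semi-)variogram is $\gamma(h)=\frac12\mathbb{E}(W(h)-W(0))^2$. The Brown-Resnick process associated to $\gamma$ is the process $Z(t)=\max_{i\in\mathbb{N}}\big(X'_i+W'_i(t)-\frac{\sigma^2(t)}{2}\big)$, $t\in\mathbb{R}^d$, where $\sum_i\delta_{X'_i}$ is a Poisson point process on $\mathbb{R}$ with intensity measure $e^{-x}dx$ and $W'_i$ are independent copies of $W$ (a sample-path continuous, centred, intrinsically stationary Gaussian field with variogram $\gamma$ and variance $\sigma^2(\cdot)$), independent of the $X'_i$. It is a stationary max-stable process with standard Gumbel margins whose law depends only on $\gamma$. The relation $\stackrel{d}{=}$ denotes equality of all finite-dimensional distributions. *)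

(* Defs.v *)
From HB Require Import structures.
From mathcomp Require Import all_boot all_order all_algebra finmap.
From mathcomp Require Import all_classical all_reals all_analysis.
From mathcomp Require Import measurable_realfun.

Set Implicit Arguments.
Unset Strict Implicit.
Unset Printing Implicit Defensive.

Import Order.TTheory GRing.Theory Num.Theory.
Import numFieldNormedType.Exports.

Local Open Scope classical_set_scope.
Local Open Scope ring_scope.
Local Open Scope ereal_scope.

(* R^d with its Borel sigma-algebra; the carrier is convertible to ['rV[R]_d]. *)
Notation borel_rV R d := (g_sigma_algebraType (open : set (set 'rV[R]_d))).

Section independence.
Context {dT : measure_display} {T : measurableType dT} {R : realType}
  (P : probability T R).

Definition sigma_gen {dU : measure_display} {U : measurableType dU}
    (I : Type) (f : I -> T -> U) : set (set T) :=
  <<s \bigcup_(i in [set: I]) preimage_set_system setT (f i) measurable >>.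

Definition independent2 (F G : set (set T)) : Prop :=
  forall A B, F A -> G B -> P (A `&` B) = P A * P B.

Definition mutually_independent (I : choiceType) (F : I -> set (set T)) : Prop :=
  forall (J : {fset I}) (A : I -> set T), (forall i, i \in J -> F i (A i)) ->
    P (\bigcap_(i in [set` J]) A i) = \prod_(i <- J) P (A i).

End independence.

Section fields.
Context {dT : measure_display} {T : measurableType dT} {R : realType}
  (P : probability T R) (d : nat).
Implicit Types (Y : 'rV[R]_d -> T -> R).

Definition random_field Y : Prop := forall t, measurable_fun setT (Y t).

Definition continuous_paths Y : Prop :=
  forall w, continuous (fun t : 'rV[R]_d => Y t w).

(* N(m, s^2), where [s = 0] is the point mass at [m]; [normal_prob m 0] is
   not degenerate (it is the uniform law on [0, 1]). *)
Definition gaussian_law (m s : R) : set R -> \bar R :=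
  if s == 0%R then \d_m else normal_prob m s.

Definition gaussian_field Y : Prop :=
  forall (n : nat) (t : 'I_n -> 'rV[R]_d) (a : 'I_n -> R),
  exists m s : R, forall B : set R, measurable B ->
    P [set w | B (\sum_(i < n) a i * Y (t i) w)%R] = gaussian_law m s B.

Definition weakly_stationary Y : Prop :=
  [/\ forall x, Y x \in Lfun P 2%:E,
      forall x y, 'E_P[Y x] = 'E_P[Y y] &
      forall x y h,
        covariance P (Y (x + h)%R) (Y (y + h)%R) = covariance P (Y x) (Y y)].

Definition intrinsically_stationary Y : Prop :=
  forall h, weakly_stationary (fun x w => Y (x + h) w - Y x w)%R.

Definition is_variogram Y (gamma : 'rV[R]_d -> R) : Prop :=
  forall h, (gamma h)%:E = 2^-1%:E * 'E_P[(fun w => (Y h w - Y 0 w) ^+ 2)%R].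

Definition centred Y : Prop := forall t, 'E_P[Y t] = 0.

Definition field_variance Y (t : 'rV[R]_d) : R := fine 'V_P[Y t].

(* The fields from which Brown-Resnick processes are built. *)
Definition brown_resnick_field Y (gamma : 'rV[R]_d -> R) : Prop :=
  [/\ random_field Y, continuous_paths Y & gaussian_field Y] /\
  [/\ intrinsically_stationary Y, is_variogram Y gamma & centred Y].

End fields.

Definition eq_fdd (R : realType) (d : nat)
    {d1 : measure_display} {T1 : measurableType d1} (P1 : probability T1 R)
    (Y1 : 'rV[R]_d -> T1 -> R)
    {d2 : measure_display} {T2 : measurableType d2} (P2 : probability T2 R)
    (Y2 : 'rV[R]_d -> T2 -> R) : Prop :=
  forall (n : nat) (t : 'I_n -> 'rV[R]_d) (B : set (n.-tuple R)),
    measurable B ->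
    P1 [set w | B [tuple Y1 (t i) w | i < n]] =
    P2 [set w | B [tuple Y2 (t i) w | i < n]].

(* The copies are copies of Y as a random element of C(R^d): their paths are
   continuous too, so that equality of the finite-dimensional distributions is
   equality in law. *)
Definition independent_copies (R : realType) (d : nat)
    {d0 : measure_display} {T0 : measurableType d0} (P0 : probability T0 R)
    (Y : 'rV[R]_d -> T0 -> R)
    {dT : measure_display} {T : measurableType dT} (P : probability T R)
    (Yi : nat -> 'rV[R]_d -> T -> R) : Prop :=
  [/\ forall i, random_field (Yi i), forall i, continuous_paths (Yi i),
      forall i, eq_fdd P (Yi i) P0 Y &
      mutually_independent P (fun i => sigma_gen (Yi i))].

Section poisson_point_process.
Context {dT : measure_display} {T : measurableType dT} {R : realType}
  (P : probability T R) {dU : measure_display} {U : measurableType dU}.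

(* The number of points in A, i.e. (\sum_i \delta_{xi_i})(A). *)
Definition point_count (xi : nat -> T -> U) (A : set U) (w : T) : \bar R :=
  \sum_(0 <= i <oo) \d_(xi i w) A.

(* N has the Poisson law of mean l; it is +oo almost surely when l = +oo. The
   second argument of [poisson_prob] is a dummy. *)
Definition poisson_distributed (N : T -> \bar R) (l : \bar R) : Prop :=
  match l with
  | r%:E => forall k : nat,
      P [set w | N w = k%:R%:E] = poisson_prob r 0%N [set k]
  | +oo => P [set w | N w = +oo] = 1
  | -oo => False
  end.

Definition poisson_point_process (xi : nat -> T -> U) (mu : set U -> \bar R)
    : Prop :=
  [/\ forall i, measurable_fun setT (xi i),
      forall A, measurable A -> poisson_distributed (point_count xi A) (mu A) &
      forall (n : nat) (A : 'I_n -> set U), (forall j, measurable (A j)) ->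
        trivIset setT A ->
        mutually_independent P
          (fun j =>
             g_sigma_algebra_preimage (point_count xi (A j)))].

End poisson_point_process.

(* The measure e^{-x} dx on R. *)
Definition gumbel_intensity (R : realType) (A : set R) : \bar R :=
  \int[lebesgue_measure]_(x in A) (expR (- x))%:E.

(* The measure e^{-x} dx Q(dh) on R x R^d. *)
Definition gumbel_prod_intensity (R : realType) (d : nat)
    (Q : probability (borel_rV R d) R) (A : set (R * borel_rV R d)) : \bar R :=
  \int[lebesgue_measure \x Q]_(z in A) (expR (- z.1))%:E.

Section maximum.
Context {R : realType}.

Definition is_max (u : nat -> R) (m : R) : Prop :=
  range u m /\ ubound (range u) m.

(* The value is irrelevant when the maximum is not attained. *)
Definition max_seq (u : nat -> R) : R := xget 0%R (is_max u).

End maximum.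

(* Z is obtained by the Brown-Resnick construction from some field Y, on an
   auxiliary space, with variogram gamma; the Poisson points are independent of
   the copies as a sequence, not only as a point measure. *)
Definition brown_resnick_process (R : realType) (d : nat)
    (gamma : 'rV[R]_d -> R)
    {dT : measure_display} {T : measurableType dT} (P : probability T R)
    (Z : 'rV[R]_d -> T -> R) : Prop :=
  exists (d0 : measure_display) (T0 : measurableType d0)
    (P0 : probability T0 R) (Y : 'rV[R]_d -> T0 -> R)
    (Yi : nat -> 'rV[R]_d -> T -> R) (X : nat -> T -> R),
  [/\ brown_resnick_field P0 Y gamma,
      independent_copies P0 Y P Yi,
      poisson_point_process P X (@gumbel_intensity R),
      independent2 P (sigma_gen X)
        (sigma_gen (fun it : nat * 'rV[R]_d => Yi it.1 it.2)) &
      forall t w, Z t w =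
        max_seq (fun i => X i w + Yi i t w - field_variance P0 Y t / 2)%R].

(* Main.v *)
Require Import Defs.
From HB Require Import structures.
From mathcomp Require Import all_boot all_order all_algebra finmap.
From mathcomp Require Import all_classical all_reals all_analysis.
From mathcomp Require Import measurable_realfun.
From mathcomp Require Import ring lra.

Set Implicit Arguments.
Unset Strict Implicit.
Unset Printing Implicit Defensive.

Import Order.TTheory GRing.Theory Num.Theory.
Import numFieldNormedType.Exports.

Local Open Scope classical_set_scope.
Local Open Scope ring_scope.

(** Both processes are maxima of heights [x + V (t - h) - sigma2 (t - h) / 2] over the
    points [u] of a Poisson process with intensity [exp (- x u)], where [x] and [h] are
    the height and the shift of the point and [V] is an independent copy of the field
    attached to it; the Brown-Resnick construction has all shifts [h] equal to zero. It
    is enough to compare the probabilities that such a maximum stays below levels [y] at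
    finitely many sites [t] ([distribution_function_determines]).

    That event says that no point exceeds a level at a site. With [p u] the probability
    that a point at [u] exceeds, its probability is [exp (- l)] with [l] the integral of
    [p] against the intensity. To see this, the event is written as the limit of
    products over the first points. By independence of the points and the copies
    ([unit_mean_decoupling]) the copies can be averaged out for frozen points, which
    replaces each factor by [1 - p u] ([mean_prod_marks]). The limit of the mean of
    these products is the generating functional of the Poisson process
    ([generating_functional]); it is obtained by approximating [p] with dyadic step
    functions, for which it reads off the joint law of the counts of disjoint sets.
    Taking [q * p] with small [q] in place of [p] shows that the number of exceedances
    is finite ([exceed_count_fin]), so that the maximum is attained ([max_attained]).

    It remains to compute [l]. For a fixed shift [h] it is the exceedance mass at the
    sites [t j - h], that is the mean of the mass which [exp (- x) dx] gives to the
    heights [x] such that [x + Y (t j - h) - sigma2 (t j - h) / 2] exceeds [y j] for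
    some [j]. Since the measure [exp (- x) dx] is multiplied by a constant under
    translations, the value at one site [u i] can be absorbed in the height at the cost
    of the density [exp (Y (u i) - sigma2 (u i) / 2)], which has mean one
    ([exceedance_mass_tilted]). Under this tilted law the moment generating function of
    the increments from [u i] is the mean of the exponential of a combination whose
    coefficients add up to one, and this depends only on the variogram at the
    differences of the sites ([affine_mgf], [tilted_increment_mgf]). As finite moment
    generating functions determine laws ([mgf_determines_joint_law]), the exceedance
    mass depends neither on the shift [h] nor on the choice of the field with the given
    variogram ([exceedance_mass_variogram]). Averaging over [h] therefore changes
    nothing, and both processes have the same finite-dimensional distributions. *)

(** * Laws with a density *)

Section weighted_law.
Local Open Scope ereal_scope.
Context d1 d2 (T1 : measurableType d1) (T2 : measurableType d2) (R : realType).

Import HBNNSimple.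

(** An integral transfer rule that needs only the values of [nu] on sets; it covers
    image measures, densities and their combinations. *)
Lemma ge0_integral_weighted (mu : {measure set T1 -> \bar R})
    (nu : {measure set T2 -> \bar R}) (f : T1 -> R) (X : T1 -> T2)
    (g : T2 -> \bar R) :
  (forall x, (0 <= f x)%R) -> measurable_fun setT f -> measurable_fun setT X ->
  (forall A, measurable A -> \int[mu]_x (f x * \1_A (X x))%:E = nu A) ->
  (forall y, 0 <= g y) -> measurable_fun setT g ->
  \int[nu]_y g y = \int[mu]_x ((f x)%:E * g (X x)).
Proof.
move=> f0 mf mX nuE g0 mg.
pose h := nnsfun_approx measurableT mg.
have cvgh y : (EFin \o h n) y @[n --> \oo] --> g y by exact: cvg_nnsfun_approx.
have mhX n : measurable_fun setT (fun x => h n (X x)).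
  by apply: measurableT_comp => //; exact/measurable_funP.
have -> : \int[nu]_y g y = limn (fun n => \int[nu]_y (EFin \o h n) y).
  under eq_integral do rewrite -(cvg_lim _ (cvgh _))//.
  apply: monotone_convergence => //.
  - by move=> n; apply/measurable_EFinP; exact/measurable_funP.
  - by move=> n x _ /=; rewrite lee_fin.
  - by move=> x _ a b ab; rewrite lee_fin; exact/lefP/nd_nnsfun_approx.
have -> : \int[mu]_x ((f x)%:E * g (X x)) =
    limn (fun n => \int[mu]_x ((f x)%:E * (h n (X x))%:E)).
  have fg x : (f x)%:E * (h n (X x))%:E @[n --> \oo] --> (f x)%:E * g (X x).
    by apply: cvgeZl => //; exact: cvgh.
  under eq_integral do rewrite -(cvg_lim _ (fg _))//.
  apply: monotone_convergence => //.
  - by move=> n; apply: emeasurable_funM; exact/measurable_EFinP.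
  - by move=> n x _ /=; rewrite mule_ge0 ?lee_fin.
  - move=> x _ a b ab/=; rewrite lee_wpmul2l ?lee_fin//.
    exact/lefP/nd_nnsfun_approx.
congr (limn _); apply/funext => n.
have mhr r : measurable (h n @^-1` [set r]) by exact: measurable_funPTI.
transitivity (\sum_(r \in range (h n)) r%:E * nu (h n @^-1` [set r])).
  by rewrite integralT_nnsfun sintegralE.
transitivity (\int[mu]_x (\sum_(r \in range (h n))
    (r * (f x * \1_(h n @^-1` [set r]) (X x)))%:E)); last first.
  apply: eq_integral => x _; rewrite -EFinM [in RHS](fimfunE (h n) (X x)).
  rewrite fsumEFin//; congr EFin; rewrite fsbig_finite//= [in RHS]fsbig_finite//=.
  by rewrite mulr_sumr; apply: eq_bigr => r _; rewrite mulrCA.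
have mfi r : measurable_fun setT
    (fun x => (f x * \1_(h n @^-1` [set r]) (X x))%R : R).
  apply: measurable_funM => //.
  exact: (measurableT_comp (measurable_indic (mhr r)) mX).
rewrite ge0_integral_fsum//; last 2 first.
  - by move=> r; apply/measurable_EFinP; exact: measurable_funM.
  - move=> r x _; rewrite mulrCA lee_fin mulr_ge0// -lee_fin.
    exact: nnfun_muleindic_ge0.
apply: eq_fsbigr => r /[!inE] -[y _ yr].
under [RHS]eq_integral do rewrite EFinM.
rewrite ge0_integralZl//; first by rewrite nuE.
- exact/measurable_EFinP.
- by move=> x _; rewrite lee_fin mulr_ge0.
- by rewrite lee_fin -yr.
Qed.

End weighted_law.

Section weighted_law_measure.
Local Open Scope ereal_scope.
Context d1 d2 (T1 : measurableType d1) (T2 : measurableType d2) (R : realType).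
Context (mu : {measure set T1 -> \bar R}) (f : T1 -> R) (X : T1 -> T2).
Hypotheses (f0 : forall x, (0 <= f x)%R) (mf : measurable_fun setT f)
  (mX : measurable_fun setT X).

(** The law of [X] under the measure of density [f] with respect to [mu]. *)
Definition weighted_law (A : set T2) : \bar R :=
  \int[mu]_x (f x * \1_A (X x))%:E.

Let weighted_law0 : weighted_law set0 = 0.
Proof. by apply: integral0_eq => x _; rewrite indic0 mulr0. Qed.

Let weighted_law_ge0 A : 0 <= weighted_law A.
Proof. by apply: integral_ge0 => x _; rewrite lee_fin mulr_ge0. Qed.

Let weighted_law_sigma_additive : semi_sigma_additive weighted_law.
Proof.
move=> F mF tF mUF.
have E A : measurable A -> weighted_law A = \int[mu]_(x in X @^-1` A) (f x)%:E.
  move=> mA; rewrite [RHS]integral_mkcond; apply: eq_integral => x _.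
  rewrite patchE indicE; have [XA|XA] := pselect (A (X x)).
    by rewrite !mem_set// mulr1.
  by rewrite !memNset// mulr0.
have mXF i : measurable (X @^-1` F i) by rewrite -[X in measurable X]setTI; exact: mX.
rewrite E// preimage_bigcup ge0_integral_bigcup//.
- under eq_fun do under eq_bigr do rewrite E//.
  by apply: is_cvg_nneseries => n _ _; apply: integral_ge0 => x _; rewrite lee_fin.
- exact/measurable_funTS/measurable_EFinP.
- by move=> x _; rewrite lee_fin.
- apply/trivIsetP => /= i j _ _ ij; rewrite -preimage_setI.
  by move/trivIsetP : tF => /(_ _ _ _ _ ij) ->//; rewrite preimage_set0.
Qed.

HB.instance Definition _ := isMeasure.Build _ _ _ weighted_law
  weighted_law0 weighted_law_ge0 weighted_law_sigma_additive.

Definition weighted_measure : {measure set T2 -> \bar R} := weighted_law.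

Lemma ge0_integral_weighted_measure (g : T2 -> \bar R) :
  (forall y, 0 <= g y) -> measurable_fun setT g ->
  \int[weighted_measure]_y g y = \int[mu]_x ((f x)%:E * g (X x)).
Proof. by move=> g0 mg; exact: ge0_integral_weighted. Qed.

End weighted_law_measure.

(** * Limits of exponentials and of polynomials *)

Section elementary_limits.
Context {R : realType}.
Implicit Types x y c : R.

Lemma expR_sub1_le y : expR y - 1 <= y * expR y.
Proof.
have := expR_ge1Dx (- y); rewrite expRN => h.
have := ler_wpM2r (expR_ge0 y) h; rewrite mulVf ?gt_eqF ?expR_gt0// => h2.
by rewrite mulrDl mul1r mulNr in h2; lra.
Qed.

Lemma norm_expR_sub1_le y : `|expR y - 1| <= `|y| * expR `|y|.
Proof.
have [y0|y0] := leP 0 y.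
  rewrite !ger0_norm//; first exact: expR_sub1_le.
  by rewrite subr_ge0 -expR0 ler_expR.
rewrite !ltr0_norm ?subr_lt0 ?expR_lt1//.
have h1 := expR_ge1Dx y.
have h2 : 1 <= expR (- y) by rewrite -expR0 ler_expR oppr_ge0 ltW.
have : - y * 1 <= - y * expR (- y) by rewrite ler_wpM2l// oppr_ge0 ltW.
lra.
Qed.

Lemma le_expR_norm c x : expR (c * x) <= expR (`|c| * `|x|).
Proof. by rewrite ler_expR -normrM ler_norm. Qed.

Lemma cvg_expR_slope (x e : nat -> R) (l : R) : (forall n, 0 < e n) ->
  e n @[n --> \oo] --> (0 : R) -> x n @[n --> \oo] --> l ->
  (e n)^-1 * (expR (x n * e n) - 1) @[n --> \oo] --> l.
Proof.
move=> e_gt0 e0 xl.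
apply: (@squeeze_cvgr _ _ _ _ x (fun n => x n * expR (x n * e n))) => //.
- apply: nearW => n; rewrite ler_pdivlMl// ler_pdivrMl// mulrC.
  have := expR_ge1Dx (x n * e n); have := expR_sub1_le (x n * e n).
  by move=> h1 h2; apply/andP; split; lra.
- rewrite -[X in _ --> X]mulr1; apply: cvgM => //.
  suff : expR (x n * e n) @[n --> \oo] --> expR (l * 0) by rewrite mulr0 expR0.
  by apply: continuous_cvg; [exact: continuous_expR|exact: cvgM].
Qed.

Lemma cvg_exp_quotient x :
  n.+1%:R * (expR (x / n.+1%:R) - 1) @[n --> \oo] --> x.
Proof.
have : (n.+1%:R^-1)^-1 * (expR (x * n.+1%:R^-1) - 1) @[n --> \oo] --> x.
  apply: cvg_expR_slope; [|exact: cvg_harmonic|exact: cvg_cst].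
  by move=> n; rewrite invr_gt0.
by under eq_fun do rewrite invrK.
Qed.

Lemma norm_exp_quotient_le x n :
  `|n.+1%:R * (expR (x / n.+1%:R) - 1)| <= expR (2 * `|x|).
Proof.
have n0 : 0 < n.+1%:R :> R by rewrite ltr0n.
rewrite normrM (gtr0_norm n0).
have := norm_expR_sub1_le (x / n.+1%:R) => h.
rewrite -(ler_pM2l n0) in h; apply: (le_trans h).
rewrite normrM normfV (gtr0_norm n0) mulrA [n.+1%:R * _]mulrCA divff ?gt_eqF//.
rewrite mulr1 mulr_natl mulr2n expRD; apply: ler_pM; rewrite ?expR_ge0//.
  by have := expR_ge1Dx `|x|; lra.
rewrite ler_expR ler_pdivrMr// ler_peMr//.
by rewrite ler1n.
Qed.

Lemma norm_series_sin_coeff_le y n : `|series (sin_coeff y) n| <= expR `|y|.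
Proof.
apply: (@le_trans _ _ (series (exp_coeff `|y|) n)).
  apply: (le_trans (ler_norm_sum _ _ _)); apply: ler_sum => i _.
  rewrite /sin_coeff /exp_coeff /= !normrM normfV !normrX !normr_nat normrN1.
  rewrite expr1n mulr1 ler_wpM2r ?invr_ge0 ?ler0n// -[leRHS]mul1r.
  rewrite ler_wpM2r ?exprn_ge0//.
  by case: (odd i).
have -> : expR `|y| = limn (series (exp_coeff `|y|)) by [].
apply: nondecreasing_cvgn_le; last exact: is_cvg_series_exp_coeff.
by apply/nondecreasing_series => i _ _; rewrite divr_ge0// exprn_ge0.
Qed.

Lemma cvg_series_sin_coeff y : series (sin_coeff y) n @[n --> \oo] --> sin y.
Proof. by rewrite unlock; exact: is_cvg_series_sin_coeff. Qed.

Lemma norm_horner_le (p : {poly R}) t c : 0 <= c -> `|t| <= expR c ->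
  `|p.[t]| <= (\sum_(i < size p) `|p`_i|) * expR ((size p)%:R * c).
Proof.
move=> c0 tc; rewrite horner_coef mulr_suml.
apply: (le_trans (ler_norm_sum _ _ _)); apply: ler_sum => i _.
rewrite normrM normrX ler_wpM2l//.
apply: (@le_trans _ _ (expR c ^+ i)); first by rewrite lerXn2r// nnegrE// expR_ge0.
rewrite -expRM_natl ler_expR ler_wpM2r// ler_nat ltnW//.
Qed.

End elementary_limits.

Section polynomial_step.
Context {R : realType}.

(** On [-1, 1] these polynomials tend to the indicator of the negative numbers. With
    [v = ((1 + t) / 2) ^ n.+1] and the exponent [k], the product [k * v] is
    [n.+1 * (1 + t) ^ n.+1], which tends to zero for [t < 0] and is at least [n.+1]
    for [t >= 0]; the inequalities of Bernoulli conclude. *)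
Definition step_poly (n : nat) : {poly R} :=
  (1 - ((1 + 'X) * (2^-1)%:P) ^+ n.+1) ^+ (n.+1 * 2 ^ n.+1).

Lemma horner_step_poly n t :
  (step_poly n).[t] = (1 - ((1 + t) / 2) ^+ n.+1) ^+ (n.+1 * 2 ^ n.+1).
Proof. by rewrite /step_poly !hornerE. Qed.

Let u01 (t : R) : -1 <= t <= 1 -> 0 <= (1 + t) / 2 <= 1.
Proof. by move=> /andP[? ?]; apply/andP; split; lra. Qed.

Lemma step_poly_bounds n t : -1 <= t <= 1 -> 0 <= (step_poly n).[t] <= 1.
Proof.
move=> /u01/andP[u0 u1]; rewrite horner_step_poly.
have : 0 <= ((1 + t) / 2) ^+ n.+1 <= 1 by rewrite exprn_ge0// exprn_ile1.
move=> /andP[v0 v1]; rewrite exprn_ge0 ?exprn_ile1//; lra.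
Qed.

Lemma bernoulli_ge1 (x : R) k : 0 <= x -> 1 + k%:R * x <= (1 + x) ^+ k.
Proof.
move=> x0; elim: k => [|k IH]; first by rewrite mul0r addr0 expr0.
rewrite exprS -nat1r; apply: (@le_trans _ _ ((1 + x) * (1 + k%:R * x))).
  have : 0 <= k%:R * x * x by rewrite !mulr_ge0.
  lra.
by rewrite ler_wpM2l// addr_ge0.
Qed.

Lemma bernoulli_sub (x : R) k : 0 <= x <= 1 -> 1 - k%:R * x <= (1 - x) ^+ k.
Proof.
move=> /andP[x0 x1]; elim: k => [|k IH]; first by rewrite mul0r subr0 expr0.
rewrite exprS -nat1r; apply: (@le_trans _ _ ((1 - x) * (1 - k%:R * x))).
  have : 0 <= k%:R * x * x by rewrite !mulr_ge0.
  lra.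
by rewrite ler_wpM2l// subr_ge0.
Qed.

Lemma cvg_natmul_expr (r : R) : 0 <= r < 1 ->
  n.+1%:R * r ^+ n.+1 @[n --> \oo] --> (0 : R).
Proof.
move=> /andP[r0 r1]; pose s := (1 + r) / 2.
have s0 : 0 < s by rewrite /s; lra.
have rs : r < s by rewrite /s; lra.
have s1 : s < 1 by rewrite /s; lra.
pose e := s^-1 - 1.
have e0 : 0 < e by rewrite subr_gt0 invf_gt1.
have ns n : n.+1%:R * s ^+ n.+1 <= e^-1.
  rewrite -ler_pdivlMr ?exprn_gt0// ler_pdivlMl// mulrC -exprVn.
  have := bernoulli_ge1 n.+1 (ltW e0).
  rewrite [1 + e](_ : _ = s^-1); [lra | by rewrite /e addrC subrK].
have q1 : r / s < 1 by rewrite ltr_pdivrMr// mul1r.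
have q0 : 0 <= r / s by rewrite divr_ge0// ltW.
apply: (@squeeze_cvgr _ _ _ _ (fun=> 0) (fun n => e^-1 * (r / s) ^+ n.+1)).
- apply: nearW => n; rewrite mulr_ge0 ?exprn_ge0//=.
  rewrite -[r in leLHS](divfK (lt0r_neq0 s0)) exprMn mulrCA mulrC ler_wpM2r//.
  exact: exprn_ge0.
- exact: cvg_cst.
- have := @cvg_geometric R e^-1 (r / s); rewrite ger0_norm// => /(_ q1) h.
  by have := (cvg_comp (addn 1) _ (cvg_addnl 1) h).
Qed.

Lemma cvg_step_poly (t : R) : -1 <= t <= 1 ->
  (step_poly n).[t] @[n --> \oo] --> ((t < 0)%R%:R : R).
Proof.
move=> t11; have /andP[u0 u1] := u01 t11.
set u := (1 + t) / 2 in u0 u1.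
have v01 n : 0 <= u ^+ n.+1 <= 1 by rewrite exprn_ge0// exprn_ile1.
case: ltP => [t0|t0] /=.
  apply: (@squeeze_cvgr _ _ _ _ (fun n => 1 - n.+1%:R * (2 * u) ^+ n.+1) (fun=> 1)).
  - apply: nearW => n; have /andP[_ ->] := step_poly_bounds n t11; rewrite andbT.
    rewrite horner_step_poly -/u; apply: le_trans (bernoulli_sub _ (v01 n)).
    by rewrite exprMn natrM natrX mulrA.
  - rewrite -[X in _ --> X]subr0; apply: cvgB; first exact: cvg_cst.
    by apply: cvg_natmul_expr; apply/andP; rewrite /u; split; lra.
  - exact: cvg_cst.
apply: (@squeeze_cvgr _ _ _ _ (fun=> 0) (fun n => n.+1%:R^-1)).
- apply: nearW => n; have /andP[-> _] /= := step_poly_bounds n t11.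
  rewrite horner_step_poly -/u; set k := (n.+1 * 2 ^ n.+1)%N.
  have /andP[v0 v1] := v01 n; set v := u ^+ n.+1 in v0 v1 *.
  have kv : n.+1%:R <= k%:R * v.
    rewrite /k natrM natrX -mulrA -exprMn ler_peMr// exprn_ege1//.
    by rewrite /u; lra.
  have h1 : (1 - v) ^+ k * (1 + v) ^+ k <= 1.
    by rewrite -exprMn exprn_ile1//; nra.
  have h2 : n.+1%:R <= (1 + v) ^+ k.
    by have := bernoulli_ge1 k v0; lra.
  have h3 : 0 <= (1 - v) ^+ k by rewrite exprn_ge0// subr_ge0.
  rewrite -[n.+1%:R^-1]mul1r ler_pdivlMr ?ltr0n//; apply: le_trans h1.
  by rewrite ler_wpM2l.
- exact: cvg_cst.
- exact: cvg_harmonic.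
Qed.

End polynomial_step.

(** * Moment generating functions on the line *)

Section mgf_determines_law.
Context {R : realType} (mu nu : {measure set (measurableTypeR R) -> \bar R}).
Hypothesis mgf_fin : forall c : R, (\int[mu]_x (expR (c * x))%:E < +oo)%E.
Hypothesis mgf_eq : forall c : R,
  (\int[mu]_x (expR (c * x))%:E = \int[nu]_x (expR (c * x))%:E)%E.

(** The bound by an exponential keeps the class inside the integrable functions
    and lets dominated convergence act on it. *)
Let exp_bounded (F : R -> R) :=
  exists C c : R, [/\ 0 <= C, 0 <= c & forall x, `|F x| <= C * expR (c * `|x|)].

Let matched (F : R -> R) :=
  [/\ measurable_fun setT F, exp_bounded F &
   (\int[mu]_x (F x)%:E = \int[nu]_x (F x)%:E)%E].

Let measurable_exp_norm (c : R) :
  measurable_fun setT (fun x : measurableTypeR R => expR (c * `|x|)).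
Proof.
apply: measurableT_comp; first exact: measurable_expR.
by apply: measurable_funM => //; exact: measurableT_comp.
Qed.

Let measurable_exp (c : R) :
  measurable_fun setT (fun x : measurableTypeR R => expR (c * x)).
Proof.
by apply: measurableT_comp; [exact: measurable_expR|exact: measurable_funM].
Qed.

Let integrable_exp_norm (m : {measure set (measurableTypeR R) -> \bar R}) (C c : R) :
  (forall c : R, (\int[m]_x (expR (c * x))%:E < +oo)%E) ->
  m.-integrable setT (fun x => (C * expR (c * `|x|))%:E).
Proof.
move=> fin; under eq_fun do rewrite EFinM.
apply: integrableZl => //; apply/integrableP; split.
  by apply/measurable_EFinP; exact: measurable_exp_norm.
apply: (@le_lt_trans _ _ (\int[m]_x ((expR (c * x))%:E + (expR (- c * x))%:E))%E).
  apply: ge0_le_integral => //.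
  - apply/measurableT_comp => //.
    by apply/measurable_EFinP; exact: measurable_exp_norm.
  - by apply: emeasurable_funD; apply/measurable_EFinP; exact: measurable_exp.
  - move=> x _; rewrite gee0_abs ?lee_fin ?expR_ge0//.
    case: (ger0P x) => _; first by rewrite lerDl expR_ge0.
    by rewrite mulrN mulNr lerDr expR_ge0.
rewrite ge0_integralD//.
- exact: lte_add_pinfty.
- by apply/measurable_EFinP; exact: measurable_exp.
- by apply/measurable_EFinP; exact: measurable_exp.
Qed.

Let mgf_fin_nu (c : R) : (\int[nu]_x (expR (c * x))%:E < +oo)%E.
Proof. by rewrite -mgf_eq. Qed.

Let integrable_bounded (m : {measure set (measurableTypeR R) -> \bar R}) F :
  (forall c : R, (\int[m]_x (expR (c * x))%:E < +oo)%E) ->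
  measurable_fun setT F -> exp_bounded F -> m.-integrable setT (EFin \o F).
Proof.
move=> fin mF [C [c [_ _ Cc]]].
apply: le_integrable (integrable_exp_norm C c fin) => //.
  exact/measurable_EFinP.
move=> x _; rewrite /= lee_fin (le_trans (Cc x))// ler_norm//.
Qed.

Let matched_lim (F_ : nat -> R -> R) F (C c : R) : 0 <= C -> 0 <= c ->
  (forall n, matched (F_ n)) -> (forall n x, `|F_ n x| <= C * expR (c * `|x|)) ->
  (forall x, F_ n x @[n --> \oo] --> F x) -> matched F.
Proof.
move=> C0 c0 mF bF cF.
have mesF : measurable_fun setT F.
  by apply: (measurable_fun_cvg (h := F_)) => [n|x _]; [case: (mF n)|exact: cF].
have conv (m : {measure set (measurableTypeR R) -> \bar R}) :
    (forall c : R, (\int[m]_x (expR (c * x))%:E < +oo)%E) ->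
    (\int[m]_x (F_ n x)%:E @[n --> \oo] --> \int[m]_x (F x)%:E)%E.
  move=> fin; have [] // := @dominated_convergence _ _ _ m _ measurableT
    (fun n x => (F_ n x)%:E) (fun x => (F x)%:E)
    (fun x => (C * expR (c * `|x|))%:E).
  - by move=> n; apply/measurable_EFinP; case: (mF n).
  - exact/measurable_EFinP.
  - by apply: aeW => x _; apply: cvg_EFin; [exact: nearW|exact: cF].
  - exact: integrable_exp_norm.
  - by apply: aeW => x n _; rewrite lee_fin bF.
split => //.
  exists C, c; split => // x.
  have : `|F_ n x| @[n --> \oo] --> `|F x| by apply: cvg_norm; exact: cF.
  move=> h; rewrite -(cvg_lim _ h)//; apply: limr_le; first by apply/cvg_ex; exists `|F x|.
  by apply: nearW => n; exact: bF.
have h1 := conv mu mgf_fin; have h2 := conv nu mgf_fin_nu.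
rewrite -(cvg_lim _ h1)// -(cvg_lim _ h2)//; congr (limn _).
by apply/funext => n; case: (mF n).
Qed.

Let matched_exp c : matched (fun x => expR (c * x)).
Proof.
split => //; first exact: measurable_exp.
exists 1, `|c|; split => // x; rewrite mul1r ger0_norm ?expR_ge0//; exact: le_expR_norm.
Qed.

Let matchedD F G : matched F -> matched G -> matched (fun x => F x + G x).
Proof.
move=> [mF bF eF] [mG bG eG]; split.
- exact: measurable_funD.
- case: bF => C [c [C0 c0 h]]; case: bG => C' [c' [C0' c0' h']].
  exists (C + C'), (c + c'); split; rewrite ?addr_ge0// => x.
  apply: (le_trans (ler_normD _ _)); rewrite mulrDl; apply: lerD.
    apply: (le_trans (h x)); rewrite ler_wpM2l// ler_expR ler_wpM2r//; lra.
  apply: (le_trans (h' x)); rewrite ler_wpM2l// ler_expR ler_wpM2r//; lra.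
- have := integralD_EFin measurableT (integrable_bounded mgf_fin mF bF)
    (integrable_bounded mgf_fin mG bG).
  have := integralD_EFin measurableT (integrable_bounded mgf_fin_nu mF bF)
    (integrable_bounded mgf_fin_nu mG bG).
  by rewrite /= eF eG => <- <-.
Qed.

Let matchedZ a F : matched F -> matched (fun x => a * F x).
Proof.
move=> [mF bF eF]; split.
- exact: measurable_funM.
- case: bF => C [c [C0 c0 h]]; exists (`|a| * C), c; split => //.
    by rewrite mulr_ge0.
  by move=> x; rewrite normrM -mulrA ler_wpM2l.
- under eq_integral do rewrite EFinM.
  under [RHS]eq_integral do rewrite EFinM.
  rewrite integralZl//; last exact: integrable_bounded bF.
  rewrite integralZl//; last exact: integrable_bounded bF.
  by rewrite eF.
Qed.

Let matched_cst a : matched (fun=> a).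
Proof.
have := matchedZ a (matched_exp 0); congr matched; apply/funext => x.
by rewrite mul0r expR0 mulr1.
Qed.

Let matched_sum n (F_ : 'I_n -> R -> R) : (forall i, matched (F_ i)) ->
  matched (fun x => \sum_(i < n) F_ i x).
Proof.
elim: n F_ => [|n IH] F_ mF.
  by under eq_fun do rewrite big_ord0; exact: matched_cst.
under eq_fun do rewrite big_ord_recr/=.
by apply: matchedD => //; apply: IH => i; exact: mF.
Qed.

(** The powers are limits of [(n * (exp (x / n) - 1)) ^ k], which by the binomial
    formula are combinations of exponentials. *)
Let matched_pow k : matched (fun x => x ^+ k).
Proof.
apply: (@matched_lim (fun n x => (n.+1%:R * (expR (x / n.+1%:R) - 1)) ^+ k) _
  1 (2 * k%:R)) => //.
- move=> n; under eq_fun do rewrite exprMn exprBn mulr_sumr.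
  apply: matched_sum => i.
  have := matchedZ (n.+1%:R ^+ k * ((-1) ^+ i *+ 'C(k, i)))
    (matched_exp ((k - i)%:R / n.+1%:R)).
  congr matched; apply/funext => x.
  rewrite expr1n mulr1 (_ : _ / _ * x = (k - i)%:R * (x / n.+1%:R)); last first.
    by rewrite mulrAC mulrA.
  by rewrite expRM_natl mulrnAr mulrnAl mulrnAr mulrA.
- move=> n x; rewrite normrX mul1r.
  apply: (@le_trans _ _ (expR (2 * `|x|) ^+ k)).
    by rewrite lerXn2r// ?nnegrE ?expR_ge0//; exact: norm_exp_quotient_le.
  by rewrite -expRM_natl ler_expR mulrCA mulrA.
- move=> x; have h := @cvg_exp_quotient _ x.
  exact: (@cvg_comp _ _ _ _ (fun y : R => y ^+ k) _ _ _ h (@exprn_continuous _ _ _)).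
Qed.

Let matched_horner (p : {poly R}) : matched (fun x => p.[x]).
Proof.
under eq_fun do rewrite horner_coef.
by apply: matched_sum => i; apply: matchedZ; exact: matched_pow.
Qed.

Let sin_poly n : {poly R} := \sum_(i < n)
  ((odd i)%:R * (-1) ^+ i.-1./2 / i`!%:R) *: 'X^i.

Let horner_sin_poly n y : (sin_poly n).[y] = series (sin_coeff y) n.
Proof.
rewrite /sin_poly horner_sum /series/= big_mkord; apply: eq_bigr => i _.
by rewrite hornerZ hornerXn /sin_coeff/= mulrAC.
Qed.

(** The Taylor polynomials of the sine are bounded by the exponential. *)
Let matched_sin (q : {poly R}) a b : matched (fun x => q.[sin (a * x + b)]).
Proof.
pose K : R := \sum_(i < size q) `|q`_i|.
have K0 : 0 <= K by rewrite sumr_ge0.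
apply: (@matched_lim (fun n x => q.[(sin_poly n).[a * x + b]]) _
  (K * expR ((size q)%:R * `|b|)) ((size q)%:R * `|a|)).
- by rewrite mulr_ge0 ?expR_ge0.
- by rewrite mulr_ge0.
- move=> n; have := matched_horner (q \Po (sin_poly n \Po (a *: 'X + b%:P))).
  congr matched; apply/funext => x.
  by rewrite !horner_comp hornerD hornerZ hornerX hornerC.
- move=> n x; rewrite horner_sin_poly.
  apply: (le_trans (norm_horner_le _ _ (norm_series_sin_coeff_le _ _))) => //.
  rewrite -/K -mulrA ler_wpM2l// -expRD ler_expR -mulrA -mulrDr ler_wpM2l//.
  by rewrite addrC (le_trans (ler_normD _ _))// normrM.
- move=> x; under eq_fun do rewrite horner_sin_poly.
  have h := @cvg_series_sin_coeff _ (a * x + b).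
  exact: (@cvg_comp _ _ _ _ (fun y : R => q.[y]) _ _ _ h (@continuous_horner _ _ _)).
Qed.

Let matched_sin_lt0 a b : matched (fun x => (sin (a * x + b) < 0)%R%:R).
Proof.
apply: (@matched_lim (fun n x => (step_poly n).[sin (a * x + b)]) _ 1 0) => //.
- move=> n x; rewrite mul0r expR0 mulr1.
  have /(step_poly_bounds n)/andP[] : -1 <= sin (a * x + b) <= 1.
    by rewrite sin_geN1 sin_le1.
  by move=> ? ?; rewrite ger0_norm.
- by move=> x; apply: cvg_step_poly; rewrite sin_geN1 sin_le1.
Qed.

(** The sign of [sin ((x - b) / n.+1)] is that of [x - b] as soon as [n] is large
    enough for [x - b] to lie within half a period. *)
Let matched_itv b : matched (fun x => (x < b)%R%:R).
Proof.
apply: (@matched_lim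
  (fun n x => (sin (n.+1%:R^-1 * x - n.+1%:R^-1 * b) < 0)%R%:R) _ 1 0) => //.
- move=> n x; rewrite mul0r expR0 mulr1.
  by case: (_ < 0) => /=; rewrite ?normr1// normr0.
- move=> x.
  have := @cvg_harmonic R.
  have p1 : 0 < (`|x - b| + 1)^-1 :> R by rewrite invr_gt0 ltr_wpDl.
  move=> /cvgr0Pnorm_lt/(_ _ p1) hn.
  apply: cvg_near_cst; near=> n.
  congr ((_ : bool)%:R).
  rewrite -mulrBr; set y := x - b.
  have n0 : 0 < n.+1%:R^-1 :> R by rewrite invr_gt0.
  have : `|n.+1%:R^-1 : R| < (`|y| + 1)^-1 by near: n; exact: hn.
  rewrite gtr0_norm// => ny.
  have y1 : 0 < `|y| + 1 by rewrite ltr_wpDl.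
  have small : n.+1%:R^-1 * `|y| < pi.
    apply: (@le_lt_trans _ _ 1); last by have := pi_ge2 R; lra.
    rewrite -[leRHS](mulVf (lt0r_neq0 y1)).
    by rewrite ler_pM ?normr_ge0 ?lerDl ?ler01 ?(ltW ny) ?(ltW n0).
  have [xb|bx] := ltP x b.
    have y0 : y < 0 by rewrite subr_lt0.
    rewrite -oppr_gt0 -sinN -mulrN sin_gt0_pi//.
    by rewrite mulr_gt0 ?oppr_gt0//= -(ltr0_norm y0).
  have y0 : 0 <= y by rewrite subr_ge0.
  apply/negbTE; rewrite -leNgt sin_ge0_pi// mulr_ge0//=.
  by rewrite -(ger0_norm y0) ltW.
Unshelve. all: by end_near.
Qed.

(** A finite measure on the line whose moment generating function is finite
    everywhere is determined by it. The functions with equal integrals under both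
    measures are closed under dominated limits; starting from the exponentials
    they come to contain the powers, the polynomials of [sin (a * x + b)], the
    indicators of [sin (a * x + b) < 0] and, letting the period grow, the
    indicators of half-lines. *)
Lemma mgf_determines_law (A : set R) : measurable A -> mu A = nu A.
Proof.
move=> mA; have half b (m : {measure set (measurableTypeR R) -> \bar R}) :
    (\int[m]_x ((x < b)%R%:R : R)%:E = m `]-oo, b[%classic)%E.
  rewrite -[in RHS](setIT `]-oo, b[%classic) -integral_indic//.
  apply: eq_integral => x _; rewrite indicE.
  rewrite (_ : (x \in _) = (x < b))//.
  by apply/idP/idP; rewrite inE/= in_itv.
apply: (@measure_unique _ R (measurableTypeR R) (@RGenInftyO.G R) (fun n => `]-oo, n%:R[%classic)) => //.
- exact: RGenInftyO.measurableE.
- move=> _ _ [x ->] [y ->]; exists (Num.min x y).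
  rewrite predeqE => z /=; rewrite !in_itv/= lt_min.
  by split => [[-> ->]//|/andP].
- by move=> n; exists n%:R.
- apply/seteqP; split => // x _; exists (Num.trunc `|x|).+1 => //=.
  by rewrite in_itv/= (le_lt_trans (ler_norm x))// truncnS_gt.
- by move=> _ [x ->]; have [_ _ e] := matched_itv x; rewrite -!half e.
- move=> n; have [m b _] := matched_itv n%:R; rewrite -half.
  by apply: integrable_lty => //; exact: (integrable_bounded mgf_fin m b).
Qed.

End mgf_determines_law.

(** * Moment generating functions of random vectors *)

Section mixed_transform.
Context d (T : measurableType d) {R : realType} (m : {measure set T -> \bar R}).
Context (f : T -> R) (n : nat) (S : 'I_n -> T -> R).
Hypotheses (f0 : forall x, 0 <= f x) (mf : measurable_fun setT f)
  (mS : forall j, measurable_fun setT (S j)).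

(** The factors of a functional that interpolates, as [k] runs from [0] to [n],
    between the moment generating function and the law on product sets. *)
Definition mixed_factor k (A : 'I_n -> set R) (a : 'I_n -> R) (j : 'I_n)
  (s : R) : R := if (j < k)%N then \1_(A j) s else expR (a j * s).

Definition mixed_transform k A a : \bar R :=
  (\int[m]_x (f x * \prod_(j < n) mixed_factor k A a j (S j x))%:E)%E.

Lemma mixed_factor_ge0 k A a j s : 0 <= mixed_factor k A a j s.
Proof. by rewrite /mixed_factor; case: ifP => _; rewrite ?expR_ge0. Qed.

Lemma measurable_mixed_factor k A a j : (forall j, measurable (A j)) ->
  measurable_fun setT (fun x => mixed_factor k A a j (S j x)).
Proof.
move=> mA; rewrite /mixed_factor; have [jk|jk] := boolP (j < k)%N.
  exact: (measurableT_comp (measurable_indic (mA j)) (mS j)).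
by apply: (measurableT_comp (@measurable_expR R)); exact: measurable_funM.
Qed.

Lemma mixed_transform0 A a : mixed_transform 0 A a =
  (\int[m]_x (f x * expR (\sum_(j < n) a j * S j x))%:E)%E.
Proof. by apply: eq_integral => x _; rewrite expR_sum. Qed.

Lemma mixed_transformT A a : mixed_transform n A a =
  (\int[m]_x (f x * \prod_(j < n) \1_(A j) (S j x))%:E)%E.
Proof.
apply: eq_integral => x _; congr (_ * _)%:E; apply: eq_bigr => j _.
by rewrite /mixed_factor ltn_ord.
Qed.

Hypothesis fin : forall a : 'I_n -> R,
  (\int[m]_x (f x * expR (\sum_(j < n) a j * S j x))%:E < +oo)%E.

Let measurable_mixed k A a (P : pred 'I_n) : (forall j, measurable (A j)) ->
  measurable_fun setT
    (fun x => f x * \prod_(j < n | P j) mixed_factor k A a j (S j x)).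
Proof.
move=> mA; apply: measurable_funM => //.
under eq_fun do rewrite -big_filter.
by apply: measurable_prod => j _; exact: measurable_mixed_factor.
Qed.

Lemma mixed_transform_fin k A a : (forall j, measurable (A j)) ->
  (mixed_transform k A a < +oo)%E.
Proof.
move=> mA; apply: le_lt_trans (fin (fun j => if (j < k)%N then 0 else a j)).
apply: ge0_le_integral => //.
- by move=> x _; rewrite lee_fin mulr_ge0// prodr_ge0// => j _; exact: mixed_factor_ge0.
- by apply/measurable_EFinP; exact: measurable_mixed.
- apply/measurable_EFinP; apply: measurable_funM => //.
  apply: (measurableT_comp (@measurable_expR R)).
  by apply: measurable_sum => j; exact: measurable_funM.
- move=> x _; rewrite lee_fin ler_wpM2l// expR_sum; apply: ler_prod => j _.
  rewrite mixed_factor_ge0 /mixed_factor/=; case: ifP => _; last by [].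
  by rewrite mul0r expR0 indicE; case: (_ \in _).
Qed.

Definition mixed_weight (k : 'I_n) A a (x : T) : R :=
  f x * \prod_(j < n | j != k) mixed_factor k A a j (S j x).

Lemma mixed_weight_ge0 (k : 'I_n) A a x : 0 <= mixed_weight k A a x.
Proof. by rewrite mulr_ge0// prodr_ge0// => j _; exact: mixed_factor_ge0. Qed.

Lemma measurable_mixed_weight (k : 'I_n) A a : (forall j, measurable (A j)) ->
  measurable_fun setT (mixed_weight k A a).
Proof. exact: measurable_mixed. Qed.

Lemma mixed_weight_exp (k : 'I_n) A a c x :
  mixed_weight k A a x * expR (c * S k x) =
  f x * \prod_(j < n) mixed_factor k A
    (fun j => if j == k then c else a j) j (S j x).
Proof.
rewrite /mixed_weight [in RHS](bigD1 k)//= [X in _ = _ * (X * _)]/mixed_factor.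
rewrite ltnn eqxx [expR _ * _]mulrC mulrA; congr (_ * _ * _).
by apply: eq_bigr => j /negbTE jk; rewrite /mixed_factor jk.
Qed.

Lemma mixed_weight_indic (k : 'I_n) A a x :
  mixed_weight k A a x * \1_(A k) (S k x) =
  f x * \prod_(j < n) mixed_factor k.+1 A a j (S j x).
Proof.
rewrite /mixed_weight [in RHS](bigD1 k)//= [X in _ = _ * (X * _)]/mixed_factor.
rewrite ltnSn [\1__ _ * _]mulrC mulrA; congr (_ * _ * _).
apply: eq_bigr => j jk; rewrite /mixed_factor.
rewrite [(j < k.+1)%N](_ : _ = (j < k)%N)//.
by rewrite ltnS leq_eqVlt [X in X || _](negbTE jk).
Qed.

Definition mixed_measure (k : 'I_n) A a (mA : forall j, measurable (A j)) :
    {measure set (measurableTypeR R) -> \bar R} :=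
  weighted_measure m (mixed_weight_ge0 k A a) (measurable_mixed_weight k a mA)
    (mS k : measurable_fun setT (S k : T -> measurableTypeR R)).

Lemma integral_mixed_measure (k : 'I_n) A a (mA : forall j, measurable (A j)) c :
  (\int[mixed_measure k a mA]_y (expR (c * y))%:E =
   mixed_transform k A (fun j => if j == k then c else a j))%E.
Proof.
rewrite ge0_integral_weighted_measure.
- by apply: eq_integral => x _; rewrite -EFinM mixed_weight_exp.
- by move=> y; rewrite lee_fin expR_ge0.
- apply/measurable_EFinP; apply: (measurableT_comp (@measurable_expR R)).
  exact: measurable_funM.
Qed.

Lemma mixed_measureE (k : 'I_n) A a (mA : forall j, measurable (A j)) :
  mixed_measure k a mA (A k) = mixed_transform k.+1 A a.
Proof. by apply: eq_integral => x _; rewrite mixed_weight_indic. Qed.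

End mixed_transform.

(** Random vectors with the same moment generating function, finite everywhere,
    have the same law: the one-dimensional result replaces the exponentials by
    indicators one coordinate after the other, the remaining factors entering the
    density of the measure. *)
Lemma mgf_determines_joint_law {R : realType} d1 d2 (T1 : measurableType d1)
    (T2 : measurableType d2) (m1 : {measure set T1 -> \bar R})
    (m2 : {measure set T2 -> \bar R}) (f1 : T1 -> R) (f2 : T2 -> R) n
    (S1 : 'I_n -> T1 -> R) (S2 : 'I_n -> T2 -> R) (A : 'I_n -> set R) :
  (forall x, 0 <= f1 x) -> measurable_fun setT f1 ->
  (forall j, measurable_fun setT (S1 j)) ->
  (forall x, 0 <= f2 x) -> measurable_fun setT f2 ->
  (forall j, measurable_fun setT (S2 j)) ->
  (forall a : 'I_n -> R,
    \int[m1]_x (f1 x * expR (\sum_(j < n) a j * S1 j x))%:E < +oo)%E ->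
  (forall a : 'I_n -> R,
    \int[m1]_x (f1 x * expR (\sum_(j < n) a j * S1 j x))%:E =
    \int[m2]_x (f2 x * expR (\sum_(j < n) a j * S2 j x))%:E)%E ->
  (forall j, measurable (A j)) ->
  (\int[m1]_x (f1 x * \prod_(j < n) \1_(A j) (S1 j x))%:E =
   \int[m2]_x (f2 x * \prod_(j < n) \1_(A j) (S2 j x))%:E)%E.
Proof.
move=> f10 mf1 mS1 f20 mf2 mS2 fin eqm mA.
have fin2 a : (\int[m2]_x (f2 x * expR (\sum_(j < n) a j * S2 j x))%:E < +oo)%E.
  by rewrite -eqm.
rewrite -(mixed_transformT _ _ _ _ (fun=> 0)) -(mixed_transformT _ _ _ _ (fun=> 0)).
move: (fun=> 0) => a.
suff H k : (k <= n)%N -> forall a,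
    mixed_transform m1 f1 S1 k A a = mixed_transform m2 f2 S2 k A a by exact: H.
elim: k => [_ {}a|k IH kn {}a]; first by rewrite !mixed_transform0.
have {}IH := IH (ltnW kn); pose k' := Ordinal kn.
rewrite -[k.+1]/(nat_of_ord k').+1 -(mixed_measureE m1 f10 mf1 mS1 k' a mA).
rewrite -(mixed_measureE m2 f20 mf2 mS2 k' a mA).
apply: mgf_determines_law; last exact: mA.
- move=> c; rewrite integral_mixed_measure; exact: mixed_transform_fin.
- by move=> c; rewrite !integral_mixed_measure; exact: IH.
Qed.

(** * Gaussian variables *)

Lemma cvg_EFin_real {R : realType} (u : nat -> R) (l : R) :
  (u n)%:E @[n --> \oo] --> l%:E <-> u n @[n --> \oo] --> l.
Proof.
split; first exact: fine_cvg.
by move=> ul; apply: cvg_EFin; [exact: nearW|exact: ul].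
Qed.

Section gaussian_variable.
Context d (T : measurableType d) {R : realType} (P : probability T R).
Context (V : T -> R) (m s : R).
Hypotheses (mV : measurable_fun setT V)
  (law : forall B : set R, measurable B -> P [set w | B (V w)] = gaussian_law m s B).

Let integral_law (nu : {measure set (measurableTypeR R) -> \bar R}) (g : R -> R) :
  (forall B, measurable B -> gaussian_law m s B = nu B) ->
  (forall y, 0 <= g y) -> measurable_fun setT g ->
  (\int[P]_w (g (V w))%:E = \int[nu]_x (g x)%:E)%E.
Proof.
move=> e g0 mg; rewrite (@ge0_integral_weighted _ _ _ _ _ P nu (fun=> 1) V)//.
- by apply: eq_integral => w _; rewrite mul1e.
- move=> A mA; under eq_integral do rewrite mul1r.
  rewrite (eq_integral (fun w => (\1_(V @^-1` A) w)%:E)); last first.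
    by move=> w _; rewrite !indicE; congr (_%:R%:E); apply/idP/idP; rewrite !inE.
  rewrite integral_indic//; first by rewrite setIT -e// -law.
  by rewrite -[X in measurable X]setTI; exact: mV.
- by apply/measurable_EFinP.
Qed.

Lemma integral_normal_prob_expR a : s != 0 ->
  (\int[normal_prob m s]_x (expR (a * x))%:E =
   (expR (a * m + a ^+ 2 * s ^+ 2 / 2))%:E)%E.
Proof.
move=> s0.
have mexp : measurable_fun setT (fun x : R => expR (a * x)).
  by apply: measurableT_comp; [exact: measurable_expR|exact: measurable_funM].
rewrite (@ge0_integral_weighted _ _ _ _ _ lebesgue_measure (normal_prob m s)
  (normal_pdf m s) idfun)//.
- transitivity (\int[lebesgue_measure]_x ((expR (a * m + a ^+ 2 * s ^+ 2 / 2))%:E *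
    (normal_pdf (m + a * s ^+ 2) s x)%:E))%E.
    apply: eq_integral => x _; rewrite -!EFinM; congr EFin.
    rewrite /normal_pdf (negbTE s0) /normal_fun.
    rewrite -[LHS]mulrA [RHS]mulrCA -!expRD; congr (_ * expR _).
    by rewrite -[s ^+ 2 *+ 2]mulr_natr /=; field.
  rewrite ge0_integralZl//; first by rewrite integral_normal_pdf mule1.
  + by apply/measurable_EFinP; exact: measurable_normal_pdf.
  + by move=> x _; exact: normal_pdf_ge0.
- by move=> x; exact: normal_pdf_ge0.
- exact: measurable_normal_pdf.
- exact: measurable_id.
- move=> A mA; rewrite /normal_prob [RHS]integral_mkcond.
  apply: eq_integral => x _; rewrite patchE indicE.
  by case: (x \in A); rewrite ?mulr1// mulr0.
- by apply/measurable_EFinP.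
Qed.

Lemma gaussian_mgf a :
  (\int[P]_w (expR (a * V w))%:E = (expR (a * m + a ^+ 2 * s ^+ 2 / 2))%:E)%E.
Proof.
have mexp : measurable_fun setT (fun x : R => expR (a * x)).
  by apply: measurableT_comp; [exact: measurable_expR|exact: measurable_funM].
have e0 (y : R) : 0 <= expR (a * y) by exact: expR_ge0.
have [s0|s0] := eqVneq s 0.
  rewrite (@integral_law (@dirac _ (measurableTypeR R) m R) (fun x => expR (a * x)))//.
    rewrite integral_dirac//; last exact/measurable_EFinP.
    by rewrite diracT mul1e s0 expr0n/= mulr0 mul0r addr0.
  by move=> B mB; rewrite /gaussian_law s0 eqxx.
rewrite (@integral_law (normal_prob m s) (fun x => expR (a * x)))//.
  exact: integral_normal_prob_expR.
by move=> B mB; rewrite /gaussian_law (negbTE s0).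
Qed.

Let integrable_exp_norm c :
  P.-integrable setT (fun w => (expR (c * `|V w|))%:E).
Proof.
have mexp b : measurable_fun setT (fun w => expR (b * V w)).
  by apply: measurableT_comp; [exact: measurable_expR|exact: measurable_funM].
have mexpn : measurable_fun setT (fun w => expR (c * `|V w|)).
  apply: measurableT_comp; first exact: measurable_expR.
  by apply: measurable_funM => //; exact: measurableT_comp.
apply/integrableP; split; first exact/measurable_EFinP.
apply: (@le_lt_trans _ _
    (\int[P]_w ((expR (c * V w))%:E + (expR (- c * V w))%:E))%E).
  apply: ge0_le_integral => //.
  - by apply: measurableT_comp => //; exact/measurable_EFinP.
  - by apply: emeasurable_funD; exact/measurable_EFinP.
  - move=> w _; rewrite gee0_abs ?lee_fin ?expR_ge0//.
    case: (ger0P (V w)) => _; first by rewrite lerDl expR_ge0.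
    by rewrite mulrN mulNr lerDr expR_ge0.
rewrite ge0_integralD//; [|exact/measurable_EFinP|exact/measurable_EFinP].
by rewrite !gaussian_mgf -EFinD ltry.
Qed.

(** The moments of a Gaussian variable are read off its moment generating
    function, [n * (exp (V / n) - 1)] being close to [V]. *)
Let cvg_moment k : P.-integrable setT (fun w => (V w ^+ k)%:E) /\
  (\int[P]_w ((n.+1%:R * (expR (V w / n.+1%:R) - 1)) ^+ k)%:E @[n --> \oo] -->
   \int[P]_w (V w ^+ k)%:E)%E.
Proof.
have mq n : measurable_fun setT (fun w => n.+1%:R * (expR (V w / n.+1%:R) - 1)).
  apply: measurable_funM => //; apply: measurable_funB => //.
  by apply: measurableT_comp; [exact: measurable_expR|exact: measurable_funM].
have mk := measurable_funX k.
have [] // := @dominated_convergence _ _ _ P _ measurableT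
  (fun n w => ((n.+1%:R * (expR (V w / n.+1%:R) - 1)) ^+ k)%:E)
  (fun w => (V w ^+ k)%:E) (fun w => (expR (2 * k%:R * `|V w|))%:E).
- by move=> n; apply/measurable_EFinP; exact: mk.
- by apply/measurable_EFinP; exact: mk.
- apply: aeW => w _; apply: cvg_EFin; first exact: nearW.
  have h := @cvg_exp_quotient _ (V w).
  exact: (@cvg_comp _ _ _ _ (fun y : R => y ^+ k) _ _ _ h (@exprn_continuous _ _ _)).
- apply: aeW => w n _; rewrite lee_fin normrX.
  apply: (@le_trans _ _ (expR (2 * `|V w|) ^+ k)).
    by rewrite lerXn2r// ?nnegrE ?expR_ge0//; exact: norm_exp_quotient_le.
  by rewrite -expRM_natl ler_expR mulrCA mulrA.
Qed.

Lemma integrable_gaussian : P.-integrable setT (fun w => (V w)%:E).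
Proof.
by have [+ _] := cvg_moment 1; under eq_fun do rewrite expr1.
Qed.

Lemma integrable_gaussian_sqr : P.-integrable setT (fun w => (V w ^+ 2)%:E).
Proof. by have [] := cvg_moment 2. Qed.

Let integrable_exp c : P.-integrable setT (fun w => (expR (c * V w))%:E).
Proof.
apply: le_integrable (integrable_exp_norm `|c|) => //.
  apply/measurable_EFinP.
  by apply: measurableT_comp; [exact: measurable_expR|exact: measurable_funM].
by move=> w _; rewrite lee_fin !(ger0_norm (expR_ge0 _)) le_expR_norm.
Qed.

Let integral_quotient e : e != 0 -> (\int[P]_w (e^-1 * (expR (V w * e) - 1))%:E =
  (e^-1 * (expR ((m + e * s ^+ 2 / 2) * e) - 1))%:E)%E.
Proof.
move=> e0; under eq_integral do rewrite EFinM EFinB [V _ * e]mulrC.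
have i1 := @finite_measure_integrable_cst _ _ _ P setT 1 measurableT.
have ie := integrable_exp e.
rewrite integralZl//; last exact: integrableB.
rewrite integralB//.
rewrite gaussian_mgf integral_cst//= probability_setT mule1 -EFinB -EFinM.
by congr (_ * (expR _ - _))%:E; field.
Qed.

Lemma gaussian_mean : (\int[P]_w (V w)%:E = m%:E)%E.
Proof.
have [_] := cvg_moment 1; under [X in _ --> X -> _]eq_integral do rewrite expr1.
move=> /cvg_lim <-//; apply/cvg_lim => //.
have : ((n.+1%:R^-1)^-1 * (expR ((m + n.+1%:R^-1 * s ^+ 2 / 2) * n.+1%:R^-1) - 1))
    @[n --> \oo] --> m.
  apply: cvg_expR_slope.
  - by move=> n; rewrite invr_gt0.
  - exact: cvg_harmonic.
  - rewrite -[X in _ --> X]addr0; apply: cvgD; first exact: cvg_cst.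
    under eq_fun do rewrite -mulrA.
    rewrite -(mul0r (s ^+ 2 / 2)); apply: cvgM; last exact: cvg_cst.
    exact: cvg_harmonic.
move=> /cvg_EFin_real h; apply: cvg_trans h.
apply: near_eq_cvg; apply: nearW => n /=.
rewrite -integral_quotient ?invr_eq0 ?pnatr_eq0//.
by apply: eq_integral => w _; rewrite expr1 invrK.
Qed.

Lemma gaussian_sqr : m = 0 -> (\int[P]_w (V w ^+ 2)%:E = (s ^+ 2)%:E)%E.
Proof.
move=> m0; have [_] := cvg_moment 2.
move=> /cvg_lim <-//; apply/cvg_lim => //.
pose e n : R := n.+1%:R^-1 ^+ 2.
have e_gt0 n : 0 < e n by rewrite exprn_gt0// invr_gt0.
have e0 : e n @[n --> \oo] --> 0.
  rewrite -[X in _ --> X](mul0r (0 : R)); rewrite /e; under eq_fun do rewrite expr2.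
  by apply: cvgM; exact: cvg_harmonic.
have : ((e n)^-1 * (expR (2 * s ^+ 2 * e n) - 1) -
    2 * ((e n)^-1 * (expR (s ^+ 2 / 2 * e n) - 1)))
    @[n --> \oo] --> 2 * s ^+ 2 - 2 * (s ^+ 2 / 2).
  apply: cvgB; first by apply: cvg_expR_slope => //; exact: cvg_cst.
  apply: cvgM; first exact: cvg_cst.
  by apply: cvg_expR_slope => //; exact: cvg_cst.
rewrite (_ : 2 * s ^+ 2 - _ = s ^+ 2); last by field.
move=> /cvg_EFin_real h; apply: cvg_trans h.
apply: near_eq_cvg; apply: nearW => n /=.
transitivity (\int[P]_w (((e n)^-1)%:E * ((expR (2 / n.+1%:R * V w))%:E -
    2%:E * (expR (n.+1%:R^-1 * V w))%:E + 1%:E)))%E; last first.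
  apply: eq_integral => w _.
  suff H : (e n)^-1 * (expR (2 / n.+1%:R * V w) - 2 * expR (n.+1%:R^-1 * V w) + 1)
    = (n.+1%:R * (expR (V w / n.+1%:R) - 1)) ^+ 2 by exact: (congr1 EFin H).
  rewrite -mulrA expRM_natl exprMn /e -exprVn invrK; congr (_ * _).
  by rewrite [_^-1 * _]mulrC; ring.
have i3 := integrable_exp (n.+1%:R^-1); have i0 := integrable_exp (2 / n.+1%:R).
have i2 := integrableZl measurableT 2 i3.
have i12 := integrableB measurableT i0 i2.
have i1 := @finite_measure_integrable_cst _ _ _ P setT 1 measurableT.
rewrite integralZl//; last exact: integrableD.
rewrite integralD// integralB// integralZl//.
rewrite !gaussian_mgf integral_cst//= probability_setT mule1.
suff H : (e n)^-1 * (expR (2 / n.+1%:R * m + (2 / n.+1%:R) ^+ 2 * s ^+ 2 / 2) -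
    2 * expR (n.+1%:R^-1 * m + n.+1%:R^-1 ^+ 2 * s ^+ 2 / 2) + 1) =
    (e n)^-1 * (expR (2 * s ^+ 2 * e n) - 1) -
    2 * ((e n)^-1 * (expR (s ^+ 2 / 2 * e n) - 1)) by exact: (esym (congr1 EFin H)).
rewrite [2 * (_ * _)]mulrCA -mulrBr m0 !mulr0 !add0r; congr (_ * _).
rewrite (_ : (2 / _) ^+ 2 * _ / 2 = 2 * s ^+ 2 * e n); last first.
  by rewrite /e exprMn; field.
rewrite (_ : _^-1 ^+ 2 * _ / 2 = s ^+ 2 / 2 * e n); last by rewrite /e; ring.
ring.
Qed.

End gaussian_variable.

(** * Moments of intrinsically stationary Gaussian fields *)

Section affine_combination.
Context {R : realType} (n : nat) (a v : 'I_n -> R).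

Lemma sqr_affine_combination : \sum_i a i = 1 ->
  (\sum_i a i * v i) ^+ 2 =
  \sum_i a i * v i ^+ 2 -
    2^-1 * \sum_i \sum_j a i * a j * (v i - v j) ^+ 2.
Proof.
move=> a1; set q := \sum_i a i * v i ^+ 2; set l := \sum_i a i * v i.
suff -> : \sum_i \sum_j a i * a j * (v i - v j) ^+ 2 = 2 * q - 2 * l ^+ 2.
  by field.
transitivity (\sum_i (a i * v i ^+ 2 + a i * q - 2 * (a i * v i) * l)).
  apply: eq_bigr => i _; rewrite /q /l.
  have -> : a i * v i ^+ 2 = a i * v i ^+ 2 * \sum_j a j by rewrite a1 mulr1.
  rewrite !mulr_sumr -big_split/= -sumrB; apply: eq_bigr => j _. ring.
rewrite sumrB big_split/= -mulr_suml a1 -mulr_suml -mulr_sumr -/l -/q; ring.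
Qed.

End affine_combination.

Section gaussian_field_moments.
Context dT (T : measurableType dT) {R : realType} (P : probability T R) (d : nat).
Context (Y : 'rV[R]_d -> T -> R) (gamma : 'rV[R]_d -> R).
Hypothesis hY : brown_resnick_field P Y gamma.

Let mY : random_field Y. Proof. by case: hY => -[]. Qed.
Let gY : gaussian_field P Y. Proof. by case: hY => -[]. Qed.
Let sY : intrinsically_stationary P Y. Proof. by case: hY => _ []. Qed.
Let vY : is_variogram P Y gamma. Proof. by case: hY => _ []. Qed.
Let cY : centred P Y. Proof. by case: hY => _ []. Qed.

Let measurable_combination n (t : 'I_n -> 'rV[R]_d) (a : 'I_n -> R) :
  measurable_fun setT (fun w => \sum_(i < n) a i * Y (t i) w).
Proof. by apply: measurable_sum => i; exact: measurable_funM. Qed.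

Lemma field_gaussian t : exists m s : R, forall B : set R, measurable B ->
  P [set w | B (Y t w)] = gaussian_law m s B.
Proof.
have [m [s h]] := gY (fun _ : 'I_1 => t) (fun=> 1).
exists m, s => B mB; rewrite -h//; congr (P _).
by apply/seteqP; split => w /=; rewrite big_ord1 mul1r.
Qed.

Lemma increment_gaussian u v : exists m s : R, forall B : set R, measurable B ->
  P [set w | B (Y u w - Y v w)] = gaussian_law m s B.
Proof.
have [m [s h]] := gY (fun i : 'I_2 => if i == ord0 then u else v)
  (fun i : 'I_2 => if i == ord0 then 1 else -1).
exists m, s => B mB; rewrite -h//; congr (P _).
by apply/seteqP; split => w /=; rewrite big_ord_recl big_ord1/= mul1r mulN1r.
Qed.

Lemma integrable_field t : P.-integrable setT (fun w => (Y t w)%:E).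
Proof. by have [m [s h]] := field_gaussian t; exact: integrable_gaussian (mY t) h. Qed.

Lemma field_mean t : (\int[P]_w (Y t w)%:E = 0)%E.
Proof. by have := cY t; rewrite unlock. Qed.

Lemma integrable_field_sqr t : P.-integrable setT (fun w => (Y t w ^+ 2)%:E).
Proof.
by have [m [s h]] := field_gaussian t; exact: integrable_gaussian_sqr (mY t) h.
Qed.

Let mI u v : measurable_fun setT (fun w => Y u w - Y v w).
Proof. exact: measurable_funB. Qed.

Lemma integrable_increment_sqr u v :
  P.-integrable setT (fun w => ((Y u w - Y v w) ^+ 2)%:E).
Proof.
have [m [s h]] := increment_gaussian u v.
exact: integrable_gaussian_sqr (mI u v) h.
Qed.

Lemma field_varianceE t : (\int[P]_w (Y t w ^+ 2)%:E = (field_variance P Y t)%:E)%E.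
Proof.
rewrite /field_variance fineK.
  rewrite /variance unlock cY/= unlock; apply: eq_integral => w _.
  by rewrite expr2 -[in LHS](subr0 (Y t w)).
rewrite /variance unlock cY/= unlock.
rewrite (eq_integral (fun w => (Y t w ^+ 2)%:E)).
  exact: integrable_fin_num (integrable_field_sqr t).
by move=> w _; rewrite expr2 -[in RHS](subr0 (Y t w)).
Qed.

Lemma increment_sqr u v :
  (\int[P]_w ((Y u w - Y v w) ^+ 2)%:E = (2 * gamma (u - v))%:E)%E.
Proof.
have mean x : ('E_P[(fun w => Y (x + (u - v)) w - Y x w)%R] = 0)%E.
  rewrite unlock; under eq_integral do rewrite EFinB.
  rewrite integralB//; [|exact: integrable_field|exact: integrable_field].
  by rewrite !field_mean subee.
have [_ _ /(_ 0 0 v)] := sY (u - v).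
rewrite unlock !mean/= unlock !add0r.
have E x y : (\int[P]_w (((Y x \- Y y \- cst 0) * (Y x \- Y y \- cst 0)) w)%:E =
    \int[P]_w ((Y x w - Y y w) ^+ 2)%:E)%E.
  by apply: eq_integral => w _; rewrite expr2 -[in RHS](subr0 (Y x w - Y y w)).
rewrite !E addrC subrK => ->.
have := vY (u - v); rewrite unlock => h; rewrite EFinM h muleA -EFinM divff//.
by rewrite mul1e.
Qed.

(** When the coefficients add up to one, the variance of [sum b j * Y (u j)] is the
    average [sum b j * sigma2 (u j)] minus a quadratic form in the variogram. The
    drift [- sigma2 / 2] cancels the average. *)
Lemma affine_mgf n (u : 'I_n -> 'rV[R]_d) (b : 'I_n -> R) : \sum_i b i = 1 ->
  (\int[P]_w (expR (\sum_j b j * (Y (u j) w - field_variance P Y (u j) / 2)))%:E =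
   (expR (- 2^-1 * \sum_i \sum_j b i * b j * gamma (u i - u j)))%:E)%E.
Proof.
move=> b1; set s2 := field_variance P Y.
pose V w := \sum_j b j * Y (u j) w.
have mV : measurable_fun setT V by exact: measurable_combination.
have [m [s law]] := gY u b.
have m0 : m = 0.
  have := gaussian_mean mV law; rewrite /V.
  under eq_integral do rewrite -sumEFin.
  rewrite integral_sum//; last first.
    move=> i; under eq_fun do rewrite EFinM.
    by apply: integrableZl => //; exact: integrable_field.
  rewrite big1 => [[]//|i _]; under eq_integral do rewrite EFinM.
  by rewrite integralZl//; [rewrite field_mean mule0|exact: integrable_field].
have s2E : s ^+ 2 = \sum_i b i * s2 (u i) -
    \sum_i \sum_j b i * b j * gamma (u i - u j).
  apply: EFin_inj; rewrite -(gaussian_sqr mV law m0).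
  have iY i : P.-integrable setT (fun w => (b i)%:E * (Y (u i) w ^+ 2)%:E)%E.
    by apply: integrableZl => //; exact: integrable_field_sqr.
  have iI i j : P.-integrable setT
      (fun w => (b i * b j)%:E * ((Y (u i) w - Y (u j) w) ^+ 2)%:E)%E.
    by apply: integrableZl => //; exact: integrable_increment_sqr.
  have iII i : P.-integrable setT
      (fun w => \sum_j (b i * b j)%:E * ((Y (u i) w - Y (u j) w) ^+ 2)%:E)%E.
    exact: integrable_sum.
  transitivity (\int[P]_w (\sum_i (b i)%:E * (Y (u i) w ^+ 2)%:E -
      2^-1%:E * \sum_i \sum_j (b i * b j)%:E * ((Y (u i) w - Y (u j) w) ^+ 2)%:E))%E.
    apply: eq_integral => w _; rewrite /V sqr_affine_combination//.
    rewrite EFinB EFinM -!sumEFin; congr (_ - _ * _)%E.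
    by apply: eq_bigr => i _; rewrite -sumEFin.
  rewrite integralB//; last 2 first.
  - exact: integrable_sum.
  - by apply: integrableZl => //; exact: integrable_sum.
  rewrite integralZl//; last exact: integrable_sum.
  rewrite !integral_sum// EFinB -sumEFin; congr (_ - _)%E.
    apply: eq_bigr => i _; rewrite integralZl//; last exact: integrable_field_sqr.
    by rewrite field_varianceE.
  have -> : (\sum_i \sum_j b i * b j * gamma (u i - u j))%:E =
      (2^-1%:E * (\sum_i \sum_j b i * b j * (2 * gamma (u i - u j)))%:E)%E.
    rewrite -EFinM mulr_sumr; congr EFin; apply: eq_bigr => i _.
    by rewrite mulr_sumr; apply: eq_bigr => j _; field.
  congr (_ * _)%E; rewrite -sumEFin; apply: eq_bigr => i _.
  rewrite integral_sum// -sumEFin; apply: eq_bigr => j _.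
  rewrite integralZl//; last exact: integrable_increment_sqr.
  by rewrite increment_sqr.
transitivity (\int[P]_w ((expR (- 2^-1 * \sum_i b i * s2 (u i)))%:E *
    (expR (1 * V w))%:E))%E.
  apply: eq_integral => w _; rewrite -EFinM -expRD; congr (expR _)%:E.
  rewrite mul1r mulr_sumr -big_split/=; apply: eq_bigr => j _. ring.
rewrite ge0_integralZl//.
- rewrite (gaussian_mgf mV law) -EFinM -expRD m0 s2E; congr (expR _)%:E.
  by field.
- apply/measurable_EFinP; apply: measurableT_comp; first exact: measurable_expR.
  exact: measurable_funM.
Qed.

End gaussian_field_moments.

(** * Exceedance mass of a Gaussian profile *)

Section gumbel_mass.
Context {R : realType} (n : nat).
Implicit Types (y z : 'I_n -> R) (x c : R).
Local Notation leb := (@lebesgue_measure R).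

Lemma continuous_expRN : continuous (fun x : R => expR (- x)).
Proof.
by move=> x; apply: continuous_comp; [exact: oppr_continuous|exact: continuous_expR].
Qed.

Lemma measurable_expRN : measurable_fun setT (fun x : R => expR (- x)).
Proof. by apply: continuous_measurable_fun; exact: continuous_expRN. Qed.

Lemma integral_expRN_itvoy a :
  (\int[leb]_(x in `]a, +oo[) (expR (- x))%:E = (expR (- a))%:E)%E.
Proof.
have dE (x : R) : is_derive x 1 (fun x => - expR (- x)) (expR (- x)).
  have := @is_deriveN _ _ _ _ _ _ _
    (is_derive1_comp (is_derive_expR (- x)) (is_deriveNid x 1)).
  by rewrite mulrN1 opprK.
rewrite integral_itv_obnd_cbnd; last first.
  by apply/measurable_EFinP/measurable_funTS; exact: measurable_expRN.
rewrite (@ge0_continuous_FTC2y _ _ (fun x => - expR (- x)) a 0).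
- by rewrite EFinN oppeK add0e.
- by move=> x _; exact: expR_ge0.
- apply: continuous_subspaceT; exact: continuous_expRN.
- by rewrite -oppr0; apply: cvgN; exact: cvgr_expR.
- by move=> x _; case: (dE x).
- by apply: cvgN; apply/cvg_at_right_filter; exact: continuous_expRN.
- by move=> x _; rewrite derive1E; exact: derive_val.
Qed.

(** A product of indicators, one for each site: this is the shape in which the law
    of a random vector is recovered from its moment generating function. *)
Definition no_exceed y z x : R := \prod_(j < n) \1_`]-oo, y j] (x + z j).

Lemma no_exceedE y z x :
  no_exceed y z x = [forall j, x + z j <= y j]%:R.
Proof.
rewrite /no_exceed; have [/forallP h|] := boolP [forall j, x + z j <= y j].
  by rewrite big1// => j _; rewrite indicE mem_set//= in_itv/=.
rewrite negb_forall => /existsP[j xj]; rewrite (bigD1 j)//= indicE memNset ?mul0r//.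
by rewrite /= in_itv/=; exact/negP.
Qed.

Lemma no_exceed_bounds y z x : 0 <= no_exceed y z x <= 1.
Proof. by rewrite no_exceedE; case: [forall j, x + z j <= y j] => /=; rewrite ?ler01 ?lexx. Qed.

(** The mass given by [exp (- x) dx] to the heights [x] at which the profile
    [x + z] exceeds the levels [y] somewhere. *)
Definition gumbel_mass y z : \bar R :=
  (\int[leb]_x (expR (- x) * (1 - no_exceed y z x))%:E)%E.

Lemma gumbel_massE y z j0 : (forall j, y j0 - z j0 <= y j - z j) ->
  gumbel_mass y z = (expR (z j0 - y j0))%:E.
Proof.
move=> j0min; rewrite -[z j0 - y j0]opprB -integral_expRN_itvoy.
rewrite [RHS]integral_mkcond; apply: eq_integral => x _.
rewrite patchE no_exceedE; case: ifPn => [|]; rewrite ?inE ?notin_setE/= in_itv/= andbT => h.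
  rewrite (_ : [forall j, x + z j <= y j] = false) ?subr0 ?mulr1//.
  by apply/negbTE/forallPn; exists j0; rewrite -ltNge -ltrBlDr.
rewrite (_ : [forall j, x + z j <= y j] = true) ?subrr ?mulr0//.
apply/forallP => j; rewrite -lerBrDr; apply: le_trans (j0min j).
by rewrite leNgt; exact/negP.
Qed.

Lemma gumbel_mass_min y z (i : 'I_n) : exists j0, forall j, y j0 - z j0 <= y j - z j.
Proof.
by case: (@arg_minP _ _ _ i predT (fun j => y j - z j) isT) => j0 _ h; exists j0 => j; exact: h.
Qed.

(** The intensity [exp (- x) dx] is multiplied by a constant under translations, so
    that raising the profile by [c] multiplies the mass. *)
Lemma gumbel_mass_addr y z c (i : 'I_n) :
  gumbel_mass y (fun j => z j + c) = ((expR c)%:E * gumbel_mass y z)%E.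
Proof.
have [j0 h] := gumbel_mass_min y z i.
rewrite (gumbel_massE h) (@gumbel_massE y (fun j => z j + c) j0); last first.
  by move=> j; rewrite !opprD !addrA lerD2r.
by rewrite -EFinM -expRD; congr (expR _)%:E; ring.
Qed.

Lemma gumbel_mass_le y z (i : 'I_n) :
  (gumbel_mass y z <= (\sum_j expR (z j - y j))%:E)%E.
Proof.
have [j0 h] := gumbel_mass_min y z i.
by rewrite (gumbel_massE h) lee_fin (bigD1 j0)//= lerDl sumr_ge0.
Qed.

End gumbel_mass.

Section exceedance.
Context dT (T : measurableType dT) {R : realType} (P : probability T R) (d : nat).
Context (Y : 'rV[R]_d -> T -> R) (gamma : 'rV[R]_d -> R).
Hypothesis hY : brown_resnick_field P Y gamma.
Local Notation leb := (@lebesgue_measure R).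

Let mY : random_field Y. Proof. by case: hY => -[]. Qed.

Definition drifted (u : 'rV[R]_d) (w : T) : R :=
  Y u w - field_variance P Y u / 2.

Lemma measurable_drifted u : measurable_fun setT (drifted u).
Proof. exact: measurable_funB. Qed.

(** For the maximum over the Poisson points this is minus the logarithm of the
    distribution function at [y]. *)
Definition exceedance_mass n (u : 'I_n -> 'rV[R]_d) (y : 'I_n -> R) : \bar R :=
  (\int[P]_w gumbel_mass y (fun j => drifted (u j) w))%E.

Lemma drifted_mgf n (u : 'I_n -> 'rV[R]_d) (b : 'I_n -> R) : \sum_i b i = 1 ->
  (\int[P]_w (expR (\sum_j b j * drifted (u j) w))%:E =
   (expR (- 2^-1 * \sum_i \sum_j b i * b j * gamma (u i - u j)))%:E)%E.
Proof. exact: affine_mgf hY _ _ _. Qed.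

(** Under the law tilted by [exp (drifted (u i))], the increments have a moment
    generating function that depends on the variogram only: the exponents of the
    product with the tilting density add up to one. *)
Lemma tilted_increment_mgf n (u : 'I_n -> 'rV[R]_d) (i : 'I_n) (a : 'I_n -> R) :
  let b j := if j == i then 1 - \sum_(k < n | k != i) a k else a j in
  (\int[P]_w (expR (drifted (u i) w) *
     expR (\sum_j a j * (drifted (u j) w - drifted (u i) w)))%:E =
   (expR (- 2^-1 * \sum_k \sum_j b k * b j * gamma (u k - u j)))%:E)%E.
Proof.
move=> b; rewrite -drifted_mgf; last first.
  rewrite (bigD1 i)//= {1}/b eqxx (eq_bigr a) ?subrK// => j ji.
  by rewrite /b (negbTE ji).
suff key (z : 'I_n -> R) :
    z i + \sum_j a j * (z j - z i) = \sum_j b j * z j.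
  by apply: eq_integral => w _; rewrite -expRD (key (fun j => drifted (u j) w)).
rewrite (bigD1 i)//= [in RHS](bigD1 i)//= {1}/b eqxx subrr mulr0 add0r.
rewrite mulrBl mul1r -addrA; congr (_ + _).
rewrite [RHS]addrC mulr_suml -sumrB; apply: eq_bigr => j ji.
by rewrite /b (negbTE ji) mulrBr.
Qed.

Lemma integral_expR_drifted u : (\int[P]_w (expR (drifted u w))%:E = 1)%E.
Proof.
have gamma0 : gamma 0 = 0.
  have [_ [_ /(_ 0) + _]] := hY; rewrite unlock => h; apply: EFin_inj; rewrite h.
  by rewrite integral0_eq ?mule0// => w _; rewrite subrr expr0n.
have := @drifted_mgf 1 (fun=> u) (fun=> 1); rewrite big_ord1 => /(_ erefl).
rewrite !big_ord1 subrr gamma0 !mulr0 expR0 => <-.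
by apply: eq_integral => w _; rewrite big_ord1 mul1r.
Qed.

Lemma measurable_expR_drifted u : measurable_fun setT (fun w => expR (drifted u w)).
Proof.
by apply: measurableT_comp; [exact: measurable_expR|exact: measurable_drifted].
Qed.

Lemma integrable_expR_drifted u :
  P.-integrable setT (fun w => (expR (drifted u w))%:E).
Proof.
apply/integrableP; split.
  by apply/measurable_EFinP; exact: measurable_expR_drifted.
under eq_integral do rewrite gee0_abs ?lee_fin ?expR_ge0//.
by rewrite integral_expR_drifted ltry.
Qed.

Lemma measurable_no_exceed n (y : 'I_n -> R) (z : 'I_n -> T -> R) :
  (forall j, measurable_fun setT (z j)) ->
  measurable_fun setT (fun p : T * R => no_exceed y (z^~ p.1) p.2).
Proof.
move=> mz; apply: measurable_prod => j _.
have mA : measurable_fun setT (fun p : T * R => p.2 + z j p.1).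
  apply: measurable_funD; first exact: measurable_snd.
  exact: measurableT_comp (mz _) measurable_fst.
exact: (measurableT_comp (measurable_indic (measurable_itv `]-oo, y j])) mA).
Qed.

Lemma measurable_gumbel_mass n (u : 'I_n -> 'rV[R]_d) (y : 'I_n -> R) :
  measurable_fun setT (fun w => gumbel_mass y (fun j => drifted (u j) w)).
Proof.
apply: (measurable_fun_fubini_tonelli_F (m2 := leb) (fun p : T * R =>
  (expR (- p.2) * (1 - no_exceed y (fun j => drifted (u j) p.1) p.2))%:E)).
  apply/measurable_EFinP; apply: measurable_funM.
    exact: measurableT_comp measurable_expRN measurable_snd.
  apply: measurable_funB => //.
  exact: (@measurable_no_exceed n y (fun j => drifted (u j))
    (fun j => measurable_drifted (u j))).
move=> p; rewrite lee_fin mulr_ge0 ?expR_ge0// subr_ge0.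
by case/andP: (no_exceed_bounds y (fun j => drifted (u j) p.1) p.2).
Qed.

(** Measuring the heights from the value of the profile at the site [u i] brings out
    the factor [exp (drifted (u i))], a probability density; only the increments
    from [u i] remain. *)
Lemma exceedance_mass_tilted n (u : 'I_n -> 'rV[R]_d) (y : 'I_n -> R) (i : 'I_n) :
  exceedance_mass u y = (\int[leb]_x ((expR (- x))%:E * (1 -
    \int[P]_w (expR (drifted (u i) w) *
      \prod_j \1_`]-oo, y j - x] (drifted (u j) w - drifted (u i) w))%:E)))%E.
Proof.
pose z j w := drifted (u j) w - drifted (u i) w.
transitivity (\int[P]_w \int[leb]_x (expR (- x) * (expR (drifted (u i) w) *
    (1 - no_exceed y (z^~ w) x)))%:E)%E.
  apply: eq_integral => w _.
  transitivity ((expR (drifted (u i) w))%:E * gumbel_mass y (z^~ w))%E.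
    rewrite -gumbel_mass_addr//; congr gumbel_mass; apply/funext => j.
    by rewrite /z subrK.
  rewrite /gumbel_mass -ge0_integralZl//.
  - by apply: eq_integral => x _; rewrite -EFinM mulrCA.
  - apply/measurable_EFinP; apply: measurable_funM; first exact: measurable_expRN.
    apply: measurable_funB => //; apply: measurable_prod => j _.
    have mx : measurable_fun setT (fun x : R => x + z j w) by exact: measurable_funD.
    exact: (measurableT_comp (measurable_indic (measurable_itv `]-oo, y j])) mx).
  - by move=> x _; rewrite lee_fin mulr_ge0 ?expR_ge0// subr_ge0; case/andP: (no_exceed_bounds y (z^~ w) x).
have mz j : measurable_fun setT (z j).
  by apply: measurable_funB; exact: measurable_drifted.
have me := measurable_expR_drifted (u i).
have mzx := measurable_no_exceed y mz.
rewrite (@fubini_tonelli _ _ _ _ _ P leb (fun p : T * R => (expR (- p.2) *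
  (expR (drifted (u i) p.1) * (1 - no_exceed y (z^~ p.1) p.2)))%:E)); last 2 first.
- apply/measurable_EFinP; apply: measurable_funM.
    exact: measurableT_comp measurable_expRN measurable_snd.
  apply: measurable_funM; first exact: measurableT_comp me measurable_fst.
  exact: measurable_funB.
- move=> p; rewrite lee_fin !mulr_ge0 ?expR_ge0// subr_ge0.
  by case/andP: (no_exceed_bounds y (z^~ p.1) p.2).
apply: eq_integral => x _.
have E w : \prod_j \1_`]-oo, y j - x] (z j w) = no_exceed y (z^~ w) x.
  rewrite /no_exceed; apply: eq_bigr => j _; rewrite !indicE.
  congr ((_ : bool)%:R); apply/idP/idP; rewrite !inE/= !in_itv/= => ?; lra.
have m1 : measurable_fun setT (fun w => no_exceed y (z^~ w) x).
  apply: measurable_prod => j _.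
  have mx : measurable_fun setT (fun w : T => x + z j w) by exact: measurable_funD.
  exact: (measurableT_comp (measurable_indic (measurable_itv `]-oo, y j])) mx).
rewrite /=; under eq_integral do rewrite EFinM.
rewrite ge0_integralZl//; last 2 first.
- apply/measurable_EFinP; apply: measurable_funM => //.
  exact: measurable_funB.
- move=> w _; rewrite lee_fin mulr_ge0 ?expR_ge0// subr_ge0.
  by case/andP: (no_exceed_bounds y (z^~ w) x).
congr (_ * _)%E; rewrite [in RHS](eq_integral
  (fun w => (expR (drifted (u i) w) * no_exceed y (z^~ w) x)%:E)); last first.
  by move=> w _; rewrite -E.
rewrite -(integral_expR_drifted (u i)).
rewrite -integralB//=.
- by apply: eq_integral => w _; rewrite -EFinB mulrBr mulr1.
- exact: integrable_expR_drifted.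
- apply: le_integrable (integrable_expR_drifted (u i)) => //.
    by apply/measurable_EFinP; exact: measurable_funM.
  move=> w _; have /andP[n0 n1] := no_exceed_bounds y (z^~ w) x.
  rewrite lee_fin !ger0_norm ?mulr_ge0 ?expR_ge0//.
  by rewrite ler_piMr ?expR_ge0.
Qed.

Lemma exceedance_mass_fin n (u : 'I_n -> 'rV[R]_d) (y : 'I_n -> R) (i : 'I_n) :
  (exceedance_mass u y < +oo)%E.
Proof.
apply: (@le_lt_trans _ _ (\int[P]_w
    \sum_j ((expR (- y j))%:E * (expR (drifted (u j) w))%:E))%E).
  apply: ge0_le_integral => //.
  - move=> w _; apply: integral_ge0 => x _; rewrite lee_fin mulr_ge0 ?expR_ge0//.
    by rewrite subr_ge0; case/andP: (no_exceed_bounds y (fun j => drifted (u j) w) x).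
  - exact: measurable_gumbel_mass.
  - apply: emeasurable_sum => j; apply: emeasurable_funM => //.
    by apply/measurable_EFinP; exact: measurable_expR_drifted.
  - move=> w _; apply: (le_trans (gumbel_mass_le _ _ i)).
    rewrite -sumEFin; apply: lee_sum => j _.
    by rewrite -EFinM -expRD addrC.
rewrite ge0_integral_sum//.
- rewrite (eq_bigr (fun j => (expR (- y j))%:E)) ?sumEFin ?ltry// => j _.
  rewrite ge0_integralZl//.
  + by rewrite integral_expR_drifted mule1.
  + by apply/measurable_EFinP; exact: measurable_expR_drifted.
- move=> j; apply: emeasurable_funM => //.
  by apply/measurable_EFinP; exact: measurable_expR_drifted.
Qed.

End exceedance.

(** The exceedance mass is a function of the variogram and of the differences of
    the sites: the tilted increments have the same law. *)
Lemma exceedance_mass_variogram {R : realType} (d : nat)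
    (gamma : 'rV[R]_d -> R) d1 d2 (T1 : measurableType d1)
    (T2 : measurableType d2) (P1 : probability T1 R) (P2 : probability T2 R)
    (Y1 : 'rV[R]_d -> T1 -> R) (Y2 : 'rV[R]_d -> T2 -> R) n
    (u1 u2 : 'I_n -> 'rV[R]_d) (y : 'I_n -> R) (i : 'I_n) :
  brown_resnick_field P1 Y1 gamma -> brown_resnick_field P2 Y2 gamma ->
  (forall k j, u1 k - u1 j = u2 k - u2 j) ->
  exceedance_mass P1 Y1 u1 y = exceedance_mass P2 Y2 u2 y.
Proof.
move=> h1 h2 u12; rewrite (exceedance_mass_tilted h1 _ _ i).
rewrite (exceedance_mass_tilted h2 _ _ i); apply: eq_integral => x _.
congr (_ * (1 - _))%E.
have m1 := measurable_drifted h1; have m2 := measurable_drifted h2.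
apply: (mgf_determines_joint_law (A := fun j => `]-oo, y j - x]%classic)) => //.
- exact: (measurable_expR_drifted h1).
- by move=> j; apply: measurable_funB.
- exact: (measurable_expR_drifted h2).
- by move=> j; apply: measurable_funB.
- by move=> a; rewrite (tilted_increment_mgf h1) ltry.
- move=> a; rewrite (tilted_increment_mgf h1) (tilted_increment_mgf h2).
  congr (expR (_ * _))%:E; apply: eq_bigr => k _; apply: eq_bigr => j _.
  by rewrite u12.
Qed.

(** * Means of functions with values in the unit interval *)

Section unit_mean.
Context dT (T : measurableType dT) {R : realType} (P : probability T R).
Implicit Types f g : T -> R.

(** The functions for which means are finite and dominated convergence is
    automatic. *)
Definition unit_fun f := measurable_fun setT f /\ forall w, 0 <= f w <= 1.

Lemma integrable_unit f : unit_fun f -> P.-integrable setT (EFin \o f).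
Proof.
move=> [mf f01].
apply: le_integrable (@finite_measure_integrable_cst _ _ _ P setT 1 measurableT) => //.
  exact/measurable_EFinP.
move=> w _; have /andP[f0 f1] := f01 w.
by rewrite /= lee_fin normr1 ger0_norm.
Qed.

Lemma unit_meanE f : unit_fun f -> (\int[P]_w f w)%:E = (\int[P]_w (f w)%:E)%E.
Proof.
by move=> uf; rewrite fineK//; exact: integrable_fin_num (integrable_unit uf).
Qed.

Lemma le_unit_mean f g : unit_fun f -> unit_fun g -> (forall w, f w <= g w) ->
  \int[P]_w f w <= \int[P]_w g w.
Proof.
by move=> uf ug fg; apply: le_Rintegral => //; exact: integrable_unit.
Qed.

Lemma unit_mean_ge0 f : unit_fun f -> 0 <= \int[P]_w f w.
Proof. by move=> [_ f01]; apply: Rintegral_ge0 => w _; case/andP: (f01 w). Qed.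

Lemma unit_mean_cvg (f_ : nat -> T -> R) f : (forall n, unit_fun (f_ n)) ->
  (forall w, f_ n w @[n --> \oo] --> f w) ->
  unit_fun f /\ \int[P]_w f_ n w @[n --> \oo] --> \int[P]_w f w.
Proof.
move=> uf cf.
have mf : measurable_fun setT f.
  by apply: (measurable_fun_cvg (h := f_)) => [n|w _]; [case: (uf n)|exact: cf].
have f01 w : 0 <= f w <= 1.
  rewrite -(cvg_lim _ (cf w))//; apply/andP; split.
    by apply: limr_ge; [apply/cvg_ex; exists (f w); exact: cf|apply: nearW => n; case: (uf n) => _ /(_ w)/andP[]].
  by apply: limr_le; [apply/cvg_ex; exists (f w); exact: cf|apply: nearW => n; case: (uf n) => _ /(_ w)/andP[]].
have u : unit_fun f by split.
split => //; apply/cvg_EFin_real; rewrite unit_meanE//.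
under eq_fun do rewrite unit_meanE//.
have [] // := @dominated_convergence _ _ _ P _ measurableT
  (fun n w => (f_ n w)%:E) (fun w => (f w)%:E) (fun=> 1%E).
- by move=> n; apply/measurable_EFinP; case: (uf n).
- exact/measurable_EFinP.
- by apply: aeW => w _; apply/cvg_EFin_real; exact: cf.
- exact: finite_measure_integrable_cst.
- apply: aeW => w n _; case: (uf n) => _ /(_ w)/andP[h0 h1].
  by rewrite lee_fin ger0_norm.
Qed.

Lemma unit_funM f g : unit_fun f -> unit_fun g -> unit_fun (fun w => f w * g w).
Proof.
move=> [mf f01] [mg g01]; split; first exact: measurable_funM.
move=> w; have /andP[f0 f1] := f01 w; have /andP[g0 g1] := g01 w.
by rewrite mulr_ge0//= mulr_ile1.
Qed.

Lemma unit_fun_prod (I : eqType) (r : seq I) (Q : pred I) (h : I -> T -> R) :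
  (forall i, unit_fun (h i)) -> unit_fun (fun w => \prod_(i <- r | Q i) h i w).
Proof.
move=> uh; elim: r => [|i r IH].
  under eq_fun do rewrite big_nil.
  by split => // w; rewrite ler01 lexx.
under eq_fun do rewrite big_cons; case: (Q i) => //.
exact: unit_funM.
Qed.

Lemma unit_fun_indic (A : set T) : measurable A -> unit_fun \1_A.
Proof.
move=> mA; split; first exact: measurable_indic.
by move=> w; rewrite indicE; case: (w \in A); rewrite /= ?ler01 lexx.
Qed.

Lemma unit_mean_indic (A : set T) : measurable A -> (\int[P]_w \1_A w)%:E = P A.
Proof.
by move=> mA; rewrite unit_meanE ?integral_indic ?setIT//; exact: unit_fun_indic.
Qed.

End unit_mean.

Section independent_product.
Context dT (T : measurableType dT) {R : realType} (P : probability T R).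
Context dU (U : measurableType dU) (K : nat) (X : 'I_K -> T -> U).
Hypotheses (mX : forall k, measurable_fun setT (X k))
  (indX : forall B : 'I_K -> set U, (forall k, measurable (B k)) ->
     P (\bigcap_k (X k @^-1` B k)) = (\prod_k P (X k @^-1` B k))%E).

Let mpre k B : measurable B -> measurable (X k @^-1` B).
Proof. by move=> mB; rewrite -[X in measurable X]setTI; exact: mX. Qed.

Let unit_comp k (g : U -> R) : unit_fun g -> unit_fun (fun w => g (X k w)).
Proof. by move=> [mg g01]; split => //; exact: measurableT_comp. Qed.

Lemma indic_preimage k (B : set U) w : \1_B (X k w) = \1_(X k @^-1` B) w :> R.
Proof. by rewrite !indicE; congr ((_ : bool)%:R); apply/idP/idP; rewrite !inE. Qed.

(** The factorisation of events extends to means of products, one factor at a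
    time. *)
Lemma unit_mean_prod (g : 'I_K -> U -> R) : (forall k, unit_fun (g k)) ->
  \int[P]_w \prod_k g k (X k w) = \prod_k \int[P]_w g k (X k w).
Proof.
move=> ug.
suff H j : (j <= K)%N -> forall B : 'I_K -> set U, (forall k, measurable (B k)) ->
    \int[P]_w \prod_(k < K) (if (k < j)%N then g k else \1_(B k)) (X k w) =
    \prod_(k < K) \int[P]_w (if (k < j)%N then g k else \1_(B k)) (X k w).
  have := H K (leqnn K) (fun=> setT) (fun=> measurableT).
  rewrite (eq_bigr (fun k => \int[P]_w g k (X k w))) => [<-|k _]; last by rewrite ltn_ord.
  by congr fine; apply: eq_integral => w _; congr EFin; apply: eq_bigr => k _; rewrite ltn_ord.
elim: j => [_ B mB|j IH jK B mB].
  apply: EFin_inj; rewrite -prodEFin.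
  transitivity (P (\bigcap_k (X k @^-1` B k))).
    rewrite -unit_mean_indic; last first.
      by apply: fin_bigcap_measurable => // k _; exact: mpre.
    congr EFin; congr fine; apply: eq_integral => w _; congr EFin.
    rewrite [RHS]indicE; have [h|] := pselect ((\bigcap_k (X k @^-1` B k)) w).
      by rewrite mem_set// big1// => k _; rewrite indicE mem_set//; exact: h.
    move=> h; rewrite memNset//.
    have /existsNP[k /not_implyP[_ hk]] := h.
    by rewrite (bigD1 k)//= indicE memNset// mul0r.
  rewrite indX//; apply: eq_bigr => k _; rewrite -unit_mean_indic; last exact: mpre.
  by congr EFin; congr fine; apply: eq_integral => w _; rewrite -indic_preimage.
have {}IH := IH (ltnW jK); pose j' := Ordinal jK.
pose h (k : 'I_K) := if (k < j)%N then g k else \1_(B k).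
have uh k : unit_fun (h k).
  by rewrite /h; case: ifP => _ //; exact: unit_fun_indic.
have eh (k : 'I_K) : k != j' -> (if (k < j.+1)%N then g k else \1_(B k)) = h k.
  move=> kj; rewrite /h ltnS leq_eqVlt [X in X || _](_ : _ = false)//.
  exact: negbTE.
rewrite [RHS](bigD1 j')//= ltnSn.
pose c := \prod_(k | k != j') \int[P]_w h k (X k w).
rewrite [X in _ = _ * X](_ : _ = c); last first.
  by apply: eq_bigr => k kj; rewrite eh.
have c0 : 0 <= c by rewrite prodr_ge0// => k _; apply: unit_mean_ge0; exact: unit_comp.
pose f w := \prod_(k | k != j') h k (X k w).
have uf : unit_fun f by apply: unit_fun_prod => k; exact: unit_comp.
have f0 w : 0 <= f w by case: uf => _ /(_ w)/andP[].
have [mg g01] := ug j'.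
have split_at (u : U -> R) (F : 'I_K -> U -> R) : F j' = u ->
    (forall k, k != j' -> F k = h k) ->
    \int[P]_w \prod_k F k (X k w) = \int[P]_w (f w * u (X j' w)).
  move=> Fj Fk; congr fine; apply: eq_integral => w _; congr EFin.
  rewrite (bigD1 j')//= Fj mulrC; congr (_ * _).
  by apply: eq_bigr => k kj; rewrite Fk.
rewrite (split_at (g j') (fun k : 'I_K => if (k < j.+1)%N then g k else \1_(B k)));
  [|by rewrite ltnSn|exact: eh].
apply: EFin_inj; rewrite EFinM !unit_meanE; last 2 first.
- exact: unit_comp.
- by apply: unit_funM => //; exact: unit_comp.
have cst0 (w : T) : 0 <= c by [].
pose nu := weighted_measure P cst0 (measurable_cst c) (mX j').
have g0 y : (0 <= (g j' y)%:E)%E by rewrite lee_fin; case/andP: (g01 y).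
have mEg : measurable_fun setT (fun y => (g j' y)%:E) by exact/measurable_EFinP.
transitivity (\int[nu]_y (g j' y)%:E)%E.
  rewrite (@ge0_integral_weighted _ _ _ _ R P nu f (X j') _ f0 uf.1 (mX j'))//.
  move=> A mA; have uA := unit_fun_indic (R := R) mA.
  rewrite -unit_meanE; last by apply: unit_funM => //; exact: unit_comp.
  pose BA k := if k == j' then A else B k.
  have mBA k : measurable (BA k) by rewrite /BA; case: ifP.
  rewrite -(@split_at \1_A (fun k : 'I_K => if (k < j)%N then g k else \1_(BA k))).
  - rewrite IH// (bigD1 j')//= ltnn /BA eqxx.
    rewrite [X in _ * X](_ : _ = c); last first.
      by apply: eq_bigr => k /negbTE kj; rewrite /h kj.
    rewrite mulrC EFinM unit_meanE; last exact: unit_comp.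
    rewrite -ge0_integralZl//.
    + apply/measurable_EFinP; exact: (unit_comp j' uA).1.
  - by rewrite /= ltnn /BA eqxx.
  - by move=> k /negbTE kj; rewrite /h /BA kj.
rewrite ge0_integral_weighted_measure// [RHS]muleC.
have mgX : measurable_fun setT (fun w => (g j' (X j' w))%:E).
  by apply/measurable_EFinP; exact: (unit_comp j' (ug j')).1.
by rewrite (ge0_integralZl P measurableT mgX).
Qed.

End independent_product.

(** * Powers with a random count *)

Section counting_power.
Context {R : realType}.

(** [s ^ N] for a count [N], with value [0] for an infinite count. The partial sums
    are bounded measurable functions, which gives measurability and means. *)
Definition count_power (s : R) (N : \bar R) : R :=
  limn (fun m => \sum_(k < m) s ^+ k * \1_[set k%:R%:E] N).

Lemma count_power_partial_nat s k m :
  \sum_(i < m) s ^+ i * \1_[set i%:R%:E] (k%:R%:E : \bar R) =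
  (if (k < m)%N then s ^+ k else 0) :> R.
Proof.
have E (i : nat) : s ^+ i * \1_[set i%:R%:E] (k%:R%:E : \bar R) =
    if i == k then s ^+ k else 0.
  case: eqVneq => [->|ik]; first by rewrite indicE mem_set// mulr1.
  rewrite indicE memNset ?mulr0// => -[] /eqP.
  by rewrite eqr_nat eq_sym (negbTE ik).
under eq_bigr do rewrite E.
case: ifPn => [km|]; last first.
  rewrite -leqNgt => mk; rewrite big1// => i _.
  by rewrite ifN// neq_ltn (leq_trans (ltn_ord i) mk).
rewrite (bigD1 (Ordinal km))//= eqxx big1 ?addr0// => i ik.
by rewrite ifN//; apply: contra ik => /eqP e; apply/eqP/val_inj.
Qed.

Lemma count_power_partial0 s (N : \bar R) m : (forall k, N <> k%:R%:E) ->
  \sum_(i < m) s ^+ i * \1_[set i%:R%:E] N = 0 :> R.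
Proof.
by move=> h; rewrite big1// => i _; rewrite indicE memNset ?mulr0//=; exact: h.
Qed.

Lemma count_power_nat s k : count_power s k%:R%:E = s ^+ k.
Proof.
apply/cvg_lim => //; apply: cvg_near_cst; exists k.+1 => // m /= km.
by rewrite count_power_partial_nat km.
Qed.

Lemma count_power_notin s (N : \bar R) : (forall k, N <> k%:R%:E) ->
  count_power s N = 0.
Proof.
move=> h; apply/cvg_lim => //; apply: cvg_near_cst; apply: nearW => m.
exact: count_power_partial0.
Qed.

Lemma cvg_count_power s N :
  \sum_(k < m) s ^+ k * \1_[set k%:R%:E] N @[m --> \oo] --> count_power s N.
Proof.
have [[k ->]|h] := pselect (exists k, N = k%:R%:E).
  rewrite count_power_nat; apply: cvg_near_cst; exists k.+1 => // m /= km.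
  by rewrite count_power_partial_nat km.
have {}h k : N <> k%:R%:E by move=> e; apply: h; exists k.
rewrite count_power_notin//; apply: cvg_near_cst; apply: nearW => m.
exact: count_power_partial0.
Qed.

Lemma unit_count_power_partial s m : 0 <= s <= 1 ->
  unit_fun (fun N : \bar R => \sum_(k < m) s ^+ k * \1_[set k%:R%:E] N : R).
Proof.
move=> /andP[s0 s1]; split.
  apply: measurable_sum => k; apply: measurable_funM => //.
move=> N; have [[k ->]|h] := pselect (exists k, N = k%:R%:E).
  rewrite count_power_partial_nat; case: ifP => _; last by rewrite lexx ler01.
  by rewrite exprn_ge0// exprn_ile1.
by rewrite count_power_partial0 ?lexx ?ler01// => k e; apply: h; exists k.
Qed.

Lemma unit_count_power (s : R) : 0 <= s <= 1 -> unit_fun (count_power s).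
Proof.
move=> s01; split.
  apply: (measurable_fun_cvg (h := fun m N => \sum_(k < m) s ^+ k * \1_[set k%:R%:E] N)).
    by move=> m; case: (unit_count_power_partial m s01).
  by move=> N _; exact: cvg_count_power.
move=> N; have cN := @cvg_count_power s N; rewrite -(cvg_lim _ cN)//.
have cc : cvgn (fun m => \sum_(k < m) s ^+ k * \1_[set k%:R%:E] N) by apply/cvg_ex; exists (count_power s N).
apply/andP; split; [apply: limr_ge|apply: limr_le] => //; apply: nearW => m;
  by case: (unit_count_power_partial m s01) => _ /(_ N)/andP[].
Qed.

Lemma bool_count_cases (a : nat -> bool) :
  let S m := \sum_(i < m) (a i : nat) in
  (exists k m0, forall m, (m0 <= m)%N -> S m = k) \/
  (forall k, exists m0, forall m, (m0 <= m)%N -> (k <= S m)%N).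
Proof.
move=> S.
have Sh m m' : (m <= m')%N -> (S m <= S m')%N.
  move=> /subnK <-; rewrite addnC /S big_split_ord/= leq_addr//.
have [[k hk]|h] := pselect (exists k, forall m, (S m <= k)%N).
  left; elim: k hk => [hk|k IH hk].
    by exists 0%N, 0%N => m _; apply/eqP; rewrite -leqn0.
  have [[m0 hm0]|h] := pselect (exists m, S m = k.+1).
    exists k.+1, m0 => m mm0; apply/eqP; rewrite eqn_leq hk/= -hm0; exact: Sh.
  apply: IH => m; have := hk m; rewrite leq_eqVlt => /orP[/eqP e|//].
  by exfalso; apply: h; exists m.
right => k; apply: contrapT => hk; apply: h; exists k => m.
rewrite leqNgt; apply/negP => km; apply: hk; exists m => m' mm'.
exact: leq_trans (ltnW km) (Sh _ _ mm').
Qed.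

Lemma cvg_prod_count (a : nat -> bool) (c : R) : 0 < c <= 1 ->
  \prod_(i < m) (1 - c * (a i)%:R) @[m --> \oo] -->
  count_power (1 - c) (\sum_(0 <= i <oo) ((a i)%:R : R)%:E)%E.
Proof.
move=> /andP[c0 c1]; pose S m := (\sum_(i < m) (a i : nat))%N.
have prodE m : \prod_(i < m) (1 - c * (a i)%:R) = (1 - c) ^+ S m.
  rewrite -prodrXr; apply: eq_bigr => i _.
  by case: (a i); rewrite ?mulr1 ?expr1// mulr0 subr0 expr0.
under eq_fun do rewrite prodE.
have sumE m : (\sum_(0 <= i < m) ((a i)%:R : R)%:E)%E = ((S m)%:R : R)%:E.
  by rewrite big_mkord sumEFin natr_sum.
have [[k [m0 h]]|h] := bool_count_cases a.
  have -> : (\sum_(0 <= i <oo) ((a i)%:R : R)%:E)%E = (k%:R)%:E.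
    apply/cvg_lim => //; apply: cvg_near_cst; exists m0 => // m /= mm.
    by rewrite sumE /S h.
  rewrite count_power_nat; apply: cvg_near_cst; exists m0 => // m /= mm.
  by rewrite /S h.
have -> : (\sum_(0 <= i <oo) ((a i)%:R : R)%:E)%E = +oo%E.
  apply/cvg_lim => //; apply/cvgeyPge => A.
  have [m0 hm0] := h (Num.trunc `|A|).+1; exists m0 => // m /= mm.
  rewrite sumE lee_fin (le_trans (ler_norm A))// (le_trans (ltW (truncnS_gt _)))//.
  by rewrite ler_nat hm0.
rewrite count_power_notin//.
have := @cvg_expr R (1 - c); rewrite ger0_norm ?subr_ge0// => /(_ _)/cvgrPdist_lt hc.
apply/cvgrPdist_lt => e e0; have [|N _ hN] := hc _ e e0; first by lra.
have [m0 hm0] := h N; exists m0 => // m /= mm; apply: hN => /=; exact: hm0.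
Qed.

End counting_power.

(** * Thinning of a Poisson process at finitely many rates *)

Lemma cvg_prod_ord {R : realType} K (h : 'I_K -> nat -> R) (l : 'I_K -> R) :
  (forall k, h k m @[m --> \oo] --> l k) ->
  \prod_k h k m @[m --> \oo] --> \prod_k l k.
Proof.
elim: K h l => [|K IH] h l hl.
  by under eq_fun do rewrite big_ord0; rewrite big_ord0; exact: cvg_cst.
under eq_fun do rewrite big_ord_recr/=; rewrite big_ord_recr/=.
by apply: cvgM => //; apply: IH => k; exact: hl.
Qed.

Section mutual_independence.
Context dT (T : measurableType dT) {R : realType} (P : probability T R).

Lemma mutually_independent_ord (I : choiceType) (F : I -> set (set T)) K
    (e : 'I_K -> I) (A : 'I_K -> set T) : injective e ->
  mutually_independent P F -> (forall k, F (e k) (A k)) ->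
  P (\bigcap_k A k) = (\prod_k P (A k))%E.
Proof.
move=> inje indF FA.
pose B i := if [pick k | e k == i] is Some k then A k else setT.
have Be k : B (e k) = A k.
  rewrite /B; case: pickP => [k' /eqP /inje -> //|/(_ k)].
  by rewrite eqxx.
have s_uniq : uniq [seq e k | k <- enum 'I_K] by rewrite map_inj_uniq ?enum_uniq.
pose J := seq_fset tt [seq e k | k <- enum 'I_K].
have inJ i : (i \in J) = (i \in [seq e k | k <- enum 'I_K]).
  by rewrite seq_fsetE.
have := indF J B; rewrite (perm_big _ (seq_fset_perm tt _)) undup_id// big_map big_enum/=.
rewrite (eq_bigr (fun k => P (A k))) => [<-|k _]; last by rewrite Be.
- congr (P _); apply/seteqP; split => w h.
    move=> i /=; rewrite inJ => /mapP[k _ ->]; rewrite Be; exact: h.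
  by move=> k _; rewrite -Be; apply: h => /=; rewrite inJ map_f// mem_enum.
- by move=> i; rewrite inJ => /mapP[k _ ->]; rewrite Be.
Qed.

End mutual_independence.

Section point_process.
Context dT (T : measurableType dT) {R : realType} (P : probability T R).
Context dU (U : measurableType dU) (xi : nat -> T -> U) (mu : set U -> \bar R).
Local Notation point_count := (point_count (R := R)).
Hypothesis ppp : poisson_point_process P xi mu.

Let mxi i : measurable_fun setT (xi i). Proof. by case: ppp. Qed.

Lemma point_countE A w :
  point_count xi A w = (\sum_(0 <= i <oo) ((xi i w \in A)%:R : R)%:E)%E.
Proof. by apply: eq_eseriesr => i _; rewrite diracE. Qed.

Lemma measurable_point_count A : measurable A ->
  measurable_fun setT (point_count xi A).
Proof.
move=> mA; rewrite (funext (point_countE A)).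
apply: ge0_emeasurable_sum => i.
  by move=> w _ _; rewrite lee_fin.
move=> _; apply/measurable_EFinP.
exact: (measurableT_comp (measurable_indic mA) (mxi i)).
Qed.

Lemma count_probability A r k : measurable A -> mu A = r%:E -> 0 <= r ->
  P [set w | point_count xi A w = k%:R%:E] = (expR (- r) * exp_coeff r k)%:E.
Proof.
move=> mA muA r0; have [_ /(_ A mA) + _] := ppp; rewrite /poisson_distributed muA.
move=> ->; rewrite /poisson_prob; case: ifPn => [r_gt0|].
  rewrite esum_set1 ?lee_fin ?poisson_pmf_ge0// /poisson_pmf r_gt0.
  by rewrite mulrC.
rewrite -leNgt => rle; have -> : r = 0 by apply/eqP; rewrite eq_le rle r0.
rewrite oppr0 expR0 mul1r diracE /exp_coeff/= expr0n.
case: k => [|k]; first by rewrite mem_set// fact0 divr1.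
by rewrite memNset// mul0r.
Qed.

Lemma mean_count_power A r c : measurable A -> mu A = r%:E -> 0 <= r ->
  0 <= c <= 1 ->
  \int[P]_w count_power (1 - c) (point_count xi A w) = expR (- (c * r)).
Proof.
move=> mA muA r0 /andP[c0 c1]; set s := 1 - c.
have s01 : 0 <= s <= 1 by rewrite /s; apply/andP; split; lra.
pose N := point_count xi A.
have mN : measurable_fun setT N by exact: measurable_point_count.
have [||_] := @unit_mean_cvg _ _ _ P
  (fun m w => \sum_(k < m) s ^+ k * \1_[set k%:R%:E] (N w))
  (fun w => count_power s (N w)).
- move=> m; have [mp p01] := @unit_count_power_partial R s m s01.
  by split => //; exact: (measurableT_comp mp mN).
- by move=> w; exact: cvg_count_power.
move=> /cvg_lim <-//; apply/cvg_lim => //.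
have mset k : measurable [set w | N w = k%:R%:E].
  rewrite -[X in measurable X]setTI; exact: mN (emeasurable_set1 _).
have E m : \int[P]_w (\sum_(k < m) s ^+ k * \1_[set k%:R%:E] (N w)) =
    expR (- r) * series (exp_coeff (s * r)) m.
  rewrite /series/= big_mkord mulr_sumr; apply: EFin_inj.
  rewrite unit_meanE; last first.
    have [mp p01] := @unit_count_power_partial R s m s01.
    by split => //; exact: (measurableT_comp mp mN).
  under eq_integral do rewrite -sumEFin.
  rewrite ge0_integral_sum//.
  - rewrite -sumEFin; apply: eq_bigr => k _.
    under eq_integral do rewrite EFinM.
    rewrite ge0_integralZl//.
    + rewrite (eq_integral (fun w => (\1_[set w | N w = k%:R%:E] w)%:E)); last first.
        by move=> w _; rewrite !indicE; congr ((_ : bool)%:R)%:E; apply/idP/idP; rewrite !inE.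
      rewrite integral_indic// setIT.
      rewrite [X in (_ * X)%E](count_probability k mA muA r0) -EFinM.
      by rewrite /exp_coeff/= exprMn; congr EFin; ring.
    + apply/measurable_EFinP.
      exact: (measurableT_comp (measurable_indic (emeasurable_set1 _)) mN).
    + by rewrite lee_fin exprn_ge0//; case/andP: s01.
  - move=> k; apply/measurable_EFinP; apply: measurable_funM => //.
    exact: (measurableT_comp (measurable_indic (emeasurable_set1 _)) mN).
  - move=> k w _; rewrite lee_fin mulr_ge0// exprn_ge0//; by case/andP: s01.
under eq_fun do rewrite E.
rewrite (_ : - (c * r) = - r + s * r) ?expRD; last by rewrite /s; ring.
apply: cvgM; first exact: cvg_cst.
exact: is_cvg_series_exp_coeff.
Qed.

(** Thinning at finitely many constant rates: the counts of disjoint sets are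
    independent Poisson variables. *)
Lemma thinning_simple K (A : 'I_K -> set U) (c r : 'I_K -> R) :
  (forall k, measurable (A k)) -> trivIset setT A ->
  (forall k, 0 < c k <= 1) -> (forall k, mu (A k) = (r k)%:E) ->
  (forall k, 0 <= r k) ->
  \int[P]_w \prod_(i < m) \prod_k (1 - c k * \1_(A k) (xi i w))
    @[m --> \oo] --> expR (- \sum_k c k * r k).
Proof.
move=> mA tA c01 muA r0.
have N_meas k : measurable_fun setT (point_count xi (A k)).
  exact: measurable_point_count.
have cp01 k : 0 <= 1 - c k <= 1.
  by have /andP[? ?] := c01 k; apply/andP; split; lra.
have -> : expR (- \sum_k c k * r k) =
    \int[P]_w \prod_k count_power (1 - c k) (point_count xi (A k) w).
  rewrite (@unit_mean_prod _ _ _ P _ _ K (fun k => point_count xi (A k)) N_meas _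
    (fun k => count_power (1 - c k))).
  - rewrite -sumrN expR_sum; apply: eq_bigr => k _.
    rewrite (mean_count_power (mA k) (muA k))//.
    by have /andP[? ?] := c01 k; apply/andP; split; lra.
  - move=> B mB; have [_ _ /(_ K A mA tA)] := ppp.
    move=> /(@mutually_independent_ord _ _ _ _ _ _ K id); apply => // k.
    by exists (B k) => //; rewrite setTI.
  - by move=> k; exact: unit_count_power.
have [||_ //] := @unit_mean_cvg _ _ _ P
  (fun m w => \prod_(i < m) \prod_k (1 - c k * \1_(A k) (xi i w)))
  (fun w => \prod_k count_power (1 - c k) (point_count xi (A k) w)).
- move=> m; apply: unit_fun_prod => i; apply: unit_fun_prod => k; split.
    apply: measurable_funB => //; apply: measurable_funM => //.
    exact: (measurableT_comp (measurable_indic (mA k)) (mxi i)).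
  move=> w; rewrite indicE; have /andP[? ?] := c01 k.
  by case: (_ \in _); apply/andP; split; rewrite /=; lra.
- move=> w; under eq_fun do rewrite exchange_big/=.
  apply: cvg_prod_ord => k; rewrite point_countE.
  exact: (@cvg_prod_count _ (fun i => xi i w \in A k) _ (c01 k)).
Qed.

End point_process.

(** * The generating functional of a Poisson process *)

Section dyadic_level.
Context {R : realType} dU (U : measurableType dU) (p : U -> R).
Hypotheses (mp : measurable_fun setT p) (p01 : forall u, 0 <= p u <= 1).

Definition dyadic_level n (k : 'I_(2 ^ n)) : set U :=
  p @^-1` `[k.+1%:R / 2 ^+ n, k.+2%:R / 2 ^+ n[.

Definition dyadic_rate n (k : 'I_(2 ^ n)) : R := k.+1%:R / 2 ^+ n.

Definition dyadic_approx n (u : U) : R :=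
  \sum_k dyadic_rate k * \1_(@dyadic_level n k) u.

Let p2 n : 0 < 2 ^+ n :> R. Proof. by rewrite exprn_gt0. Qed.

Lemma measurable_dyadic_level n (k : 'I_(2 ^ n)) : measurable (dyadic_level k).
Proof. by rewrite -[X in measurable X]setTI; apply: mp => //; exact: measurable_itv. Qed.

Lemma dyadic_levelE n (k : 'I_(2 ^ n)) u :
  dyadic_level k u <-> Num.trunc (p u * 2 ^+ n) = k.+1.
Proof.
have /andP[p0 _] := p01 u.
rewrite /dyadic_level/= in_itv/= ler_pdivrMr// ltr_pdivlMr//; split.
  by move=> h; apply/eqP; rewrite truncn_eq// mulr_ge0// ltW.
by move/eqP; rewrite truncn_eq// mulr_ge0// ltW.
Qed.

Lemma trivIset_dyadic_level n : trivIset setT (@dyadic_level n).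
Proof.
move=> i j _ _ [u [/dyadic_levelE ui /dyadic_levelE]]; rewrite ui => -[ij].
exact/val_inj.
Qed.

Lemma dyadic_rate01 n (k : 'I_(2 ^ n)) : 0 < dyadic_rate k <= 1.
Proof.
rewrite /dyadic_rate divr_gt0//= ler_pdivrMr// mul1r -natrX ler_nat.
exact: ltn_ord.
Qed.

Lemma dyadic_indic n (k : 'I_(2 ^ n)) u :
  \1_(dyadic_level k) u = (Num.trunc (p u * 2 ^+ n) == k.+1)%:R :> R.
Proof.
rewrite indicE; congr ((_ : bool)%:R); apply/idP/idP.
  by rewrite inE => /dyadic_levelE/eqP.
by move/eqP/dyadic_levelE; rewrite inE.
Qed.

Lemma dyadic_case n u :
  Num.trunc (p u * 2 ^+ n) = 0%N \/
  exists k : 'I_(2 ^ n), Num.trunc (p u * 2 ^+ n) = k.+1.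
Proof.
have /andP[p0 p1] := p01 u.
case E : (Num.trunc (p u * 2 ^+ n)) => [|k]; [by left|right].
suff kn : (k < 2 ^ n)%N by exists (Ordinal kn).
rewrite -(ler_nat R) natrX; apply: (@le_trans _ _ (p u * 2 ^+ n)).
  rewrite -E truncn_le mulr_ge0// ltW//.
by rewrite ler_piMl// ltW.
Qed.

Lemma dyadic_approxE n u :
  dyadic_approx n u = (Num.trunc (p u * 2 ^+ n))%:R / 2 ^+ n.
Proof.
rewrite /dyadic_approx; under eq_bigr do rewrite dyadic_indic.
have [->|[k ->]] := dyadic_case n u.
  by rewrite big1 ?mul0r// => j _; rewrite mulr0.
rewrite (bigD1 k)//= eqxx mulr1 big1 ?addr0// => j jk.
rewrite eqSS (_ : (k == j :> nat) = false) ?mulr0//.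
by rewrite eq_sym; exact: negbTE.
Qed.

Lemma prod_dyadicE n u :
  \prod_k (1 - dyadic_rate k * \1_(@dyadic_level n k) u) = 1 - dyadic_approx n u.
Proof.
rewrite dyadic_approxE; under eq_bigr do rewrite dyadic_indic.
have [->|[k ->]] := dyadic_case n u.
  by rewrite big1 ?mul0r ?subr0// => j _; rewrite mulr0 subr0.
rewrite (bigD1 k)//= eqxx mulr1 big1 ?mulr1// => j jk.
rewrite eqSS (_ : (k == j :> nat) = false) ?mulr0 ?subr0//.
by rewrite eq_sym; exact: negbTE.
Qed.

Lemma dyadic_approx_bounds n u : 0 <= dyadic_approx n u <= p u.
Proof.
have /andP[p0 _] := p01 u; rewrite dyadic_approxE divr_ge0 ?(ltW (p2 n))//=.
by rewrite ler_pdivrMr// truncn_le mulr_ge0// ltW.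
Qed.

Lemma cvg_dyadic_approx u : dyadic_approx n u @[n --> \oo] --> p u.
Proof.
have /andP[p0 _] := p01 u.
apply: (@squeeze_cvgr _ _ _ _ (fun n => p u - 2^-1 ^+ n) (fun=> p u)).
- apply: nearW => n; have /andP[_ ->] := dyadic_approx_bounds n u.
  rewrite andbT dyadic_approxE ler_pdivlMr// mulrBl -exprMn mulVf// expr1n.
  rewrite lerBlDr.
  have := truncn_itv (mulr_ge0 p0 (ltW (p2 n))) => /andP[_ /ltW].
  by rewrite -[X in _ <= X -> _]natr1.
- rewrite -[X in _ --> X]subr0; apply: cvgB; first exact: cvg_cst.
  by apply: cvg_expr; rewrite ger0_norm ?invr_ge0// invf_lt1// ltr1n.
- exact: cvg_cst.
Qed.

Lemma measurable_dyadic_approx n : measurable_fun setT (dyadic_approx n).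
Proof.
apply: measurable_sum => k; apply: measurable_funM => //.
exact: (measurable_indic (measurable_dyadic_level k)).
Qed.

End dyadic_level.

Section generating_functional.
Context dT (T : measurableType dT) {R : realType} (P : probability T R).
Context dU (U : measurableType dU) (xi : nat -> T -> U) (mu : set U -> \bar R).
Hypothesis ppp : poisson_point_process P xi mu.
Context (lam : {measure set U -> \bar R}) (f : U -> R).
Hypotheses (f0 : forall u, 0 <= f u) (mf : measurable_fun setT f)
  (muE : forall A, measurable A -> mu A = (\int[lam]_(u in A) (f u)%:E)%E).
Context (p : U -> R).
Hypotheses (mp : measurable_fun setT p) (p01 : forall u, 0 <= p u <= 1)
  (fin : (\int[lam]_u (p u * f u)%:E < +oo)%E).

Let mxi i : measurable_fun setT (xi i). Proof. by case: ppp. Qed.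

Let total : R := fine (\int[lam]_u (p u * f u)%:E)%E.
Let approx_total n : R := fine (\int[lam]_u (dyadic_approx p n u * f u)%:E)%E.

Let mdf n : measurable_fun setT (fun u => dyadic_approx p n u * f u).
Proof. by apply: measurable_funM => //; exact: measurable_dyadic_approx. Qed.

Let ipf : lam.-integrable setT (fun u => (p u * f u)%:E).
Proof.
apply/integrableP; split; first by apply/measurable_EFinP; exact: measurable_funM.
rewrite (eq_integral (fun u => (p u * f u)%:E))// => u _.
by rewrite gee0_abs// lee_fin mulr_ge0//; case/andP: (p01 u).
Qed.

Let cvg_approx_total : approx_total n @[n --> \oo] --> total.
Proof.
have [] // := @dominated_convergence _ _ _ lam _ measurableT
  (fun n u => (dyadic_approx p n u * f u)%:E) (fun u => (p u * f u)%:E)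
  (fun u => (p u * f u)%:E).
- by move=> n; exact/measurable_EFinP.
- by apply/measurable_EFinP; exact: measurable_funM.
- apply: aeW => u _; apply/cvg_EFin_real; apply: cvgM; last exact: cvg_cst.
  exact: cvg_dyadic_approx.
- apply: aeW => u n _; have /andP[d0 dp] := dyadic_approx_bounds p01 n u.
  by rewrite lee_fin ger0_norm ?mulr_ge0// ler_wpM2r.
- move=> _ _ h; apply: fine_cvg; rewrite fineK//; exact: integrable_fin_num.
Qed.

Let level_mass n (k : 'I_(2 ^ n)) :
  (\int[lam]_u (\1_(dyadic_level p k) u * f u)%:E = mu (dyadic_level p k))%E.
Proof.
rewrite muE; last exact: measurable_dyadic_level.
rewrite [RHS]integral_mkcond; apply: eq_integral => u _; rewrite patchE indicE.
by case: (u \in _); rewrite ?mul1r// mul0r.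
Qed.

Let mlf n (k : 'I_(2 ^ n)) :
  measurable_fun setT (fun u => \1_(dyadic_level p k) u * f u).
Proof.
apply: measurable_funM => //.
exact: (measurable_indic (measurable_dyadic_level mp k)).
Qed.

Let level_mass_ge0 n (k : 'I_(2 ^ n)) : (0 <= mu (dyadic_level p k))%E.
Proof.
by rewrite -level_mass; apply: integral_ge0 => u _; rewrite lee_fin mulr_ge0.
Qed.

Let level_mass_fin n (k : 'I_(2 ^ n)) :
  mu (dyadic_level p k) = (fine (mu (dyadic_level p k)))%:E.
Proof.
rewrite fineK// ge0_fin_numE//.
have /andP[r0 _] := @dyadic_rate01 R n k.
rewrite -(@lte_pmul2l _ (@dyadic_rate R _ k)%:E) ?lte_fin// mulry gtr0_sg// mul1e.
apply: le_lt_trans fin; rewrite -level_mass -ge0_integralZl//.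
- apply: ge0_le_integral => //.
  + by move=> u _; rewrite -EFinM lee_fin !mulr_ge0// ltW.
  + by under eq_fun do rewrite -EFinM; apply/measurable_EFinP; exact: measurable_funM.
  + by apply/measurable_EFinP; exact: measurable_funM.
  + move=> u _; rewrite lee_fin mulrA ler_wpM2r//.
    have /andP[_] := dyadic_approx_bounds p01 n u; apply: le_trans.
    rewrite /dyadic_approx (bigD1 k)//= lerDl sumr_ge0// => j _.
    by rewrite mulr_ge0//; case/andP: (@dyadic_rate01 R n j) => /ltW.
- exact/measurable_EFinP.
- by move=> u _; rewrite lee_fin mulr_ge0.
- by rewrite lee_fin ltW.
Qed.

Let approx_totalE n : approx_total n =
  \sum_k @dyadic_rate R _ k * fine (mu (@dyadic_level R dU U p n k)).
Proof.
apply: EFin_inj; rewrite -sumEFin.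
rewrite (eq_bigr (fun k => ((@dyadic_rate R _ k)%:E *
  \int[lam]_u (\1_(@dyadic_level R dU U p n k) u * f u)%:E)%E)); last first.
  by move=> k _; rewrite EFinM level_mass -level_mass_fin.
rewrite (eq_bigr (fun k => (\int[lam]_u (@dyadic_rate R _ k *
  (\1_(@dyadic_level R dU U p n k) u * f u))%:E)%E)); last first.
  move=> k _; rewrite -ge0_integralZl//.
  - exact/measurable_EFinP.
  - by move=> u _; rewrite lee_fin mulr_ge0.
  - by rewrite lee_fin ltW//; case/andP: (@dyadic_rate01 R n k).
rewrite -ge0_integral_sum//.
- rewrite fineK.
    apply: eq_integral => u _; rewrite /dyadic_approx mulr_suml -sumEFin.
    by apply: eq_bigr => k _; rewrite mulrA.
  apply: integrable_fin_num => //; apply: le_integrable ipf => //.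
    exact/measurable_EFinP.
  move=> u _; have /andP[d0 dp] := dyadic_approx_bounds p01 n u.
  by rewrite lee_fin !ger0_norm ?mulr_ge0// ?ler_wpM2r// (le_trans d0).
- by move=> k; apply/measurable_EFinP; exact: measurable_funM.
- by move=> k u _; rewrite lee_fin !mulr_ge0// ltW//.
Qed.

Let unit_thin (q : U -> R) m : measurable_fun setT q ->
  (forall u, 0 <= q u <= 1) ->
  unit_fun (fun w => \prod_(i < m) (1 - q (xi i w))).
Proof.
move=> mq q01; apply: unit_fun_prod => i; split.
  by apply: measurable_funB => //; exact: (measurableT_comp mq (mxi i)).
by move=> w; have /andP[? ?] := q01 (xi i w); apply/andP; split; lra.
Qed.

Let dyadic01 n u : 0 <= dyadic_approx p n u <= 1.
Proof.
have /andP[-> dp] := dyadic_approx_bounds p01 n u; rewrite (le_trans dp)//.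
by case/andP: (p01 u).
Qed.

Let cvg_approx n :
  \int[P]_w \prod_(i < m) (1 - dyadic_approx p n (xi i w)) @[m --> \oo] -->
  expR (- approx_total n).
Proof.
rewrite approx_totalE.
have := @thinning_simple _ _ _ P _ _ xi mu ppp (2 ^ n) (@dyadic_level R dU U p n)
  (@dyadic_rate R n) (fun k => fine (mu (@dyadic_level R dU U p n k))).
under eq_cvg do under eq_Rintegral do under eq_bigr do rewrite prod_dyadicE//.
apply => //.
- exact: measurable_dyadic_level.
- exact: trivIset_dyadic_level.
- by move=> k; exact: dyadic_rate01.
- by move=> k; rewrite fine_ge0.
Qed.

Let le_thin (q q' : U -> R) m w : (forall u, 0 <= q u <= 1) ->
  (forall u, 0 <= q' u <= 1) -> (forall u, q u <= q' u) ->
  \prod_(i < m) (1 - q' (xi i w)) <= \prod_(i < m) (1 - q (xi i w)).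
Proof.
move=> q01 q01' qq'; apply: ler_prod => i _.
have /andP[? ?] := q01' (xi i w); have := qq' (xi i w).
by move=> ?; apply/andP; split; lra.
Qed.

(** The generating functional of a Poisson process. The products are decreasing
    in the number of factors and in the rate, so that the limits along the
    factors and along the dyadic approximations of the rate can be exchanged. *)
Lemma generating_functional :
  \int[P]_w \prod_(i < m) (1 - p (xi i w)) @[m --> \oo] --> expR (- total).
Proof.
pose b m := \int[P]_w \prod_(i < m) (1 - p (xi i w)).
pose a n m := \int[P]_w \prod_(i < m) (1 - dyadic_approx p n (xi i w)).
have ua n m : unit_fun (fun w => \prod_(i < m) (1 - dyadic_approx p n (xi i w))).
  by apply: unit_thin; [exact: measurable_dyadic_approx|exact: dyadic01].
have ub m : unit_fun (fun w => \prod_(i < m) (1 - p (xi i w))) by exact: unit_thin.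
have ba n m : b m <= a n m.
  apply: le_unit_mean => // w; apply: le_thin => // u.
  by case/andP: (dyadic_approx_bounds p01 n u).
have a_ge n m : expR (- approx_total n) <= a n m.
  have cn := @cvg_approx n; rewrite -(cvg_lim _ cn)//; apply: nonincreasing_cvgn_ge.
    apply/nonincreasing_seqP => k; apply: le_unit_mean => // w.
    rewrite big_ord_recr/= ler_piMr//.
      by case: (ua n k) => _ /(_ w)/andP[].
    by rewrite gerBl; case/andP: (dyadic01 n (xi k w)).
  by apply/cvg_ex; exists (expR (- approx_total n)).
have cvg_exp : expR (- approx_total n) @[n --> \oo] --> expR (- total).
  apply: continuous_cvg; first exact: continuous_expR.
  by apply: cvgN; exact: cvg_approx_total.
have b_ge m : expR (- total) <= b m.
  have [||_ cb] := @unit_mean_cvg _ _ _ P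
      (fun n w => \prod_(i < m) (1 - dyadic_approx p n (xi i w)))
      (fun w => \prod_(i < m) (1 - p (xi i w))).
  - by move=> n; exact: ua.
  - move=> w; apply: (@cvg_prod_ord _ m (fun i n => 1 - dyadic_approx p n (xi i w))).
    by move=> i; apply: cvgB; [exact: cvg_cst|exact: cvg_dyadic_approx].
  rewrite /b -(cvg_lim _ cvg_exp)// -(cvg_lim _ cb)//; apply: ler_lim.
  - by apply/cvg_ex; exists (expR (- total)).
  - by apply/cvg_ex; exists (b m).
  - by apply: nearW => n; exact: a_ge.
apply/cvgrPdist_lt => e e0.
have e20 : 0 < e / 2 by rewrite divr_gt0.
move: cvg_exp => /cvgrPdist_lt/(_ _ e20)[n0 _ /(_ n0 (leqnn _))/= hn].
have cn0 := @cvg_approx n0; move: cn0 => /cvgrPdist_lt/(_ _ e20)[m0 _ hm].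
exists m0 => // m /hm/=; rewrite -/(a n0 m) -/(b m) => am.
have := ba n0 m; have := b_ge m; move: hn am; rewrite !ltr_norml.
by move=> /andP[? ?] /andP[? ?] ? ?; apply/andP; split; lra.
Qed.

End generating_functional.

(** * Joint measurability of continuous fields *)

Section borel_rV.
Context {R : realType} (d : nat).
Local Notation E := (borel_rV R d).

Lemma continuous_measurable_rV (g : 'rV[R]_d -> R) : continuous g ->
  measurable_fun setT (g : E -> R).
Proof.
move=> cg; apply: (measurability (@RGenInftyO.G R)).
  exact: RGenInftyO.measurableE.
move=> _ [_ [x ->] <-]; rewrite setTI; apply: sub_sigma_algebra.
by move/continuousP : cg; apply; exact: interval_open.
Qed.

Lemma continuous_measurable_rV_rV (g : 'rV[R]_d -> 'rV[R]_d) : continuous g ->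
  measurable_fun setT (g : E -> E).
Proof.
move=> cg; apply: (@measurability _ _ E E setT (g : E -> E) (@open 'rV[R]_d)) => //.
move=> _ [A oA <-]; rewrite setTI; apply: sub_sigma_algebra.
by move/continuousP : cg; apply.
Qed.

Lemma measurable_subrV (t : 'rV[R]_d) :
  measurable_fun setT ((fun h : 'rV[R]_d => t - h) : E -> E).
Proof.
apply: continuous_measurable_rV_rV => h.
by apply: continuousB; [exact: cst_continuous|exact: cvg_id].
Qed.

Definition grid_index n (h : 'rV[R]_d) : 'rV[int]_d :=
  \row_j Num.floor (h ord0 j * 2 ^+ n).

Definition grid_point n (z : 'rV[int]_d) : 'rV[R]_d :=
  \row_j ((z ord0 j)%:~R / 2 ^+ n).

Lemma measurable_grid_cell n z : measurable ([set h | grid_index n h = z] : set E).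
Proof.
have -> : [set h | grid_index n h = z] = \bigcap_(j : 'I_d)
    ((fun h : 'rV[R]_d => h ord0 j * 2 ^+ n) @^-1` `[(z ord0 j)%:~R, (z ord0 j + 1)%:~R[).
  apply/seteqP; split => [h /= <- j _|h hz].
    by rewrite /= in_itv/= mxE; exact: floor_itv.
  apply/rowP => j; rewrite mxE; apply/eqP; rewrite floor_eq.
  by have := hz j I; rewrite /= in_itv.
apply: fin_bigcap_measurable; first exact: finite_finset.
move=> j _; rewrite -[X in measurable X]setTI.
have : measurable_fun setT ((fun h : 'rV[R]_d => h ord0 j * 2 ^+ n) : E -> R).
  apply: measurable_funM => //; apply: continuous_measurable_rV.
  exact: coord_continuous.
by apply => //; exact: measurable_itv.
Qed.

Lemma cvg_grid_point (h : 'rV[R]_d) :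
  grid_point n (grid_index n h) @[n --> \oo] --> h.
Proof.
apply/cvg_ballP => e e0.
have : (2^-1 : R) ^+ n @[n --> \oo] --> 0.
  by apply: cvg_expr; rewrite ger0_norm ?invr_ge0// invf_lt1// ltr1n.
move=> /cvgr0Pnorm_lt/(_ _ e0) [N _ hN]; exists N => // n /hN/= ne; split => // i j.
rewrite (ord1 i) -ball_normE/= !mxE.
have p2 : 0 < 2 ^+ n :> R by rewrite exprn_gt0.
apply: le_lt_trans ne; rewrite (ger0_norm (exprn_ge0 _ _)) ?invr_ge0//.
have /andP[f1 f2] := floor_itv (h ord0 j * 2 ^+ n).
rewrite ger0_norm; last by rewrite subr_ge0 ler_pdivrMr.
rewrite -(ler_pM2r p2) mulrBl divfK ?gt_eqF// -exprMn mulVf// expr1n.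
by rewrite intrD in f2; rewrite lerBlDl ltW.
Qed.

(** A field with continuous paths is jointly measurable, being the limit of the
    fields read at the lower corner of the dyadic cell of the argument. *)
Lemma measurable_evaluation dT (T : measurableType dT) (Y : 'rV[R]_d -> T -> R) :
  (forall t, measurable_fun setT (Y t)) ->
  (forall w, continuous (fun t => Y t w)) ->
  measurable_fun setT (fun z : E * T => Y z.1 z.2).
Proof.
move=> mY cY.
apply: (measurable_fun_cvg
  (h := fun n (z : E * T) => Y (grid_point n (grid_index n z.1)) z.2)).
- move=> n _ B mB; rewrite setTI.
  have -> : (fun z : E * T => Y (grid_point n (grid_index n z.1)) z.2) @^-1` B =
      \bigcup_(z : 'rV[int]_d)
        ([set h | grid_index n h = z] `*` (Y (grid_point n z) @^-1` B)).
    apply/seteqP; split => [[h w] /= hB|[h w] [z _ [/= <-]]//].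
    by exists (grid_index n h).
  apply: countable_bigcupT_measurable.
    exact: countableP.
  move=> z; apply: measurableX; first exact: measurable_grid_cell.
  by rewrite -[X in measurable X]setTI; exact: mY.
- move=> [h w] _ /=; apply: (@cvg_comp _ _ _ (fun n => grid_point n (grid_index n h))
    (fun t => Y t w) _ _ _ (@cvg_grid_point h)).
  exact: cY.
Qed.

End borel_rV.

(** * Decoupling of independent sigma-algebras *)

Section decoupling.
Context dT (T : measurableType dT) {R : realType} (P : probability T R).
Context d1 d2 (T1 : measurableType d1) (T2 : measurableType d2).

(** For independent [a] and [b] the joint law is the product of the laws, so the
    second argument may be averaged first, with the first one frozen. *)
Lemma unit_mean_decoupling (a : {mfun T >-> T1}) (b : {mfun T >-> T2})
    (g : T1 * T2 -> R) :
  (forall A B, measurable A -> measurable B ->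
    P (a @^-1` A `&` b @^-1` B) = P (a @^-1` A) * P (b @^-1` B))%E ->
  unit_fun g ->
  \int[P]_w g (a w, b w) = \int[P]_v \int[P]_w g (a v, b w).
Proof.
move=> ind [mg g01].
have g0 z : (0 <= (g z)%:E)%E by rewrite lee_fin; case/andP: (g01 z).
have mEg : measurable_fun setT (fun z => (g z)%:E) by exact/measurable_EFinP.
have mab : measurable_fun setT (fun w => (a w, b w)).
  exact: measurable_fun_pair.
pose m1 := distribution P a; pose m2 := distribution P b.
have usec x : unit_fun (fun w => g (x, b w)).
  split=> [|w]; last exact: g01.
  apply: measurableT_comp => //; exact: measurable_fun_pair.
have sec x : (\int[m2]_y (g (x, y))%:E = \int[P]_w (g (x, b w))%:E)%E.
  rewrite /m2 ge0_integral_distribution//.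
  by apply: (measurableT_comp mEg); exact: measurable_pair1.
have uout : unit_fun (fun v => \int[P]_w g (a v, b w)).
  split.
    rewrite (_ : (fun v => _) = fine \o (fubini_F m2 (fun z => (g z)%:E)) \o a).
      apply: (measurableT_comp (fine_measurable _)) => //.
      apply: measurableT_comp => //.
      exact: (measurable_fun_fubini_tonelli_F (m2 := m2)).
    by apply/funext => v /=; rewrite /fubini_F sec.
  move=> v; have ua := usec (a v).
  rewrite -!lee_fin unit_meanE//; apply/andP; split.
    by apply: integral_ge0 => w _; exact: g0.
  rewrite -[leRHS](probability_setT P) -[P setT]mul1e -integral_cst//.
  apply: ge0_le_integral => //.
  - by apply/measurable_EFinP; case: ua.
  - by move=> w _; rewrite lee_fin; case/andP: (g01 (a v, b w)).
apply: EFin_inj; rewrite unit_meanE; last first.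
  split=> [|w]; last exact: g01.
  exact: (measurableT_comp mg mab).
rewrite unit_meanE//.
transitivity (\int[pushforward P (fun w => (a w, b w))]_z (g z)%:E)%E.
  by rewrite ge0_integral_pushforward.
transitivity (\int[m1 \x m2]_z (g z)%:E)%E.
  apply: eq_measure_integral => A mA _; apply/esym.
  exact: product_measure_unique.
rewrite fubini_tonelli1// ge0_integral_distribution//.
- by apply: eq_integral => v _ /=; rewrite /fubini_F sec unit_meanE.
- exact: (measurable_fun_fubini_tonelli_F (m2 := m2)).
- by move=> x; apply: integral_ge0 => y _; exact: g0.
Qed.

End decoupling.

Section sub_sigma_algebra.
Context dT (T : measurableType dT) dU (U : measurableType dU) (I : Type)
  (f : I -> T -> U).

(** Makes measurability with respect to the sigma-algebra generated by a family an
    instance of measurability between spaces. *)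
Definition generated_type :=
  g_sigma_algebraType
    (\bigcup_(i in [set: I]) preimage_set_system setT (f i) measurable).

Lemma measurable_generator i :
  measurable_fun setT (f i : generated_type -> U).
Proof.
by move=> _ B mB; apply: sub_sigma_algebra; exists i => //; exists B.
Qed.

Lemma measurable_generatedE (A : set T) :
  sigma_gen f A <-> measurable (A : set generated_type).
Proof. by []. Qed.

Lemma sigma_gen_measurable (A : set T) :
  (forall i, measurable_fun setT (f i)) -> sigma_gen f A -> measurable A.
Proof.
move=> mf; apply: smallest_sub; first exact: sigma_algebra_measurable.
by move=> _ [i _ [B mB <-]]; exact: mf.
Qed.

End sub_sigma_algebra.

(** * Exceedances of a marked Poisson process *)

Section stays_below.
Context {R : realType} (d n : nat) (S : Type).
Implicit Types (Y : 'rV[R]_d -> S -> R) (v : 'I_n -> 'rV[R]_d) (l : 'I_n -> R).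

Definition stays_below Y v l (w : S) : R := \prod_j \1_`]-oo, l j] (Y (v j) w).

Lemma stays_belowE Y v l w :
  stays_below Y v l w = [forall j, Y (v j) w <= l j]%:R.
Proof.
rewrite /stays_below; have [/forallP h|] := boolP [forall j, Y (v j) w <= l j].
  by rewrite big1// => j _; rewrite indicE mem_set//= in_itv/=.
rewrite negb_forall => /existsP[j xj]; rewrite (bigD1 j)//= indicE memNset ?mul0r//.
by rewrite /= in_itv/=; exact/negP.
Qed.

Lemma stays_below_bounds Y v l w : 0 <= stays_below Y v l w <= 1.
Proof.
by rewrite stays_belowE; case: [forall j, Y (v j) w <= l j]; rewrite /= ?ler01 ?lexx.
Qed.

End stays_below.

Section stays_below_measurable.
Context {R : realType} (d n : nat) dS (S : measurableType dS).
Context (Y : 'rV[R]_d -> S -> R) (mY : forall t, measurable_fun setT (Y t)).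

Lemma unit_stays_below (v : 'I_n -> 'rV[R]_d) (l : 'I_n -> R) :
  unit_fun (stays_below Y v l).
Proof.
split; last exact: stays_below_bounds.
apply: measurable_prod => j _.
exact: (measurableT_comp (measurable_indic (measurable_itv `]-oo, l j])) (mY (v j))).
Qed.

Lemma unit_stays_below_joint dU (U : measurableType dU)
    (site : 'I_n -> U -> borel_rV R d) (lev : 'I_n -> U -> R) :
  (forall w, continuous (fun t => Y t w)) ->
  (forall j, measurable_fun setT (site j)) ->
  (forall j, measurable_fun setT (lev j)) ->
  unit_fun (fun z : U * S => stays_below Y (site^~ z.1) (lev^~ z.1) z.2).
Proof.
move=> cY ms ml; split; last by move=> z; exact: stays_below_bounds.
apply: measurable_prod => j _.
have mz : measurable_fun setT (fun z : U * S => Y (site j z.1) z.2 - lev j z.1).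
  apply: measurable_funB; last exact: measurableT_comp (ml j) measurable_fst.
  have msz : measurable_fun setT (fun z : U * S => (site j z.1, z.2)).
    apply: measurable_fun_pair; last exact: measurable_snd.
    exact: measurableT_comp (ms j) measurable_fst.
  exact: measurableT_comp (measurable_evaluation mY cY) msz.
apply: (eq_measurable_fun
  (fun z : U * S => \1_`]-oo, 0] (Y (site j z.1) z.2 - lev j z.1) : R)).
  move=> z _ /=; rewrite !indicE; congr ((_ : bool)%:R).
  by apply/idP/idP; rewrite !inE/= !in_itv/= subr_le0.
exact: (measurableT_comp (measurable_indic (measurable_itv `]-oo, (0 : R)])) mz).
Qed.

End stays_below_measurable.

Section marked_process.
Context {R : realType} (d : nat).
Context d0 (T0 : measurableType d0) (P0 : probability T0 R) (W : 'rV[R]_d -> T0 -> R).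
Context dT (T : measurableType dT) (P : probability T R)
  (Wi : nat -> 'rV[R]_d -> T -> R).
Hypotheses (mW : random_field W) (cW : continuous_paths W)
  (hWi : independent_copies P0 W P Wi).
Context dU (U : measurableType dU) (xi : nat -> T -> U) (mu : set U -> \bar R).
Hypotheses (ppp : poisson_point_process P xi mu)
  (hind : independent2 P (sigma_gen xi)
     (sigma_gen (fun it : nat * 'rV[R]_d => Wi it.1 it.2))).
Context (lam : {measure set U -> \bar R}) (f : U -> R).
Hypotheses (f0 : forall u, 0 <= f u) (mf : measurable_fun setT f)
  (muE : forall A, measurable A -> mu A = (\int[lam]_(u in A) (f u)%:E)%E).
Context (n : nat) (site : 'I_n -> U -> borel_rV R d) (lev : 'I_n -> U -> R).
Hypotheses (ms : forall j, measurable_fun setT (site j))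
  (ml : forall j, measurable_fun setT (lev j)).

Let mxi i : measurable_fun setT (xi i). Proof. by case: ppp. Qed.
Let mWi i t : measurable_fun setT (Wi i t).
Proof. by case: hWi => h _ _ _; exact: h. Qed.

Let cWi i w : continuous (fun t => Wi i t w).
Proof. by case: hWi => _ h _ _; exact: h. Qed.

Definition exceed_prob (u : U) : R :=
  1 - \int[P0]_w stays_below W (site^~ u) (lev^~ u) w.

Hypothesis fin : (\int[lam]_u (exceed_prob u * f u)%:E < +oo)%E.

Lemma mean_stays_below_copy i (v : 'I_n -> 'rV[R]_d) (l : 'I_n -> R) :
  \int[P]_w stays_below (Wi i) v l w = \int[P0]_w stays_below W v l w.
Proof.
pose B := [set x : n.-tuple R | forall j, tnth x j <= l j].
have mB : measurable B.
  rewrite (_ : B = \bigcap_(j : 'I_n) ((@tnth n R)^~ j @^-1` `]-oo, l j])).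
    apply: fin_bigcap_measurable; first exact: finite_finset.
    move=> j _; rewrite -[X in measurable X]setTI.
    exact: (@measurable_tnth _ _ n j measurableT _ (measurable_itv `]-oo, l j])).
  apply/seteqP; split => x /= h j; first by move=> _; rewrite /= in_itv/=.
  by have := h j I; rewrite /= in_itv.
have E dS (S : measurableType dS) (Q : probability S R) (Y : 'rV[R]_d -> S -> R) :
    (forall t, measurable_fun setT (Y t)) ->
    (\int[Q]_w stays_below Y v l w)%:E = Q [set w | B [tuple Y (v j) w | j < n]].
  move=> mY; rewrite -unit_mean_indic; last first.
    rewrite -[X in measurable X]setTI.
    have : measurable_fun setT (fun w => [tuple Y (v j) w | j < n]).
      apply/measurable_fun_tnthP => j.
      rewrite (_ : _ \o _ = Y (v j)); first exact: mY.
      by apply/funext => w /=; rewrite tnth_mktuple.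
    exact.
  congr EFin; apply: eq_Rintegral => w _; rewrite stays_belowE indicE.
  congr ((_ : bool)%:R); apply/forallP/idP => [h|].
    by rewrite inE => j; rewrite /= tnth_mktuple.
  by rewrite inE => h j; have := h j; rewrite /= tnth_mktuple.
apply: EFin_inj; rewrite (E _ _ P (Wi i) (mWi i)) (E _ _ P0 W mW).
by case: hWi => _ _ /(_ i) + _; apply.
Qed.

(** For frozen points the marks are independent copies of the field, and each factor
    is a function of one of them. *)
Lemma mean_prod_marks (q : R) m (u : nat -> U) : 0 <= q <= 1 ->
  \int[P]_w \prod_(i < m) (1 - q * (1 -
    stays_below (Wi i) (site^~ (u i)) (lev^~ (u i)) w)) =
  \prod_(i < m) (1 - q * exceed_prob (u i)).
Proof.
move=> /andP[q0 q1].
pose X (i : 'I_m) := stays_below (Wi i) (site^~ (u i)) (lev^~ (u i)).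
pose g (x : R) := 1 - q * (1 - \1_[set (1 : R)] x).
have gX (i : 'I_m) w : g (X i w) = 1 - q * (1 - X i w).
  rewrite /g /X stays_belowE indicE; case: [forall j, _ <= _] => /=.
    by rewrite mem_set.
  by rewrite memNset// => /eqP; rewrite eq_sym oner_eq0.
have uX i : unit_fun (X i) by exact: unit_stays_below.
have ug : unit_fun g.
  split.
    apply: measurable_funB => //; apply: measurable_funM => //.
    apply: measurable_funB => //; exact: (measurable_indic (measurable_set1 _)).
  move=> x; rewrite /g indicE; case: (_ \in _); rewrite /=; apply/andP; split; lra.
have indX (B : 'I_m -> set R) : (forall k, measurable (B k)) ->
    P (\bigcap_k (X k @^-1` B k)) = (\prod_k P (X k @^-1` B k))%E.
  move=> mB; have [_ _ _ mi] := hWi.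
  apply: (mutually_independent_ord (@ord_inj m) mi) => k.
  apply/measurable_generatedE; rewrite -[X in measurable X]setTI.
  have [+ _] := @unit_stays_below R d n _ (generated_type (Wi k)) (Wi k)
    (fun t => @measurable_generator _ _ _ _ _ (Wi k) t) (site^~ (u k)) (lev^~ (u k)).
  by apply.
transitivity (\int[P]_w \prod_k g (X k w)).
  by apply: eq_Rintegral => w _; apply: eq_bigr => i _; rewrite gX.
rewrite (@unit_mean_prod _ _ _ P _ _ m X (fun k => (uX k).1) indX (fun=> g))//.
apply: eq_bigr => i _; rewrite /exceed_prob -(mean_stays_below_copy i).
transitivity (\int[P]_w ((1 - q) + q * X i w)).
  by apply: eq_Rintegral => w _; rewrite gX; ring.
have iX := integrable_unit P (uX i).
have iqX : P.-integrable setT (EFin \o (fun w => q * X i w)).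
  exact: (integrableZl measurableT q iX).
have iq : P.-integrable setT (EFin \o (fun=> 1 - q)).
  exact: finite_measure_integrable_cst.
rewrite RintegralD// Rintegral_cst// RintegralZl//= probability_setT/= mulr1; ring.
Qed.

Lemma unit_exceed_prob : measurable_fun setT exceed_prob /\
  forall u, 0 <= exceed_prob u <= 1.
Proof.
have [mj j01] := @unit_stays_below_joint R d n _ T0 W mW _ U site lev cW ms ml.
split.
  apply: measurable_funB => //.
  apply: (measurableT_comp (fine_measurable _)) => //.
  apply: (measurable_fun_fubini_tonelli_F (m2 := P0)
    (fun z : U * T0 => (stays_below W (site^~ z.1) (lev^~ z.1) z.2)%:E)).
    exact/measurable_EFinP.
  by move=> z; rewrite lee_fin; case/andP: (j01 z).
move=> u; rewrite /exceed_prob.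
have uu := @unit_stays_below R d n _ T0 W mW (site^~ u) (lev^~ u).
have h0 := unit_mean_ge0 P0 uu.
have h1 : \int[P0]_w stays_below W (site^~ u) (lev^~ u) w <= 1.
  have u1 : unit_fun (fun _ : T0 => (1 : R)) by split => // w; rewrite ler01 lexx.
  apply: le_trans (le_unit_mean P0 uu u1 _) _.
    by move=> w; case/andP: (stays_below_bounds W (site^~ u) (lev^~ u) w).
  by rewrite Rintegral_cst//= probability_setT/= mulr1.
by apply/andP; split; lra.
Qed.

Let TF := generated_type xi.
Let TG := generated_type (fun it : nat * 'rV[R]_d => Wi it.1 it.2).

Let mFid : measurable_fun setT (id : T -> TF).
Proof. by move=> _ A mA; rewrite setTI; exact: sigma_gen_measurable mxi mA. Qed.

Let mGid : measurable_fun setT (id : T -> TG).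
Proof.
move=> _ A mA; rewrite setTI.
by apply: (sigma_gen_measurable (f := fun it : nat * 'rV[R]_d => Wi it.1 it.2)).
Qed.

(** Averaging the marks first turns the product over the marked points into a
    product over the points, with the retention rate scaled by [q]. *)
Lemma marked_functional (q : R) : 0 <= q <= 1 ->
  \int[P]_w \prod_(i < m) (1 - q * (1 -
    stays_below (Wi i) (site^~ (xi i w)) (lev^~ (xi i w)) w)) @[m --> \oo] -->
  expR (- (q * fine (\int[lam]_u (exceed_prob u * f u)%:E)%E)).
Proof.
move=> q01; have /andP[q0 q1] := q01; have [mp p01] := unit_exceed_prob.
have mqp : measurable_fun setT (fun u => q * exceed_prob u) by exact: measurable_funM.
have qp01 u : 0 <= q * exceed_prob u <= 1.
  by have /andP[? ?] := p01 u; rewrite mulr_ge0//= mulr_ile1.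
have qE : (\int[lam]_u (q * exceed_prob u * f u)%:E =
    q%:E * \int[lam]_u (exceed_prob u * f u)%:E)%E.
  rewrite -ge0_integralZl//.
  - by apply: eq_integral => u _; rewrite -EFinM mulrA.
  - by apply/measurable_EFinP; exact: measurable_funM.
  - by move=> u _; rewrite lee_fin mulr_ge0//; case/andP: (p01 u).
have int0 : (0 <= \int[lam]_u (exceed_prob u * f u)%:E)%E.
  by apply: integral_ge0 => u _; rewrite lee_fin mulr_ge0//; case/andP: (p01 u).
have qfin : (\int[lam]_u (q * exceed_prob u * f u)%:E < +oo)%E.
  by rewrite qE; apply: lte_mul_pinfty => //; rewrite lee_fin.
have := generating_functional ppp f0 mf muE mqp qp01 qfin.
rewrite qE fineM//; last by rewrite ge0_fin_numE.
apply: cvg_trans; apply: near_eq_cvg; apply: nearW => m.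
pose g (z : TF * TG) : R := \prod_(i < m) (1 - q * (1 -
    stays_below (Wi i) (site^~ (xi i z.1)) (lev^~ (xi i z.1)) z.2)).
have ug : unit_fun g.
  apply: unit_fun_prod => i.
  have [mj j01] := @unit_stays_below_joint R d n _ TG (Wi i)
    (fun t => @measurable_generator _ _ _ _ _
      (fun it : nat * 'rV[R]_d => Wi it.1 it.2) (i : nat, t))
    _ U site lev (@cWi i) ms ml.
  split.
    apply: measurable_funB => //; apply: measurable_funM => //.
    apply: measurable_funB => //.
    apply: (measurableT_comp (f := fun z : U * TG =>
      stays_below (Wi i) (site^~ z.1) (lev^~ z.1) z.2) mj
      (g := fun z : TF * TG => (xi i z.1, z.2))).
    apply: measurable_fun_pair; last exact: measurable_snd.
    exact: measurableT_comp (@measurable_generator _ _ _ _ _ xi i) measurable_fst.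
  move=> z; have /andP[? ?] := j01 (xi i z.1, z.2).
  have ? : 0 <= 1 - stays_below (Wi i) (site^~ (xi i z.1)) (lev^~ (xi i z.1)) z.2 by lra.
  by apply/andP; split; nra.
pose ida : {mfun T >-> TF} := mfun_Sub (mem_set mFid).
pose idb : {mfun T >-> TG} := mfun_Sub (mem_set mGid).
have := @unit_mean_decoupling _ _ _ P _ _ TF TG ida idb g.
move=> /(_ (fun A B mA mB => hind mA mB) ug) /= dec.
rewrite [RHS]dec; apply: eq_Rintegral => v _; apply/esym.
exact: (mean_prod_marks m (fun i => xi i v) q01).
Qed.

Let stay i (w : T) : R :=
  stays_below (Wi i) (site^~ (xi i w)) (lev^~ (xi i w)) w.

Let measurable_stay i : measurable_fun setT (stay i).
Proof.
have [mj _] := @unit_stays_below_joint R d n _ T (Wi i) (mWi i) _ U site lev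
  (@cWi i) ms ml.
have mp : measurable_fun setT (fun w => (xi i w, w)).
  by apply: measurable_fun_pair => //; exact: measurable_id.
exact: (measurableT_comp mj mp).
Qed.

Definition exceed_count (w : T) : \bar R :=
  (\sum_(0 <= i <oo) ((stay i w == 0)%:R : R)%:E)%E.

Let stay01 i w : 1 - stay i w = (stay i w == 0)%:R.
Proof.
rewrite /stay stays_belowE; case: [forall j, _ <= _] => /=.
  by rewrite oner_eq0 subrr.
by rewrite eqxx subr0.
Qed.

Lemma measurable_exceed_count : measurable_fun setT exceed_count.
Proof.
apply: ge0_emeasurable_sum => i; first by move=> w _ _; rewrite lee_fin.
move=> _; apply/measurable_EFinP.
by under eq_fun do rewrite -stay01; exact: measurable_funB.
Qed.

Let total : R := fine (\int[lam]_u (exceed_prob u * f u)%:E)%E.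

Lemma mean_power_exceed_count (q : R) : 0 < q <= 1 ->
  \int[P]_w count_power (1 - q) (exceed_count w) = expR (- (q * total)).
Proof.
move=> /andP[q0 q1]; have q01 : 0 <= q <= 1 by rewrite ltW.
have h := @marked_functional q q01.
rewrite -(cvg_lim _ h)//; apply/esym/cvg_lim => //.
have [||//] := @unit_mean_cvg _ _ _ P
  (fun m w => \prod_(i < m) (1 - q * (1 - stay i w)))
  (fun w => count_power (1 - q) (exceed_count w)).
- move=> m; apply: unit_fun_prod => i; split.
    apply: measurable_funB => //; apply: measurable_funM => //.
    exact: measurable_funB.
  move=> w; rewrite stay01; case: (_ == _); apply/andP; split; rewrite /=; lra.
- move=> w; under eq_fun do under eq_bigr do rewrite stay01.
  by apply: (@cvg_prod_count _ (fun i => stay i w == 0)); rewrite q0.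
Qed.

Let q_unit (q : R) : 0 < q <= 1 ->
  unit_fun (fun w => count_power (1 - q) (exceed_count w)).
Proof.
move=> /andP[q0 q1]; have [|mc c01] := @unit_count_power R (1 - q).
  by apply/andP; split; lra.
by split => //; exact: (measurableT_comp mc measurable_exceed_count).
Qed.

Let measurable_count_set x : measurable [set w | exceed_count w = x].
Proof.
rewrite -[X in measurable X]setTI.
exact: measurable_exceed_count (emeasurable_set1 x).
Qed.

(** An infinite number of exceedances kills every product; letting [q] tend to
    zero, this has probability zero. *)
Lemma exceed_count_fin : P [set w | exceed_count w = +oo%E] = 0%E.
Proof.
set D := [set w | _]; have mD : measurable D by exact: measurable_count_set.
have uD : unit_fun (\1_D : T -> R) by exact: unit_fun_indic.
rewrite -unit_mean_indic//; congr EFin.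
have bound q : 0 < q <= 1 -> \int[P]_w \1_D w <= q * total.
  move=> q01; have uq := q_unit q01.
  have iD := integrable_unit P uD; have iq := integrable_unit P uq.
  have i1 : P.-integrable setT (EFin \o (fun=> 1 : R)).
    exact: finite_measure_integrable_cst.
  have : \int[P]_w count_power (1 - q) (exceed_count w) <=
      \int[P]_w (1 - \1_D w).
    apply: le_Rintegral => //; first exact: (integrableB measurableT i1 iD).
    move=> w _; rewrite indicE; have [wD|wD] := pselect (D w).
      rewrite mem_set// subrr; have -> : exceed_count w = +oo%E by [].
      by rewrite count_power_notin.
    by rewrite memNset// subr0; case: uq => _ /(_ w)/andP[].
  rewrite mean_power_exceed_count// RintegralB// Rintegral_cst//= probability_setT/=.
  rewrite mulr1 => h; have := expR_ge1Dx (- (q * total)); lra.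
have total0 : 0 <= total.
  apply: fine_ge0; apply: integral_ge0 => u _; rewrite lee_fin mulr_ge0//.
  by have [_ /(_ u)/andP[]] := unit_exceed_prob.
apply/eqP; rewrite eq_le (unit_mean_ge0 P uD) andbT leNgt; apply/negP.
set c := \int[P]_w \1_D w in bound * => c0.
have t1 : 0 < total + c + 1 by lra.
have := bound (c / (total + c + 1)); rewrite divr_gt0//= ler_pdivrMr// mul1r.
move=> /(_ ltac:(lra)); rewrite mulrAC ler_pdivlMr// ler_pM2l//; lra.
Qed.

(** The case [q = 1]: the product is then the indicator of no exceedance. *)
Lemma no_exceed_probability :
  P [set w | forall i, stays_below (Wi i) (site^~ (xi i w)) (lev^~ (xi i w)) w = 1] =
  (expR (- total))%:E.
Proof.
have := @mean_power_exceed_count 1; rewrite ltr01 lexx mul1r subrr => /(_ erefl) <-.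
have E : [set w | forall i, stay i w = 1] = [set w | exceed_count w = 0%E].
  apply/seteqP; split => w /=.
    move=> h; rewrite /exceed_count eseries0// => i _ _.
    by rewrite h oner_eq0.
  move=> h i; have := stay01 i w.
  have : (((stay i w == 0)%:R : R)%:E <= exceed_count w)%E.
    rewrite /exceed_count; apply: le_trans (nneseries_lim_ge i.+1 _).
      rewrite big_mkord big_ord_recr/=; apply: leeDr.
      by apply: sume_ge0 => k _; rewrite lee_fin.
    by move=> k _ _; rewrite lee_fin.
  rewrite h lee_fin; case: (stay i w == 0) => /=; first by rewrite ler10.
  by move=> _ /eqP; rewrite subr_eq0 => /eqP ->.
rewrite -/(stay _ _) [X in P X]E -unit_mean_indic; last exact: measurable_count_set.
congr EFin; apply: eq_Rintegral => w _; rewrite indicE.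
have [h|h] := pselect (exceed_count w = 0%E).
  by rewrite mem_set// h -[0%E]/((0%:R : R)%:E) count_power_nat.
rewrite memNset//; have [[k kE]|hk] := pselect (exists k, exceed_count w = (k%:R : R)%:E).
  rewrite kE count_power_nat expr0n; case: k kE => // kE.
by rewrite count_power_notin// => k e; apply: hk; exists k.
Qed.

End marked_process.

(** * Distribution functions and maxima *)

Section orthants.
Context {R : realType} (n : nat).
Local Notation V := (n.-tuple R).

Definition orthant (y : 'I_n -> R) : set V := [set x | forall j, tnth x j <= y j].

Definition orthants : set (set V) := [set A | exists y, A = orthant y].

Lemma measurable_orthant y : measurable (orthant y).
Proof.
rewrite (_ : orthant y = \bigcap_(j : 'I_n) ((@tnth n R)^~ j @^-1` `]-oo, y j])).
  apply: fin_bigcap_measurable; first exact: finite_finset.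
  move=> j _; rewrite -[X in measurable X]setTI.
  exact: (@measurable_tnth _ _ n j measurableT _ (measurable_itv `]-oo, y j])).
apply/seteqP; split => x /= h j; first by move=> _; rewrite /= in_itv/= h.
by have := h j I; rewrite /= in_itv.
Qed.

Lemma measurable_tupleE : @measurable _ V = <<s orthants >>.
Proof.
apply/seteqP; split; last first.
  apply: smallest_sub; first exact: sigma_algebra_measurable.
  by move=> _ [y ->]; exact: measurable_orthant.
pose S := g_sigma_algebraType orthants.
suff mid : measurable_fun setT (id : S -> V).
  by move=> A mA; have := mid measurableT A mA; rewrite setTI.
apply/measurable_fun_tnthP => j.
apply: (measurability (@RGenOInfty.G R)); first exact: RGenOInfty.measurableE.
move=> _ [_ [r ->] <-]; rewrite setTI.
have -> : ((@tnth n R)^~ j \o (id : S -> V)) @^-1` `]r, +oo[ =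
    ~` \bigcup_k orthant (fun i => if i == j then r else k%:R).
  apply/seteqP; split => x /=; rewrite in_itv/= andbT.
    by move=> xj [k _ /(_ j)]; rewrite eqxx leNgt xj.
  move=> h; rewrite ltNge; apply/negP => xj; apply: h.
  exists (Num.trunc (\sum_i `|tnth x i|)).+1 => // i.
  case: eqVneq => [->//|_]; apply: (le_trans (ler_norm _)).
  apply: le_trans (ltW (truncnS_gt _)).
  by rewrite (bigD1 i)//= lerDl sumr_ge0.
apply: measurableC; apply: bigcupT_measurable => k.
by apply: sub_sigma_algebra; exists (fun i => if i == j then r else k%:R).
Qed.

(** The orthants form a pi-system that generates the product sigma-algebra. *)
Lemma distribution_function_determines d1 d2 (T1 : measurableType d1)
    (T2 : measurableType d2) (P1 : probability T1 R) (P2 : probability T2 R)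
    (Z1 : 'I_n -> T1 -> R) (Z2 : 'I_n -> T2 -> R) (B : set V) :
  (forall j, measurable_fun setT (Z1 j)) ->
  (forall j, measurable_fun setT (Z2 j)) ->
  (forall y : 'I_n -> R, P1 [set w | forall j, Z1 j w <= y j] =
     P2 [set w | forall j, Z2 j w <= y j]) ->
  measurable B ->
  P1 [set w | B [tuple Z1 j w | j < n]] = P2 [set w | B [tuple Z2 j w | j < n]].
Proof.
move=> mZ1 mZ2 eqy mB.
have mt dS (S : measurableType dS) (Z : 'I_n -> S -> R) :
    (forall j, measurable_fun setT (Z j)) ->
    measurable_fun setT (fun w => [tuple Z j w | j < n]).
  move=> mZ; apply/measurable_fun_tnthP => j.
  rewrite (_ : _ \o _ = Z j); first exact: mZ.
  by apply/funext => w /=; rewrite tnth_mktuple.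
pose f1 : {mfun T1 >-> V} := mfun_Sub (mem_set (mt _ _ _ mZ1)).
pose f2 : {mfun T2 >-> V} := mfun_Sub (mem_set (mt _ _ _ mZ2)).
have E S (Z : 'I_n -> S -> R) y : [set w | orthant y [tuple Z j w | j < n]] =
    [set w | forall j, Z j w <= y j].
  by apply/seteqP; split => w /= h j; have := h j; rewrite tnth_mktuple.
have := @measure_unique _ R V orthants (fun k => orthant (fun=> k%:R))
  measurable_tupleE _ _ _ (distribution P1 f1) (distribution P2 f2).
apply => //.
- move=> _ _ [y ->] [z ->]; exists (fun j => Num.min (y j) (z j)).
  apply/seteqP; split => x /=; rewrite /orthant/=.
    by move=> [h1 h2] j; rewrite le_min h1 h2.
  by move=> h; split => j; have := h j; rewrite le_min => /andP[].
- by move=> k; exists (fun=> k%:R).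
- apply/seteqP; split => // x _.
  exists (Num.trunc (\sum_i `|tnth x i|)).+1 => // i.
  apply: (le_trans (ler_norm _)); apply: le_trans (ltW (truncnS_gt _)).
  by rewrite (bigD1 i)//= lerDl sumr_ge0.
- by move=> _ [y ->]; have := eqy y; rewrite -(E T1 Z1 y) -(E T2 Z2 y).
- by move=> k; rewrite -ge0_fin_numE// fin_num_measure//; exact: measurable_orthant.
Qed.

End orthants.

Section maximum_of_sequence.
Context {R : realType}.
Implicit Types (u : nat -> R).

Lemma is_max_unique u m m' : is_max u m -> is_max u m' -> m = m'.
Proof.
by move=> [im um] [im' um']; apply/eqP; rewrite eq_le um' ?um.
Qed.

Lemma max_seqE u m : is_max u m -> max_seq u = m.
Proof.
move=> um; have ex : exists m', is_max u m' by exists m.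
exact: is_max_unique (xgetPex 0 ex) um.
Qed.

Lemma is_max_at u i : (forall k, u k <= u i) -> is_max u (u i).
Proof. by move=> h; split; [exists i|move=> _ [k _ <-]]. Qed.

Lemma max_seq_le u y : (exists m, is_max u m) -> max_seq u <= y <-> forall i, u i <= y.
Proof.
move=> [m um]; rewrite (max_seqE um); have [[i _ im] ub] := um; split => [my k|].
  by apply: le_trans my; apply: ub; exists k.
by rewrite -im.
Qed.

(** A sequence that eventually falls below every level has only finitely many terms
    that compete with the first one. *)
Lemma exists_max u : (forall K : nat, exists m0, forall i, (m0 <= i)%N -> u i <= - K%:R) ->
  exists m, is_max u m.
Proof.
move=> tail; have [m0 hm0] := tail (Num.trunc `|u 0%N|).+1.
have u0 : - (Num.trunc `|u 0%N|).+1%:R < u 0%N.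
  by rewrite ltrNl (le_lt_trans (ler_norm _))// normrN truncnS_gt.
have m0_gt0 : (0 < m0)%N.
  by rewrite lt0n; apply/eqP => e; have := hm0 0%N; rewrite e leNgt u0 => /(_ isT).
case: (@arg_maxP _ _ _ (Ordinal m0_gt0) predT (fun i : 'I_m0 => u i) isT) => i _ hi.
exists (u i); apply: is_max_at => k; have [km|mk] := ltnP k m0.
  exact: (hi (Ordinal km)).
apply: le_trans (hi (Ordinal m0_gt0) isT); apply: le_trans (hm0 _ mk) (ltW u0).
Qed.

Lemma measurable_max_seq dT (T : measurableType dT) (u : nat -> T -> R) :
  (forall i, measurable_fun setT (u i)) ->
  measurable_fun setT (fun w => max_seq (u^~ w)).
Proof.
move=> mu _ B mB; rewrite setTI.
pose M i := [set w | forall k, u k w <= u i w].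
have mM i : measurable (M i).
  rewrite (_ : M i = \bigcap_k [set w | u k w <= u i w]).
    apply: bigcapT_measurable => k.
    rewrite (_ : [set w | _] = (fun w => u k w - u i w) @^-1` `]-oo, 0]).
      rewrite -[X in measurable X]setTI.
      exact: (measurable_funB (mu k) (mu i) measurableT (measurable_itv _)).
    by apply/seteqP; split => w /=; rewrite in_itv/= subr_le0.
  by apply/seteqP; split => w h k; [move=> _; exact: h|exact: (h k I)].
have -> : (fun w => max_seq (u^~ w)) @^-1` B =
    (~` (\bigcup_i M i) `&` [set w | B 0]) `|` \bigcup_i (M i `&` (u i @^-1` B)).
  apply/seteqP; split => w /=.
    have [[i hi] Bw|h Bw] := pselect (exists i, M i w).
      by right; exists i => //; split => //=; rewrite -(max_seqE (is_max_at hi)).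
    left; split; first by move=> [i _ hi]; apply: h; exists i.
    move: Bw; rewrite /max_seq xgetPN// => m [[i _ im] ub]; apply: h.
    by exists i => k; rewrite im; apply: ub; exists k.
  move=> [[h B0]|[i _ [hi Bi]]].
    rewrite /max_seq xgetPN// => m [[i _ im] ub]; apply: h.
    by exists i => // k; rewrite im; apply: ub; exists k.
  by rewrite (max_seqE (is_max_at hi)).
apply: measurableU.
  apply: measurableI; first by apply: measurableC; exact: bigcupT_measurable.
  have [B0|B0] := pselect (B 0).
    by rewrite (_ : [set w | B 0] = setT)//; apply/seteqP; split.
  by rewrite (_ : [set w | B 0] = set0)//; apply/seteqP; split.
apply: bigcupT_measurable => i; apply: measurableI => //.
by rewrite -[X in measurable X]setTI; exact: mu.
Qed.

End maximum_of_sequence.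

(** * The maximum of the marked process *)

Section heights.
Context {R : realType} (d : nat) (gamma : 'rV[R]_d -> R).
Context d0 (T0 : measurableType d0) (P0 : probability T0 R) (W : 'rV[R]_d -> T0 -> R).
Context dT (T : measurableType dT) (P : probability T R)
  (Wi : nat -> 'rV[R]_d -> T -> R).
Hypotheses (hW : brown_resnick_field P0 W gamma)
  (hWi : independent_copies P0 W P Wi).
Local Notation sigma2 := (field_variance P0 W).
Local Notation leb := (@lebesgue_measure R).

Let mW : random_field W. Proof. by case: hW => -[]. Qed.
Let cW : continuous_paths W. Proof. by case: hW => -[]. Qed.
Let mWi i t : measurable_fun setT (Wi i t).
Proof. by case: hWi => h _ _ _; exact: h. Qed.
Let cWi i w : continuous (fun t => Wi i t w).
Proof. by case: hWi => _ h _ _; exact: h. Qed.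

Lemma measurable_field_variance :
  measurable_fun setT (sigma2 : borel_rV R d -> R).
Proof.
rewrite (_ : sigma2 = fine \o (fubini_F P0
    (fun z : borel_rV R d * T0 => (W z.1 z.2 ^+ 2)%:E))); last first.
  by apply/funext => t /=; rewrite /fubini_F (field_varianceE hW).
apply: (measurableT_comp (fine_measurable _)) => //.
apply: (measurable_fun_fubini_tonelli_F (m2 := P0)
  (fun z : borel_rV R d * T0 => (W z.1 z.2 ^+ 2)%:E)).
  by apply/measurable_EFinP; apply: measurable_funX; exact: measurable_evaluation.
by move=> z; rewrite lee_fin sqr_ge0.
Qed.

(** The exceedance mass integrates over the height for a fixed path of the field;
    here the path is averaged out first, at a fixed height [x] of the point. *)
Lemma exceedance_mass_levels n (v : 'I_n -> 'rV[R]_d) (y : 'I_n -> R) :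
  (\int[leb]_x ((1 - \int[P0]_w stays_below W v
     (fun j => y j - x + sigma2 (v j) / 2) w) * expR (- x))%:E =
   exceedance_mass P0 W v y)%E.
Proof.
have E x w : stays_below W v (fun j => y j - x + sigma2 (v j) / 2) w =
    no_exceed y (fun j => drifted P0 W (v j) w) x.
  apply: eq_bigr => j _; rewrite !indicE; congr ((_ : bool)%:R).
  apply/idP/idP; rewrite !inE/= !in_itv/= /drifted => ?; lra.
have mn := @measurable_no_exceed _ T0 R n y (fun j => drifted P0 W (v j))
  (fun j => measurable_drifted hW (v j)).
rewrite /exceedance_mass /gumbel_mass
  (@fubini_tonelli _ _ _ _ _ P0 leb (fun p : T0 * R => (expR (- p.2) *
  (1 - no_exceed y (fun j => drifted P0 W (v j) p.1) p.2))%:E)); last 2 first.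
- apply/measurable_EFinP; apply: measurable_funM.
    exact: measurableT_comp measurable_expRN measurable_snd.
  exact: measurable_funB.
- move=> p; rewrite lee_fin mulr_ge0 ?expR_ge0// subr_ge0.
  by case/andP: (no_exceed_bounds y (fun j => drifted P0 W (v j) p.1) p.2).
apply: eq_integral => x _ /=.
have us := unit_stays_below mW v (fun j => y j - x + sigma2 (v j) / 2).
under [RHS]eq_integral do rewrite -E EFinM.
have i1 : P0.-integrable setT (EFin \o (fun=> 1 : R)).
  exact: finite_measure_integrable_cst.
have i2 := integrable_unit P0 us.
rewrite ge0_integralZl//; last 2 first.
- by apply/measurable_EFinP; apply: measurable_funB => //; case: us.
- by move=> w _; rewrite lee_fin subr_ge0; case/andP: (us.2 w).
rewrite EFinM muleC; congr (_ * _)%E.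
rewrite EFinB unit_meanE//.
rewrite [RHS](_ : _ = \int[P0]_w ((1 : R)%:E - (stays_below W v (fun j => y j - x + sigma2 (v j) / 2) w)%:E))%E//.
by rewrite integralB// integral_cst//= probability_setT mule1.
Qed.

Context dU (U : measurableType dU) (xi : nat -> T -> U) (mu : set U -> \bar R).
Hypotheses (ppp : poisson_point_process P xi mu)
  (hind : independent2 P (sigma_gen xi)
     (sigma_gen (fun it : nat * 'rV[R]_d => Wi it.1 it.2))).
Context (lam : {measure set U -> \bar R}) (x : U -> R) (h : U -> borel_rV R d).
Hypotheses (mx : measurable_fun setT x) (mh : measurable_fun setT h)
  (muE : forall A, measurable A -> mu A = (\int[lam]_(u in A) (expR (- x u))%:E)%E).
Hypothesis massE : forall n (t : 'I_n -> 'rV[R]_d) (y : 'I_n -> R), 'I_n ->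
  (\int[lam]_u ((1 - \int[P0]_w stays_below W (fun j => t j - (h u : 'rV[R]_d))
     (fun j => (y j - x u + sigma2 (t j - (h u : 'rV[R]_d)) / 2)%R) w)
     * expR (- x u))%:E = exceedance_mass P0 W t y)%E.

Let mxi i : measurable_fun setT (xi i). Proof. by case: ppp. Qed.

Definition height (t : 'rV[R]_d) (w : T) (i : nat) : R :=
  x (xi i w) + Wi i (t - (h (xi i w) : 'rV[R]_d)) w
    - sigma2 (t - (h (xi i w) : 'rV[R]_d)) / 2.

Let measurable_site t :
  measurable_fun setT ((fun u => t - (h u : 'rV[R]_d)) : U -> borel_rV R d).
Proof. exact: measurableT_comp (measurable_subrV t) mh. Qed.

Let measurable_level (t : 'rV[R]_d) (y : R) :
  measurable_fun setT (fun u => y - x u + sigma2 (t - (h u : 'rV[R]_d)) / 2).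
Proof.
apply: measurable_funD; first exact: measurable_funB.
apply: measurable_funM => //.
exact: measurableT_comp measurable_field_variance (measurable_site t).
Qed.

Lemma measurable_height t i : measurable_fun setT (fun w => height t w i).
Proof.
have ms := measurableT_comp (measurable_site t) (mxi i).
have mp := measurable_fun_pair ms (@measurable_id _ T setT).
apply: measurable_funB; last first.
  apply: measurable_funM => //.
  exact: measurableT_comp measurable_field_variance ms.
apply: measurable_funD; first exact: measurableT_comp mx (mxi i).
exact: (measurableT_comp (measurable_evaluation (mWi i) (@cWi i)) mp).
Qed.

Lemma stays_below_height n (t : 'I_n -> 'rV[R]_d) (y : 'I_n -> R) i w :
  stays_below (Wi i) (fun j => t j - (h (xi i w) : 'rV[R]_d))
    (fun j => y j - x (xi i w) + sigma2 (t j - (h (xi i w) : 'rV[R]_d)) / 2) w =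
  [forall j, height (t j) w i <= y j]%:R.
Proof.
rewrite stays_belowE; congr ((_ : bool)%:R); apply: eq_forallb => j.
by rewrite /height; apply/idP/idP => ?; lra.
Qed.

Let mass_fin n (t : 'I_n -> 'rV[R]_d) (y : 'I_n -> R) (j : 'I_n) :
  (\int[lam]_u (exceed_prob P0 W (fun j u => (t j - (h u : 'rV[R]_d)) : borel_rV R d)
     (fun j u => (y j - x u + sigma2 (t j - (h u : 'rV[R]_d)) / 2)%R) u
     * expR (- x u))%:E < +oo)%E.
Proof. by rewrite massE//; exact: (exceedance_mass_fin hW _ _ j). Qed.

Let mf : measurable_fun setT (fun u => expR (- x u)).
Proof. exact: measurableT_comp measurable_expRN mx. Qed.

(** Almost surely only finitely many points exceed a given level, hence the heights tend to
    minus infinity. *)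
Lemma max_attained t : {ae P, forall w, exists m, is_max (height t w) m}.
Proof.
suff tail : {ae P, forall w, forall K : nat, exists m0, forall i, (m0 <= i)%N ->
    height t w i <= - K%:R}.
  by apply: filterS tail => w; exact: exists_max.
apply/ae_foralln => K.
pose site (j : 'I_1) (u : U) : borel_rV R d := t - (h u : 'rV[R]_d).
pose lev (j : 'I_1) (u : U) : R := - K%:R - x u + sigma2 (t - (h u : 'rV[R]_d)) / 2.
have fin := @mass_fin 1 (fun=> t) (fun=> - K%:R) ord0.
have := @exceed_count_fin R d _ T0 P0 W _ T P Wi mW cW hWi _ U xi mu ppp hind lam
  (fun u => expR (- x u)) (fun u => expR_ge0 _) mf muE 1 site lev
  (fun j => measurable_site t) (fun j => measurable_level t (- K%:R)) fin.
have := @measurable_exceed_count R d _ T0 P0 W _ T P Wi hWi _ U xi mu ppp 1 site lev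
  (fun j => measurable_site t) (fun j => measurable_level t (- K%:R)).
set N := exceed_count _ _ _ _ => mN PN.
exists [set w | N w = +oo%E]; split => //.
  by rewrite -[X in measurable X]setTI; exact: mN (emeasurable_set1 _).
move=> w /= tailN; apply: contrapT => Nw; apply: tailN.
pose a i := stays_below (Wi i) (site^~ (xi i w)) (lev^~ (xi i w)) w == 0.
have [[k [m0 hm0]]|unb] := bool_count_cases a.
  exists m0 => i m0i; rewrite leNgt; apply/negP => hi.
  have ai : a i.
    rewrite /a (@stays_below_height 1 (fun=> t) (fun=> - K%:R)).
    rewrite (_ : [forall j, _] = false)//; apply/negbTE/forallPn; exists ord0.
    by rewrite -ltNge.
  have e1 : (\sum_(j < i) (a j : nat) = k)%N := hm0 _ m0i.
  have : (\sum_(j < i.+1) (a j : nat) = k)%N := hm0 _ (leqW m0i).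
  by rewrite big_ord_recr/= e1 ai => /eqP; rewrite addn1 gtn_eqF.
exfalso; apply: Nw; rewrite /N /exceed_count.
apply/cvg_lim => //; apply/cvgeyPge => A.
have [m0 hm0] := unb (Num.trunc `|A|).+1; exists m0 => // m /= mm.
rewrite big_mkord sumEFin -natr_sum lee_fin.
apply: (le_trans (ler_norm A)); apply: (le_trans (ltW (truncnS_gt _))).
by rewrite ler_nat hm0.
Qed.

Lemma measurable_max_height t : measurable_fun setT (fun w => max_seq (height t w)).
Proof. by apply: (measurable_max_seq (u := fun i w => height t w i)) => i; exact: measurable_height. Qed.

(** Where the maxima are attained, they stay below the levels [y] exactly when no
    marked point exceeds, which is a void probability. *)
Lemma max_height_distribution n (t : 'I_n -> 'rV[R]_d) (y : 'I_n -> R) (i0 : 'I_n) :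
  P [set w | forall j, max_seq (height (t j) w) <= y j] =
  (expR (- fine (exceedance_mass P0 W t y)))%:E.
Proof.
pose site (j : 'I_n) (u : U) : borel_rV R d := t j - (h u : 'rV[R]_d).
pose lev (j : 'I_n) (u : U) : R := y j - x u + sigma2 (t j - (h u : 'rV[R]_d)) / 2.
have fin := mass_fin t y i0.
have := @no_exceed_probability R d _ T0 P0 W _ T P Wi mW cW hWi _ U xi mu ppp hind lam
  (fun u => expR (- x u)) (fun u => expR_ge0 _) mf muE n site lev
  (fun j => measurable_site (t j)) (fun j => measurable_level (t j) (y j)) fin.
rewrite /exceed_prob massE// => <-.
set A := [set w | _]; set B := [set w | _].
have BE : B = \bigcap_i [set w | forall j, height (t j) w i <= y j].
  apply/seteqP; split => w /=.
    move=> hB i _ j; have := hB i; rewrite stays_below_height.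
    have [/forallP hh _|_ /eqP] := boolP [forall j, height (t j) w i <= y j]; first exact: hh.
    by rewrite eq_sym oner_eq0.
  move=> hB i; rewrite stays_below_height.
  by rewrite (_ : [forall j, _] = true)//; apply/forallP => j; exact: (hB i I).
have mle (g : T -> R) r : measurable_fun setT g -> measurable [set w | g w <= r].
  move=> mg; rewrite (_ : [set w | _] = g @^-1` `]-oo, r]).
    by rewrite -[X in measurable X]setTI; exact: mg (measurable_itv _).
  by apply/seteqP; split => w /=; rewrite in_itv.
have mA : measurable A.
  rewrite (_ : A = \bigcap_j [set w | max_seq (height (t j) w) <= y j]).
    apply: fin_bigcap_measurable => // j _; apply: mle; exact: measurable_max_height.
  by apply/seteqP; split => w hw j; [move=> _; exact: hw|exact: (hw j I)].
have mB : measurable B.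
  rewrite BE; apply: bigcapT_measurable => i.
  rewrite (_ : [set w | _] = \bigcap_j [set w | height (t j) w i <= y j]).
    apply: fin_bigcap_measurable => // j _; apply: mle; exact: measurable_height.
  by apply/seteqP; split => w hw j; [move=> _; exact: hw|exact: (hw j I)].
rewrite -[A]setIT -[B]setIT -!integral_indic//.
apply: ae_eq_integral => //.
- by apply/measurable_EFinP; exact: measurable_indic.
- by apply/measurable_EFinP; exact: measurable_indic.
have ae_max : {ae P, forall w, forall j, exists m, is_max (height (t j) w) m}.
  by apply: filter_forall => j; exact: max_attained.
apply: filterS ae_max => w hmax _; congr EFin; rewrite !indicE.
congr ((_ : bool)%:R); apply/idP/idP; rewrite !inE BE => hw.
  by move=> i _ j; have := hw j; rewrite max_seq_le//; apply.
by move=> j; rewrite /= max_seq_le// => i; exact: (hw i I).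
Qed.

End heights.

(** * Invariance under random shifts *)

Section total_mass.
Context {R : realType} (d : nat) (gamma : 'rV[R]_d -> R).
Context d0 (T0 : measurableType d0) (P0 : probability T0 R) (W : 'rV[R]_d -> T0 -> R).
Hypothesis hW : brown_resnick_field P0 W gamma.
Local Notation sigma2 := (field_variance P0 W).
Local Notation leb := (@lebesgue_measure R).

(** Shifting all sites by the same vector does not change the exceedance mass, so
    that averaging over random shifts does not either. *)
Lemma exceedance_mass_shifted (Q : probability (borel_rV R d) R) n
    (t : 'I_n -> 'rV[R]_d) (y : 'I_n -> R) : 'I_n ->
  (\int[leb \x Q]_u ((1 - \int[P0]_w stays_below W
       (fun j => t j - (u.2 : 'rV[R]_d))
       (fun j => (y j - u.1 + sigma2 (t j - (u.2 : 'rV[R]_d)) / 2)%R) w)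
     * expR (- u.1))%:E = exceedance_mass P0 W t y)%E.
Proof.
move=> i0.
have mW : random_field W by case: hW => -[].
have cW : continuous_paths W by case: hW => -[].
pose site (j : 'I_n) (u : R * borel_rV R d) : borel_rV R d := t j - (u.2 : 'rV[R]_d).
pose lev (j : 'I_n) (u : R * borel_rV R d) : R :=
  y j - u.1 + sigma2 (t j - (u.2 : 'rV[R]_d)) / 2.
have ms j : measurable_fun setT (site j).
  exact: measurableT_comp (measurable_subrV (t j)) measurable_snd.
have ml j : measurable_fun setT (lev j).
  apply: measurable_funD; first by apply: measurable_funB => //; exact: measurable_fst.
  apply: measurable_funM => //.
  exact: measurableT_comp (measurable_field_variance hW) (ms j).
have [mp p01] := @unit_exceed_prob R d _ T0 P0 W mW cW _ _ n site lev ms ml.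
rewrite (@fubini_tonelli2 _ _ _ _ R leb Q (fun u : R * borel_rV R d =>
  (exceed_prob P0 W site lev u * expR (- u.1))%:E)); last 2 first.
- apply/measurable_EFinP; apply: measurable_funM => //.
  exact: measurableT_comp measurable_expRN measurable_fst.
- by move=> u; rewrite lee_fin mulr_ge0 ?expR_ge0//; case/andP: (p01 u).
rewrite -[RHS]mule1 -(@probability_setT _ _ _ Q) -integral_cst//.
apply: eq_integral => h _.
transitivity (exceedance_mass P0 W (fun j => t j - (h : 'rV[R]_d)) y).
  rewrite /fubini_G /exceed_prob.
  exact: (exceedance_mass_levels hW (fun j => t j - (h : 'rV[R]_d)) y).
apply: (exceedance_mass_variogram y i0 hW hW) => k j.
by rewrite opprB addrA subrK.
Qed.

End total_mass.

Theorem mainTheorem1 (R : realType) (d : nat)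
    (d0 : measure_display) (T0 : measurableType d0) (P0 : probability T0 R)
    (W : 'rV[R]_d -> T0 -> R) (gamma : 'rV[R]_d -> R)
    (dT : measure_display) (T : measurableType dT) (P : probability T R)
    (Wi : nat -> 'rV[R]_d -> T -> R)
    (Q : probability (borel_rV R d) R)
    (X : nat -> T -> R) (H : nat -> T -> borel_rV R d)
    (hW : brown_resnick_field P0 W gamma)
    (hWi : independent_copies P0 W P Wi)
    (hPi : poisson_point_process P (fun i w => (X i w, H i w))
             (gumbel_prod_intensity Q))
    (hind : independent2 P (sigma_gen (fun i w => (X i w, H i w)))
              (sigma_gen (fun it : nat * 'rV[R]_d => Wi it.1 it.2))) :
  let sigma2 := field_variance P0 W in
  let xi (t : 'rV[R]_d) (w : T) (i : nat) : R :=
    X i w + Wi i (t - (H i w : 'rV[R]_d)) w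
      - sigma2 (t - (H i w : 'rV[R]_d)) / 2 in
  let Ztilde (t : 'rV[R]_d) (w : T) : R := max_seq (xi t w) in
  [/\ random_field Ztilde,
      forall t, {ae P, forall w, exists m, is_max (xi t w) m} &
      forall (dT' : measure_display) (T' : measurableType dT')
        (P' : probability T' R) (Z : 'rV[R]_d -> T' -> R),
        brown_resnick_process gamma P' Z -> eq_fdd P Ztilde P' Z].
Proof.
move=> sigma2 xi Ztilde.
(* Lebesgue measure lives on [measurableTypeR R], which has the same measurable sets
   as [R] but another display; the point processes are read there. *)
pose U := (measurableTypeR R * borel_rV R d)%type.
pose pts i w : U := (X i w, H i w).
have ppp : @poisson_point_process _ T R P _ U pts (gumbel_prod_intensity Q) by exact: hPi.
have ind : independent2 P (@sigma_gen _ T _ U _ pts)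
  (sigma_gen (fun it : nat * 'rV[R]_d => Wi it.1 it.2)) by exact: hind.
have mfst : measurable_fun setT (fst : U -> R) by exact: measurable_fst.
have msnd : measurable_fun setT (snd : U -> borel_rV R d) by exact: measurable_snd.
have muE (A : set U) : measurable A -> gumbel_prod_intensity Q A =
    (\int[(lebesgue_measure \x Q)%E]_(u in A) (expR (- (u.1 : R)))%:E)%E by [].
pose lam := [the measure U R of
  @product_measure1 _ _ (measurableTypeR R) (borel_rV R d) R lebesgue_measure Q].
have massE m (v : 'I_m -> 'rV[R]_d) (y : 'I_m -> R) (i : 'I_m) :=
  exceedance_mass_shifted hW Q v y i.
have mZt : random_field Ztilde.
  by move=> t; exact: (measurable_max_height hW hWi ppp mfst msnd t).
split=> // [t|dT' T' P' Z].
  exact: (@max_attained R d gamma _ T0 P0 W _ T P Wi hW hWi _ _ pts _ ppp ind lam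
    fst snd mfst msnd muE massE t).
move=> [d0'] [T0'] [P0'] [Y] [Yi] [X'] [hY hYi hX indX ZE] n t B mB.
(* The Brown-Resnick construction is the one with all shifts equal to zero. *)
pose origin (u : measurableTypeR R) : borel_rV R d := (0 : 'rV[R]_d).
pose level (u : measurableTypeR R) : R := u.
have morigin : measurable_fun setT origin by exact: measurable_cst.
have mlevel : measurable_fun setT level by exact: measurable_id.
have ppp' : @poisson_point_process _ T' R P' _ (measurableTypeR R) X'
  (@gumbel_intensity R) by exact: hX.
have ind' : independent2 P' (@sigma_gen _ T' _ (measurableTypeR R) _ X')
  (sigma_gen (fun it : nat * 'rV[R]_d => Yi it.1 it.2)) by exact: indX.
have muE' (A : set (measurableTypeR R)) : measurable A -> gumbel_intensity A =
    (\int[lebesgue_measure]_(u in A) (expR (- level u))%:E)%E by [].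
have massE' m (v : 'I_m -> 'rV[R]_d) (y : 'I_m -> R) : 'I_m ->
    (\int[lebesgue_measure]_u ((1 - \int[P0']_w stays_below Y
       (fun j => v j - (origin u : 'rV[R]_d)) (fun j => (y j - level u +
         field_variance P0' Y (v j - (origin u : 'rV[R]_d)) / 2)%R) w)
     * expR (- level u))%:E = exceedance_mass P0' Y v y)%E.
  move=> _; rewrite -[in RHS](_ : (fun j => v j - 0) = v).
    exact: (exceedance_mass_levels hY (fun j => v j - 0) y).
  by apply/funext => j; rewrite subr0.
have ZE' s w : Z s w = max_seq (height P0' Y Yi X' level origin s w).
  by rewrite ZE; congr max_seq; apply/funext => i; rewrite /height subr0.
have mZ s : measurable_fun setT (Z s).
  have -> : Z s = fun w => max_seq (height P0' Y Yi X' level origin s w) by exact/funext.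
  exact: (measurable_max_height hY hYi ppp' mlevel morigin s).
apply: distribution_function_determines => // y.
case: n t B y mB => [|n] t B y mB.
  have full S (V : 'I_0 -> S -> R) : [set w | forall j, V j w <= y j] = setT.
    by apply/seteqP; split => // w _ [].
  by rewrite !full; transitivity (1%E : \bar R); first exact: probability_setT;
    apply/esym; exact: probability_setT.
have := @max_height_distribution R d gamma _ T0 P0 W _ T P Wi hW hWi _ _ pts _ ppp
  ind lam fst snd mfst msnd muE massE _ t y ord0.
have := @max_height_distribution R d gamma _ T0' P0' Y _ T' P' Yi hY hYi _
  (measurableTypeR R) X' _ ppp' ind' lebesgue_measure level origin mlevel morigin muE' massE' _ t y ord0.
rewrite (exceedance_mass_variogram y ord0 hW hY (u2 := t))// => <- E.
rewrite [LHS]E; congr (P' _); apply/seteqP; split => w /= h j; have := h j; by rewrite ZE'.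
Qed.
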